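(* Let $G$ be a $2$-connected infinite graph (of arbitrary infinite cardinality). Then $G$ contains, as an induced subgraph, one of the following: $K_\infty$; an infinite clean ladder; or a member of one of the families $\Theta_\infty$, $\mathscr{F}_\infty$, $\mathscr{F}_\infty^{\Delta}$, $\mathscr{L}_\infty$, $\mathscr{L}^{\Delta}_\infty$, $\mathscr{L}^{\nabla\Delta}_\infty$.
   Context: All graphs are simple. An infinite graph is connected if any two vertices are joined by a finite path; it is $2$-connected if $G-v$ is connected for every vertex $v$. Subdividing an edge means replacing it by a path; each edge may be subdivided only finitely many times. A ray $p_1p_2p_3\dots$ is a one-way infinite path with initial vertex $p_1$; for vertices $a,b$ of a ray we write $a\le b$ if $a$ lies on the subpath from the initial vertex to $b$. Two rays are in the same end if there are infinitely many pairwise disjoint paths joining them. $K_\infty$ is the countably infinite complete graph. $\Theta_\infty$: graphs consisting of two specified vertices together with countably infinitely many pairwise internally disjoint paths between them (and nothing else). $F_\infty$: a vertex (apex) adjacent to every vertex of a ray (rim); $\mathscr{F}_\infty$: graphs obtained from $F_\infty$ by subdividing each edge an arbitrary (finite, possibly zero) number of times. $F^\Delta_\infty$: take an apex $v$, vertices $v_1,v_2,\dots$ and a ray $p_1p_2p_3\dots$, with edges $vv_i$, $v_ip_{2i-1}$, $v_ip_{2i}$ for all $i\ge1$; $\mathscr{F}^\Delta_\infty$: graphs obtained from $F^\Delta_\infty$ by subdividing each edge $vv_i$ and each edge $p_{2j}p_{2j+1}$ an arbitrary (finite, possibly zero) number of times. Ties: let $P,Q$ be disjoint rays in a graph $L$.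 A tie of $P\cup Q$ is a connected component $J$ of the graph obtained from $L$ by deleting the edges of $P$ and $Q$ (keeping all vertices) such that $J$ contains a vertex of $P$ and a vertex of $Q$; these vertices are its vertices of attachment. The $P$-span of $J$ is the subpath of $P$ between its leftmost and rightmost attachment vertices on $P$, similarly for the $Q$-span. $J$ is of type $I$ if it has exactly one attachment vertex $p$ on $P$ and one $q$ on $Q$ and its edges form a $pq$-path induced in $J$. $J$ is of type $Y$ if its $P$-span is a single edge $p^\ell p^r$, its $Q$-span is a single vertex $q$, some vertex $u$ of $J$ not on $P\cup Q$ is adjacent to both $p^\ell$ and $p^r$, and all vertices of $J$ other than $p^\ell,p^r$ lie on a $uq$-path induced in $J$. Type $\lambda$ is the same with the roles of $P$ and $Q$ exchanged. $J$ is of type $Y\text{-}\lambda$ if its $P$-span is a single edge $p^\ell p^r$, its $Q$-span is a single edge $q^\ell q^r$, there are vertices $u,v$ of $J$ not on $P\cup Q$ with $u$ adjacent to $p^\ell,p^r$ and $v$ adjacent to $q^\ell,q^r$, and all other vertices of $J$ lie on a $uv$-path induced in $J$. $\mathscr{L}_\infty$: graphs $L$ with two disjoint induced rays $P,Q$ such that all vertices and edges of $L$ not on $P$ or $Q$ belong to (infinitely many) ties of $P\cup Q$ of type $I$, one of which joins the initial vertices of $P$ and $Q$. $\mathscr{L}^\Delta_\infty$: same, but either all ties are of type $Y$ (with one of type $Y$ joining the initial vertices) or all are of type $\lambda$ (with one of type $\lambda$ joining the initial vertices). $\mathscr{L}^{\nabla\Delta}_\infty$: same, with all ties of type $Y\text{-}\lambda$,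 one joining the initial vertices. Ladders: an infinite messy ladder is a triple $(L,W,X)$ where $L$ is a locally finite graph all of whose vertices lie on two disjoint induced rays $W,X$ (rails) of $L$ which are in the same end of $L$, and $L$ has an edge between the initial vertices of $W$ and $X$; edges not on $W$ or $X$ are rungs, and for a rung $e$ let $e_W,e_X$ be its ends on $W,X$. Rungs $e,f$ form a cross $(e,f)$ if $e_W<f_W$ and $f_X<e_X$; the cross is degenerate if $W[e_W,f_W]$ and $X[f_X,e_X]$ are both single edges. An infinite clean ladder is an infinite messy ladder all of whose crosses are degenerate. *)

(* Defs.v *)
From Stdlib Require Import List FinFun Arith.
Import ListNotations.

(** * Graphs *)

Record graph : Type := Graph {
  vertex :> Type;
  adj : vertex -> vertex -> Prop;
  adj_sym : forall x y, adj x y -> adj y x;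
  adj_irrefl : forall x, ~ adj x x
}.
Arguments adj {g} x y.

Definition infinite (G : graph) : Prop := ~ Finite G.

Definition locally_finite (G : graph) : Prop :=
  forall x : G, exists l : list G, forall y, adj x y -> In y l.

Definition induced (G : graph) (S : G -> Prop) : graph :=
  {| vertex := {x : G | S x};
     adj := fun x y => adj (proj1_sig x) (proj1_sig y);
     adj_sym := fun x y => adj_sym G (proj1_sig x) (proj1_sig y);
     adj_irrefl := fun x => adj_irrefl G (proj1_sig x) |}.

(** [H] is, up to isomorphism, an induced subgraph of [G]. *)
Definition induced_subgraph (H G : graph) : Prop :=
  exists f : H -> G, Injective f /\ forall x y, adj (f x) (f y) <-> adj x y.

(** * Finite paths, connectedness *)

(** A path is given by the list of its vertices. *)
Definition path_edge {V : Type} (l : list V) (x y : V) : Prop :=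
  exists l1 l2, l = l1 ++ x :: y :: l2 \/ l = l1 ++ y :: x :: l2.

Definition path_between (G : graph) (x y : G) (l : list G) : Prop :=
  NoDup l /\ hd_error l = Some x /\ last l x = y /\
  forall u v, path_edge l u v -> adj u v.

Definition joined (G : graph) (x y : G) : Prop :=
  exists l, path_between G x y l.

Definition connected (G : graph) : Prop := forall x y : G, joined G x y.

Definition two_connected (G : graph) : Prop :=
  forall v : G, connected (induced G (fun x => x <> v)).

Definition component (G : graph) (J : G -> Prop) : Prop :=
  exists x, forall y, J y <-> joined G x y.

(** * Rays *)

Definition ray (G : graph) (P : nat -> G) : Prop :=
  Injective P /\ forall i, adj (P i) (P (S i)).

Definition on_ray {V : Type} (P : nat -> V) (x : V) : Prop :=
  exists i, x = P i.

Definition ray_edge {V : Type} (P : nat -> V) (x y : V) : Prop :=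
  exists i, (x = P i /\ y = P (S i)) \/ (y = P i /\ x = P (S i)).

Definition induced_ray (G : graph) (P : nat -> G) : Prop :=
  ray G P /\ forall i j, adj (P i) (P j) -> ray_edge P (P i) (P j).

Definition disjoint_rays {V : Type} (P Q : nat -> V) : Prop :=
  forall i j, P i <> Q j.

Definition same_end (G : graph) (P Q : nat -> G) : Prop :=
  exists l : nat -> list G,
    (forall n, exists i j, path_between G (P i) (Q j) (l n)) /\
    (forall m n x, In x (l m) -> In x (l n) -> m = n).

(** * Subdivisions *)

(** [H] is obtained from [B] by replacing each edge [uv] by the path
    [phi u :: p u v ++ [phi v]], where only the edges satisfying [S] may
    receive new vertices. *)
Definition subdivision (B : graph) (S : B -> B -> Prop) (H : graph) : Prop :=
  exists (phi : B -> H) (p : B -> B -> list H),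
    Injective phi /\
    (forall u v, adj u v ->
       path_between H (phi u) (phi v) (phi u :: p u v ++ [phi v])) /\
    (forall u v, adj u v -> p v u = rev (p u v)) /\
    (forall u v, adj u v -> ~ S u v -> p u v = []) /\
    (forall u v w, adj u v -> ~ In (phi w) (p u v)) /\
    (forall u v u' v' x, adj u v -> adj u' v' ->
       In x (p u v) -> In x (p u' v') ->
       (u = u' /\ v = v') \/ (u = v' /\ v = u')) /\
    (forall x, (exists u, x = phi u) \/
               (exists u v, adj u v /\ In x (p u v))) /\
    (forall x y, adj x y ->
       exists u v, adj u v /\ path_edge (phi u :: p u v ++ [phi v]) x y).

(** * The infinite complete graph, thetas and fans *)

Definition K_infty : graph :=
  {| vertex := nat;
     adj := fun i j => i <> j;
     adj_sym := fun i j => @not_eq_sym nat i j;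
     adj_irrefl := fun i h => h eq_refl |}.

(** [p n] lists the interior vertices of the [n]-th path. As the paths are
    distinct, at most one of them is a single edge. *)
Definition Theta_infty (H : graph) : Prop :=
  exists (a b : H) (p : nat -> list H),
    a <> b /\
    (forall n, path_between H a b (a :: p n ++ [b])) /\
    (forall m n, m <> n -> p m <> p n) /\
    (forall m n x, In x (p m) -> In x (p n) -> m = n) /\
    (forall x, x = a \/ x = b \/ exists n, In x (p n)) /\
    (forall x y, adj x y -> exists n, path_edge (a :: p n ++ [b]) x y).

Inductive fan_vertex : Set := fan_apex | fan_rim (i : nat).

Definition fan_adj (x y : fan_vertex) : Prop :=
  match x, y with
  | fan_apex, fan_rim _ | fan_rim _, fan_apex => True
  | fan_rim i, fan_rim j => j = S i \/ i = S j
  | fan_apex, fan_apex => False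
  end.

Lemma fan_adj_sym x y : fan_adj x y -> fan_adj y x.
Proof. destruct x, y; simpl; tauto. Qed.

Lemma fan_adj_irrefl x : ~ fan_adj x x.
Proof.
  destruct x as [|i]; simpl; [tauto|].
  intros [h|h]; exact (n_Sn i h).
Qed.

Definition F_infty_graph : graph := Graph fan_vertex fan_adj fan_adj_sym fan_adj_irrefl.

Definition F_infty (H : graph) : Prop :=
  subdivision F_infty_graph (fun _ _ => True) H.

(** Indices start at 0: [tfan_spoke i] is v_(i+1) and [tfan_rim k] is
    p_(k+1), so that v_(i+1) is adjacent to the rim vertices of indices
    2i and 2i+1, and the edges p_(2j) p_(2j+1) (j >= 1) join the rim vertices
    of indices 2i+1 and 2i+2 (i >= 0). *)
Inductive tfan_vertex : Set :=
  tfan_apex | tfan_spoke (i : nat) | tfan_rim (k : nat).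

Definition tfan_adj (x y : tfan_vertex) : Prop :=
  match x, y with
  | tfan_apex, tfan_spoke _ | tfan_spoke _, tfan_apex => True
  | tfan_spoke i, tfan_rim k | tfan_rim k, tfan_spoke i =>
      k = 2 * i \/ k = 2 * i + 1
  | tfan_rim k, tfan_rim l => l = S k \/ k = S l
  | _, _ => False
  end.

Lemma tfan_adj_sym x y : tfan_adj x y -> tfan_adj y x.
Proof. destruct x, y; simpl; tauto. Qed.

Lemma tfan_adj_irrefl x : ~ tfan_adj x x.
Proof.
  destruct x as [|i|k]; simpl; try tauto.
  intros [h|h]; exact (n_Sn k h).
Qed.

Definition F_Delta_graph : graph :=
  Graph tfan_vertex tfan_adj tfan_adj_sym tfan_adj_irrefl.

Definition F_Delta_subdividable (x y : tfan_vertex) : Prop :=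
  match x, y with
  | tfan_apex, tfan_spoke _ | tfan_spoke _, tfan_apex => True
  | tfan_rim k, tfan_rim l =>
      exists i, (k = 2 * i + 1 /\ l = 2 * i + 2) \/
                (l = 2 * i + 1 /\ k = 2 * i + 2)
  | _, _ => False
  end.

Definition F_Delta_infty (H : graph) : Prop :=
  subdivision F_Delta_graph F_Delta_subdividable H.

(** * Ties *)

Section DeleteRayEdges.
Context (L : graph) (P Q : nat -> L).

Definition off_rays_adj (x y : L) : Prop :=
  adj x y /\ ~ ray_edge P x y /\ ~ ray_edge Q x y.

Lemma off_rays_adj_sym x y : off_rays_adj x y -> off_rays_adj y x.
Proof.
  intros [h [hP hQ]]; split; [now apply adj_sym|split].
  - intros [i hi]; apply hP; exists i; tauto.
  - intros [i hi]; apply hQ; exists i; tauto.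
Qed.

Lemma off_rays_adj_irrefl x : ~ off_rays_adj x x.
Proof. intros [h _]; exact (adj_irrefl L x h). Qed.

Definition delete_ray_edges : graph :=
  Graph L off_rays_adj off_rays_adj_sym off_rays_adj_irrefl.
End DeleteRayEdges.

(** A tie is represented by its vertex set [J]; as a graph it is the subgraph
    of [delete_ray_edges L P Q] induced on [J]. *)
Definition tie (L : graph) (P Q : nat -> L) (J : L -> Prop) : Prop :=
  component (delete_ray_edges L P Q) J /\
  (exists i, J (P i)) /\ (exists j, J (Q j)).

Definition tie_adj (L : graph) (P Q : nat -> L) (J : L -> Prop) (x y : L) : Prop :=
  J x /\ J y /\ off_rays_adj L P Q x y.

(** The span of [J] on the ray [P] is the subpath from [P a] to [P b]. *)
Definition span {V : Type} (P : nat -> V) (J : V -> Prop) (a b : nat) : Prop :=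
  J (P a) /\ J (P b) /\ forall i, J (P i) -> a <= i <= b.

(** [l] is a path from [x] to [y] in the graph [J], and it is induced in [J]. *)
Definition induced_path_in_tie (L : graph) (P Q : nat -> L) (J : L -> Prop)
    (x y : L) (l : list L) : Prop :=
  path_between (delete_ray_edges L P Q) x y l /\
  (forall u, In u l -> J u) /\
  (forall u v, In u l -> In v l -> tie_adj L P Q J u v -> path_edge l u v).

Definition type_I (L : graph) (P Q : nat -> L) (J : L -> Prop) : Prop :=
  exists i j l,
    (forall k, J (P k) <-> k = i) /\
    (forall k, J (Q k) <-> k = j) /\
    induced_path_in_tie L P Q J (P i) (Q j) l /\
    (forall x y, tie_adj L P Q J x y <-> path_edge l x y).

Definition type_Y (L : graph) (P Q : nat -> L) (J : L -> Prop) : Prop :=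
  exists i j u l,
    span P J i (S i) /\
    span Q J j j /\
    J u /\ ~ on_ray P u /\ ~ on_ray Q u /\
    adj u (P i) /\ adj u (P (S i)) /\
    induced_path_in_tie L P Q J u (Q j) l /\
    (forall x, J x -> x <> P i -> x <> P (S i) -> In x l).

Definition type_lambda (L : graph) (P Q : nat -> L) (J : L -> Prop) : Prop :=
  type_Y L Q P J.

Definition type_Y_lambda (L : graph) (P Q : nat -> L) (J : L -> Prop) : Prop :=
  exists i j u v l,
    span P J i (S i) /\
    span Q J j (S j) /\
    J u /\ ~ on_ray P u /\ ~ on_ray Q u /\
    J v /\ ~ on_ray P v /\ ~ on_ray Q v /\
    adj u (P i) /\ adj u (P (S i)) /\
    adj v (Q j) /\ adj v (Q (S j)) /\
    induced_path_in_tie L P Q J u v l /\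
    (forall x, J x -> x <> P i -> x <> P (S i) ->
       x <> Q j -> x <> Q (S j) -> In x l).

(** * Families of ladders built from ties *)

(** All ties are then of type [T]: a tie contains an edge not on [P] or [Q],
    and two components sharing a vertex coincide. *)
Definition ladder_with_ties
    (T : forall L : graph, (nat -> L) -> (nat -> L) -> (L -> Prop) -> Prop)
    (L : graph) : Prop :=
  exists P Q : nat -> L,
    let typed_tie J := tie L P Q J /\ T L P Q J in
    induced_ray L P /\ induced_ray L Q /\ disjoint_rays P Q /\
    (forall x, ~ on_ray P x -> ~ on_ray Q x -> exists J, typed_tie J /\ J x) /\
    (forall x y, off_rays_adj L P Q x y ->
       exists J, typed_tie J /\ tie_adj L P Q J x y) /\
    (exists J : nat -> L -> Prop,
       (forall n, typed_tie (J n)) /\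
       (forall m n, m <> n -> ~ (forall x, J m x <-> J n x))) /\
    (exists J, typed_tie J /\ J (P 0) /\ J (Q 0)).

Definition L_infty (L : graph) : Prop := ladder_with_ties type_I L.

Definition L_Delta_infty (L : graph) : Prop :=
  ladder_with_ties type_Y L \/ ladder_with_ties type_lambda L.

Definition L_nabla_Delta_infty (L : graph) : Prop :=
  ladder_with_ties type_Y_lambda L.

(** * Messy and clean ladders *)

Definition messy_ladder (L : graph) (W X : nat -> L) : Prop :=
  locally_finite L /\
  induced_ray L W /\ induced_ray L X /\ disjoint_rays W X /\
  (forall x, on_ray W x \/ on_ray X x) /\
  same_end L W X /\
  adj (W 0) (X 0).

(** As the rails are disjoint, induced and cover all vertices, a rung has one
    end on each rail; it is given by the positions of these ends. *)
Definition rung (L : graph) (W X : nat -> L) (e : nat * nat) : Prop :=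
  adj (W (fst e)) (X (snd e)).

Definition cross (L : graph) (W X : nat -> L) (e f : nat * nat) : Prop :=
  rung L W X e /\ rung L W X f /\ fst e < fst f /\ snd f < snd e.

Definition degenerate (e f : nat * nat) : Prop :=
  fst f = S (fst e) /\ snd e = S (snd f).

Definition clean_ladder (L : graph) : Prop :=
  exists W X : nat -> L,
    messy_ladder L W X /\
    forall e f, cross L W X e f -> degenerate e f.

(* Main.v *)
From Stdlib Require Import List FinFun Arith Lia Classical ClassicalEpsilon ProofIrrelevance.
Require Import Defs.
Import ListNotations.

(** If some vertex [v] has infinite degree, take a geodesic tree of [G - v] and look
    at the neighbours of [v]. Either infinitely many of them lie above distinct
    children of one vertex, which gives a theta, or they hang off a geodesic ray, which
    gives a fan. The paths involved can be taken pairwise nonadjacent: otherwise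
    Ramsey's theorem provides vertices adjacent to infinitely many of the paths and,
    as edges change the distance to the root by at most one, boundedly long paths
    between two of these vertices, which end in [K_infty] or a theta.

    If [G] is locally finite, start from a geodesic ray [R] and add to it finite paths
    so that the union [L] has only one end and two vertices of [L] are linked to
    infinity by disjoint pairs of paths in [L]. Shortest such pairs are induced and
    only have degenerate crosses, and by compactness so has a limit pair of rays
    [P], [Q]. As [L] has one end, there are disjoint [P]-[Q] paths arbitrarily far
    away. If infinitely many are rungs, the rays span a clean ladder; otherwise the
    links can be made pairwise nonadjacent, and each meets the neighbourhood of a ray
    in a vertex, in two adjacent vertices, or after rerouting the ray through its end
    vertex again in one vertex. *)

(** In the locally finite case the danger is that the two limit rays run to different ends, between
    which there are no links. This is why the paths are confined to [L]: the limit rays stay in [L],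
    whose far vertices are joined in [G] outside any given finite set. Minimality, however, is
    exploited against all edges of [G]: shortcuts and exchanges use no new vertices, so they stay in
    [L], and the limit rays are induced in [G] itself. How [L] arises depends on [R]. If some
    component of [G - R] has neighbours arbitrarily far along [R], a second geodesic ray in that
    component, joined to [R] infinitely often, gives the second path to infinity. Otherwise [R]
    receives a path jumping over each [R (S n)]; any vertex off [R] lies on only finitely many
    jumps, so no new end appears, and disjoint pairs are obtained by induction along [R] as in a
    proof of Menger's theorem. Both the fans and the ladders end with the same question, how a link
    meets a ray; the predicate [side] treats one ray at a time so that it serves both. *)

Lemma choice_fun {A B} (R : A -> B -> Prop) :
  (forall x, exists y, R x y) -> exists f, forall x, R x (f x).
Proof.
  intros H.
  exists (fun x => proj1_sig (constructive_indefinite_description _ (H x))).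
  intros x; apply proj2_sig.
Qed.

Lemma least (P : nat -> Prop) :
  (exists n, P n) -> exists n, P n /\ forall m, P m -> n <= m.
Proof.
  intros [n hn]; induction n as [n IH] using lt_wf_ind.
  destruct (classic (exists m, m < n /\ P m)) as [[m [h1 h2]]|h].
  - now apply (IH m).
  - exists n; split; [assumption|]; intros m hm.
    destruct (le_lt_dec n m); [assumption|]; exfalso; apply h; eauto.
Qed.

Lemma greatest (P : nat -> Prop) b :
  (exists n, P n) -> (forall n, P n -> n <= b) ->
  exists n, P n /\ forall m, P m -> m <= n.
Proof.
  intros [n hn] hb.
  destruct (least (fun d => d <= b /\ P (b - d))) as [d [[h1 h2] h3]].
  { exists (b - n); specialize (hb n hn); split; [lia|].
    now replace (b - (b - n)) with n by lia. }
  exists (b - d); split; [assumption|]; intros m hm.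
  pose proof (hb m hm).
  enough (d <= b - m) by lia; apply h3; split; [lia|].
  now replace (b - (b - m)) with m by lia.
Qed.

Lemma in_map_seq {T} (f : nat -> T) a n x :
  In x (map f (seq a n)) <-> exists i, a <= i < a + n /\ x = f i.
Proof.
  rewrite in_map_iff; split.
  - intros [i [h1 h2]]; apply in_seq in h2; exists i; split; [lia|easy].
  - intros [i [h1 h2]]; exists i; split; [easy|]; apply in_seq; lia.
Qed.

(** Dependent choice over the whole history. [Q] has to be satisfiable after every list, even one
    that never arises; where that would fail, the caller guards [Q] by an invariant of the list. *)
Lemma greedy {T} (Q : list T -> T -> Prop) :
  (forall l, exists x, Q l x) ->
  exists f, forall n, Q (map f (seq 0 n)) (f n).
Proof.
  intros H; destruct (choice_fun Q H) as [g hg].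
  set (pre := fix pre n := match n with 0 => [] | S n => pre n ++ [g (pre n)] end).
  exists (fun n => g (pre n)); intros n.
  replace (map (fun n => g (pre n)) (seq 0 n)) with (pre n); [apply hg|].
  induction n as [|n IH]; [reflexivity|].
  rewrite seq_S, map_app, <- IH; reflexivity.
Qed.

(** * Infinite sets and Ramsey's theorem *)

Definition unbounded (P : nat -> Prop) := forall N, exists n, N <= n /\ P n.

Definition increasing (e : nat -> nat) := forall i j, i < j -> e i < e j.

Lemma increasing_S e : (forall n, e n < e (S n)) -> increasing e.
Proof. intros h i j hij; induction hij as [|j _ IH]; [apply h|specialize (h j); lia]. Qed.

Lemma increasing_inj e i j : increasing e -> e i = e j -> i = j.
Proof.
  intros h hij; destruct (lt_eq_lt_dec i j) as [[hl|]|hl]; try assumption;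
    specialize (h _ _ hl); lia.
Qed.

Lemma increasing_ge e n : increasing e -> n <= e n.
Proof.
  intros h; induction n as [|n IH]; [lia|].
  specialize (h n (S n) (Nat.lt_succ_diag_r n)); lia.
Qed.

Lemma increasing_le e i j : increasing e -> i < j -> e (S i) <= e j.
Proof.
  intros h hij; destruct (Nat.eq_dec (S i) j) as [<-|]; [lia|].
  apply Nat.lt_le_incl, h; lia.
Qed.

Lemma increasing_comp e e' :
  increasing e -> increasing e' -> increasing (fun n => e (e' n)).
Proof. intros h h' i j hij; auto. Qed.

(** That [e] skips nothing lets [reroute] read consecutive positions off [e], and lets [direct_fan]
    account for every neighbour. *)
Lemma enumerate (P : nat -> Prop) : unbounded P ->
  exists e, increasing e /\ (forall n, P (e n)) /\ forall x, P x -> exists n, x = e n.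
Proof.
  intros H.
  destruct (choice_fun (fun N n => (N <= n /\ P n) /\ forall m, N <= m /\ P m -> n <= m))
    as [g hg].
  { intros N; apply least, H. }
  set (e := fix e n := match n with 0 => g 0 | S n => g (S (e n)) end).
  assert (hinc : increasing e).
  { apply increasing_S; intros n; destruct (hg (S (e n))) as [[h _] _]; simpl; lia. }
  assert (hP : forall n, P (e n)) by (intros [|n]; apply hg).
  exists e; repeat split; trivial.
  intros x hx.
  destruct (least (fun n => x <= e n)) as [n [h1 h2]].
  { exists x; now apply increasing_ge. }
  exists n; enough (e n <= x) by lia.
  destruct n as [|n].
  - apply (hg 0); split; [lia|assumption].
  - simpl; apply (hg (S (e n))); split; [|assumption].
    destruct (le_lt_dec x (e n)) as [hl|]; [specialize (h2 n hl); lia|lia].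
Qed.

Lemma unbounded_or (P Q : nat -> Prop) :
  unbounded (fun n => P n \/ Q n) -> unbounded P \/ unbounded Q.
Proof.
  intros H; apply NNPP; intros hn; apply not_or_and in hn as [h1 h2].
  apply not_all_ex_not in h1 as [a ha], h2 as [b hb].
  destruct (H (a + b)) as [n [hn [hp|hq]]].
  - apply ha; exists n; split; [lia|assumption].
  - apply hb; exists n; split; [lia|assumption].
Qed.

Lemma unbounded_mono (P Q : nat -> Prop) :
  (forall n, P n -> Q n) -> unbounded P -> unbounded Q.
Proof. intros h H N; destruct (H N) as [n [h1 h2]]; eauto. Qed.

Lemma unbounded_pigeonhole {C} (l : list C) (Q : C -> nat -> Prop) :
  unbounded (fun n => exists c, In c l /\ Q c n) ->
  exists c, In c l /\ unbounded (Q c).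
Proof.
  induction l as [|c l IH]; intros H.
  - destruct (H 0) as [n [_ [c [[] _]]]].
  - destruct (unbounded_or (Q c) (fun n => exists c, In c l /\ Q c n)) as [h|h].
    + revert H; apply unbounded_mono; intros n [c' [[<-|h1] h2]]; eauto.
    + exists c; split; [now left|assumption].
    + destruct (IH h) as [c' [h1 h2]]; exists c'; split; [now right|assumption].
Qed.

Lemma homogeneous (P : nat -> Prop) :
  exists e, increasing e /\ ((forall n, P (e n)) \/ (forall n, ~ P (e n))).
Proof.
  destruct (unbounded_or P (fun n => ~ P n)) as [h|h].
  - intros N; exists N; split; [lia|apply classic].
  - destruct (enumerate _ h) as [e [h1 [h2 _]]]; eauto.
  - destruct (enumerate _ h) as [e [h1 [h2 _]]]; eauto.
Qed.

(** Each chosen number is stored with a proposition recording the colour it has with all later ones;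
    [ok l x] says that [x] lies beyond the stored numbers and agrees with their colours. A
    subsequence on which the recorded colours are constant is homogeneous. *)
Lemma ramsey (C : nat -> nat -> Prop) :
  exists e, increasing e /\
    ((forall i j, i < j -> C (e i) (e j)) \/ (forall i j, i < j -> ~ C (e i) (e j))).
Proof.
  set (ok := fun (l : list (nat * Prop)) x =>
    forall a c, In (a, c) l -> a < x /\ (C a x <-> c)).
  destruct (greedy (fun l ac => unbounded (ok l) ->
    ok l (fst ac) /\ unbounded (ok (l ++ [ac])))) as [f hf].
  { intros l; destruct (classic (unbounded (ok l))) as [h|h];
      [|exists (0, True); tauto].
    destruct (h 0) as [a [_ ha]].
    destruct (unbounded_or (fun x => (ok l x /\ a < x) /\ C a x)
      (fun x => (ok l x /\ a < x) /\ ~ C a x)) as [h'|h'].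
    - intros N; destruct (h (S (N + a))) as [n [h1 h2]]; exists n; split; [lia|].
      assert (a < n) by lia; destruct (classic (C a n)); [left|right]; tauto.
    - exists (a, True); intros _; split; [assumption|].
      revert h'; apply unbounded_mono; intros n [[h1 h2] h3] b c hb.
      apply in_app_or in hb as [hb|[hb|[]]]; [now apply h1|].
      injection hb as <- <-; tauto.
    - exists (a, False); intros _; split; [assumption|].
      revert h'; apply unbounded_mono; intros n [[h1 h2] h3] b c hb.
      apply in_app_or in hb as [hb|[hb|[]]]; [now apply h1|].
      injection hb as <- <-; tauto. }
  assert (hok : forall n, unbounded (ok (map f (seq 0 n)))).
  { induction n as [|n IH].
    - intros N; exists N; split; [lia|]; intros a c [].
    - rewrite seq_S, map_app; now apply hf. }
  assert (hC : forall i j, i < j -> fst (f i) < fst (f j) /\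
            (C (fst (f i)) (fst (f j)) <-> snd (f i))).
  { intros i j hij; apply (proj1 (hf j (hok j))).
    rewrite <- surjective_pairing; apply in_map_seq; exists i; split; [lia|easy]. }
  destruct (homogeneous (fun i => snd (f i))) as [e [he [h|h]]];
    exists (fun n => fst (f (e n))); (split; [intros i j hij; apply hC; auto|]).
  - left; intros i j hij; apply hC; auto.
  - right; intros i j hij hc; apply (h i); apply (hC _ (e j)) in hc; auto.
Qed.

(** Infinitude as escape from every finite list, which suits vertex types of any cardinality. *)
Definition infset {T} (P : T -> Prop) := forall l : list T, exists x, P x /\ ~ In x l.

Lemma infset_mono {T} (P Q : T -> Prop) :
  (forall x, P x -> Q x) -> infset P -> infset Q.
Proof. intros h H l; destruct (H l) as [x [h1 h2]]; eauto. Qed.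

Lemma infset_or {T} (P Q : T -> Prop) :
  infset (fun x => P x \/ Q x) -> infset P \/ infset Q.
Proof.
  intros H; apply NNPP; intros hn; apply not_or_and in hn as [h1 h2].
  apply not_all_ex_not in h1 as [a ha], h2 as [b hb].
  destruct (H (a ++ b)) as [x [[hp|hq] hx]]; rewrite in_app_iff in hx.
  - apply ha; exists x; tauto.
  - apply hb; exists x; tauto.
Qed.

Lemma infset_pigeonhole {T C} (l : list C) (Q : C -> T -> Prop) :
  infset (fun x => exists c, In c l /\ Q c x) -> exists c, In c l /\ infset (Q c).
Proof.
  induction l as [|c l IH]; intros H.
  - destruct (H []) as [x [[c [[] _]] _]].
  - destruct (infset_or (Q c) (fun x => exists c, In c l /\ Q c x)) as [h|h].
    + revert H; apply infset_mono; intros n [c' [[<-|h1] h2]]; eauto.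
    + exists c; split; [now left|assumption].
    + destruct (IH h) as [c' [h1 h2]]; exists c'; split; [now right|assumption].
Qed.

Lemma infset_sequence {T} (P : T -> Prop) :
  infset P -> exists f : nat -> T, Injective f /\ forall n, P (f n).
Proof.
  intros H; destruct (greedy (fun l x => P x /\ ~ In x l) H) as [f hf].
  exists f; split; [|intros n; apply hf].
  assert (h : forall i j, i < j -> f i <> f j).
  { intros i j hij e; apply (proj2 (hf j)); apply in_map_seq; exists i.
    split; [lia|easy]. }
  intros i j e; destruct (lt_eq_lt_dec i j) as [[hl|]|hl]; trivial;
    [now apply h in hl|symmetry in e; now apply h in hl].
Qed.

Lemma infset_image {T} (f : nat -> T) (P : nat -> Prop) (Q : T -> Prop) :
  Injective f -> unbounded P -> (forall n, P n -> Q (f n)) -> infset Q.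
Proof.
  intros hf hP hQ l; apply NNPP; intros hn.
  destruct (enumerate P hP) as [e [he [heP _]]].
  assert (h : incl (map (fun i => f (e i)) (seq 0 (S (length l)))) l).
  { intros x hx; apply in_map_seq in hx as [i [_ ->]].
    apply NNPP; intros hx; apply hn; eauto. }
  apply NoDup_incl_length in h.
  - rewrite length_map, length_seq in h; lia.
  - apply Injective_map_NoDup; [|apply seq_NoDup].
    intros i j hij; apply hf in hij; now apply (increasing_inj e).
Qed.

(** * Walks *)

(** Walks and paths are total functions on [nat]; only the values at [0, ..., n] carry meaning. *)
Definition walk {G : graph} (A : G -> Prop) (f : nat -> G) n :=
  (forall i, i <= n -> A (f i)) /\ forall i, i < n -> adj (f i) (f (S i)).

Definition ipath {G : graph} (f : nat -> G) n :=
  (forall i, i < n -> adj (f i) (f (S i))) /\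
  (forall i j, i <= n -> j <= n -> f i = f j -> i = j) /\
  (forall i j, i <= n -> j <= n -> adj (f i) (f j) -> j = S i \/ i = S j).

Inductive conn {G : graph} (A : G -> Prop) (x : G) : G -> Prop :=
| conn_refl : A x -> conn A x x
| conn_step y z : conn A x y -> adj y z -> A z -> conn A x z.

Section Walks.
Context {G : graph}.
Implicit Types (A X Y : G -> Prop) (x y z : G) (f g : nat -> G).

Lemma conn_in A x y : conn A x y -> A x /\ A y.
Proof. induction 1; tauto. Qed.

Lemma conn_trans A x y z : conn A x y -> conn A y z -> conn A x z.
Proof. intros h1 h2; induction h2; [assumption|]; eapply conn_step; eauto. Qed.

Lemma conn_edge A x y : A x -> A y -> adj x y -> conn A x y.
Proof. intros; eapply conn_step; eauto; now apply conn_refl. Qed.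

Lemma conn_sym A x y : conn A x y -> conn A y x.
Proof.
  induction 1 as [|y z h IH h1 h2]; [now apply conn_refl|].
  apply conn_trans with y; [|assumption].
  apply conn_edge; [assumption|apply (conn_in _ _ _ h)|now apply adj_sym].
Qed.

Lemma conn_mono A B x y : (forall z, A z -> B z) -> conn A x y -> conn B x y.
Proof. intros h; induction 1; [apply conn_refl; auto|eapply conn_step; eauto]. Qed.

(** Every vertex on the way is itself reachable, so the ambient set can be shrunk to the component
    of [x]. *)
Lemma conn_reach A x y : conn A x y -> conn (conn A x) x y.
Proof.
  induction 1 as [|y z h IH h1 h2]; [now apply conn_refl, conn_refl|].
  eapply conn_step; eauto; eapply conn_step; eauto.
Qed.

Lemma walk_conn_between A f n i j : walk A f n -> i <= j <= n -> conn A (f i) (f j).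
Proof.
  intros [h1 h2] [hij hj]; induction hij as [|j hij IH].
  - apply conn_refl, h1; assumption.
  - eapply conn_step; [apply IH; lia|apply h2; lia|apply h1; lia].
Qed.

Lemma walk_conn A f n i j : walk A f n -> i <= n -> j <= n -> conn A (f i) (f j).
Proof.
  intros h hi hj; destruct (le_lt_dec i j).
  - apply walk_conn_between with n; [assumption|lia].
  - apply conn_sym, walk_conn_between with n; [assumption|lia].
Qed.

Lemma conn_walk A x y :
  conn A x y -> exists f n, walk A f n /\ f 0 = x /\ f n = y.
Proof.
  induction 1 as [h|y z h [f [n [[h1 h2] [h3 h4]]]] h5 h6].
  - exists (fun _ => x), 0; repeat split; trivial; intros; lia.
  - exists (fun i => if i <=? n then f i else z), (S n); repeat split.
    + intros i hi; destruct (Nat.leb_spec i n); auto.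
    + intros i hi; destruct (Nat.leb_spec i n), (Nat.leb_spec (S i) n); try lia; auto.
      replace i with n by lia; now rewrite h4.
    + assumption.
    + destruct (Nat.leb_spec (S n) n); [lia|reflexivity].
Qed.

(** Cuts out the [d] vertices following position [i]; an edge from position [i] to position
    [i + 1 + d] makes the result a walk. *)
Definition skip f i d k := if k <=? i then f k else f (k + d).

Lemma walk_skip A f n i d :
  walk A f n -> i + 1 + d <= n -> adj (f i) (f (i + 1 + d)) ->
  walk A (skip f i d) (n - d).
Proof.
  intros [h1 h2] hi ha; split; intros k hk; unfold skip.
  - destruct (Nat.leb_spec k i); apply h1; lia.
  - destruct (Nat.leb_spec k i), (Nat.leb_spec (S k) i); try lia.
    + apply h2; lia.
    + replace k with i by lia; replace (S i + d) with (i + 1 + d) by lia; assumption.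
    + apply h2; lia.
Qed.

(** In a walk of least length, an early visit to [Y], a late visit to [X], a repeated vertex or a
    chord would each give a shorter walk. The chords range over all edges of [G], because a shortcut
    uses no new vertices and so stays in [A]. *)
Lemma shortest A X Y :
  (exists x y, X x /\ Y y /\ conn A x y) ->
  exists f n, walk A f n /\ X (f 0) /\ Y (f n) /\
    (forall i, i <= n -> X (f i) -> i = 0) /\
    (forall i, i <= n -> Y (f i) -> i = n) /\ ipath f n.
Proof.
  intros H.
  destruct (least (fun n => exists f, walk A f n /\ X (f 0) /\ Y (f n)))
    as [n [[f [hw [hX hY]]] hmin]].
  { destruct H as [x [y [h1 [h2 h3]]]]; apply conn_walk in h3 as [f [n [h3 [<- <-]]]].
    eauto. }
  assert (hX' : forall i, i <= n -> X (f i) -> i = 0).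
  { intros i hi hx; enough (n <= n - i) by lia; apply hmin.
    exists (fun k => f (i + k)); repeat split.
    - intros k hk; apply hw; lia.
    - intros k hk; replace (i + S k) with (S (i + k)) by lia; apply hw; lia.
    - now rewrite Nat.add_0_r.
    - now replace (i + (n - i)) with n by lia. }
  assert (hY' : forall i, i <= n -> Y (f i) -> i = n).
  { intros i hi hy; enough (n <= i) by lia; apply hmin.
    exists f; repeat split; trivial; intros k hk; apply hw; lia. }
  assert (hd : forall i d, i + 1 + d <= n -> adj (f i) (f (i + 1 + d)) -> d = 0).
  { intros i d hi ha; enough (n <= n - d) by lia; apply hmin.
    exists (skip f i d); split; [now apply walk_skip|]; unfold skip.
    split; [assumption|].
    destruct (Nat.leb_spec (n - d) i); [lia|].
    now replace (n - d + d) with n by lia. }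
  (* A repetition [f i = f j] with [j < n] makes [f i] adjacent to [f (S j)], a shortcut over
     [j - i] vertices; if [j = n], already [f i] lies in [Y]. *)
  assert (he : forall i j, i < j -> j <= n -> f i <> f j).
  { intros i j hij hj e; destruct (Nat.eq_dec j n) as [->|hn].
    - rewrite <- e in hY; apply hY' in hY; lia.
    - assert (j - i = 0); [|lia]; apply (hd i); [lia|].
      replace (i + 1 + (j - i)) with (S j) by lia; rewrite e; apply hw; lia. }
  assert (ha : forall i j, i < j -> j <= n -> adj (f i) (f j) -> j = S i).
  { intros i j hij hj h; assert (j - i - 1 = 0); [|lia]; apply (hd i); [lia|].
    now replace (i + 1 + (j - i - 1)) with j by lia. }
  exists f, n; repeat split; trivial; try apply hw.
  - intros i j hi hj e; destruct (lt_eq_lt_dec i j) as [[h|]|h]; trivial; exfalso.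
    + now apply (he i j).
    + now apply (he j i).
  - intros i j hi hj h; destruct (lt_eq_lt_dec i j) as [[hl|e]|hl].
    + left; auto.
    + subst j; now apply adj_irrefl in h.
    + right; apply ha; trivial; now apply adj_sym.
Qed.

Lemma conn_before A x y : conn A x y -> x <> y ->
  exists z, conn (fun w => A w /\ w <> y) x z /\ adj z y.
Proof.
  intros h hxy.
  destruct (shortest A (fun w => w = x) (fun w => w = y)) as [f [n [h1 [h2 [h3 [_ [h5 _]]]]]]].
  { exists x, y; auto. }
  destruct n as [|n]; [congruence|].
  exists (f n); split.
  - rewrite <- h2; apply (walk_conn _ f n); try lia; split; [|intros i hi; apply h1; lia].
    intros i hi; split; [apply h1; lia|]; intros e; apply h5 in e; lia.
  - rewrite <- h3; apply h1; lia.
Qed.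

End Walks.

(** * Lists of vertices along a walk *)

Lemma path_edge_map_seq {V : Type} (f : nat -> V) a n x y :
  path_edge (map f (seq a n)) x y <->
  exists i, a <= i /\ S i < a + n /\
    ((x = f i /\ y = f (S i)) \/ (y = f i /\ x = f (S i))).
Proof.
  assert (key : forall a n x y, (exists l1 l2, map f (seq a n) = l1 ++ x :: y :: l2) <->
            exists i, a <= i /\ S i < a + n /\ x = f i /\ y = f (S i)).
  { clear; intros a n; revert a; induction n as [|n IH]; intros a x y; split.
    - intros [[|] [l2 h]]; discriminate.
    - intros [i h]; lia.
    - intros [[|z l1] [l2 h]]; simpl in h; injection h as h1 h2.
      + destruct n as [|n]; [discriminate|]; simpl in h2; injection h2 as h2 _.
        exists a; repeat split; auto; lia.
      + destruct (proj1 (IH (S a) x y)) as [i hi]; [eauto|].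
        exists i; repeat split; try tauto; lia.
    - intros [i [h1 [h2 [h3 h4]]]]; destruct (Nat.eq_dec i a) as [->|hne].
      + destruct n as [|n]; [lia|]; exists [], (map f (seq (S (S a)) n)).
        simpl; congruence.
      + destruct (proj2 (IH (S a) x y)) as [l1 [l2 h]].
        { exists i; repeat split; trivial; lia. }
        exists (f a :: l1), l2; simpl; now rewrite h. }
  unfold path_edge; split.
  - intros [l1 [l2 [h|h]]].
    + destruct (proj1 (key a n x y)) as [i hi]; [eauto|]; exists i; tauto.
    + destruct (proj1 (key a n y x)) as [i hi]; [eauto|]; exists i; tauto.
  - intros [i [h1 [h2 [h|h]]]].
    + destruct (proj2 (key a n x y)) as [l1 [l2 hl]]; [exists i; tauto|].
      exists l1, l2; now left.
    + destruct (proj2 (key a n y x)) as [l1 [l2 hl]]; [exists i; tauto|].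
      exists l1, l2; now right.
Qed.

Lemma map_seq_ends {V : Type} (f : nat -> V) m :
  map f (seq 0 (S (S m))) = f 0 :: map f (seq 1 m) ++ [f (S m)].
Proof. rewrite seq_S, map_app; reflexivity. Qed.

Lemma path_between_walk (G : graph) (f : nat -> G) n :
  (forall i, i < n -> adj (f i) (f (S i))) ->
  (forall i j, i <= n -> j <= n -> f i = f j -> i = j) ->
  path_between G (f 0) (f n) (map f (seq 0 (S n))).
Proof.
  intros h1 h2; repeat split.
  - assert (h : forall a m, a + m <= S n -> NoDup (map f (seq a m))).
    { intros a m; revert a; induction m as [|m IH]; intros a hm; constructor.
      - intros hin; apply in_map_seq in hin as [i [hi he]].
        apply h2 in he; lia.
      - apply IH; lia. }
    apply h; lia.
  - rewrite seq_S, map_app; simpl; apply last_last.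
  - intros u v huv; apply path_edge_map_seq in huv
      as [i [_ [hi [[-> ->]|[-> ->]]]]]; [|apply adj_sym]; apply h1; lia.
Qed.

Lemma path_between_conn (G : graph) x y l :
  path_between G x y l -> conn (fun z => In z l) x y.
Proof.
  intros [hd [hh [hl he]]].
  destruct l as [|z l]; [discriminate|]; injection hh as ->.
  assert (key : forall l1 l2, x :: l = l1 ++ l2 -> l1 <> [] ->
            conn (fun z => In z (x :: l)) x (last l1 x)).
  { induction l1 as [|w l1 IH] using rev_ind; [congruence|]; intros l2 e _.
    rewrite last_last; destruct l1 as [|w' l1'] eqn:el1.
    - injection e as <- _; apply conn_refl; now left.
    - rewrite <- el1 in *.
      assert (hne : l1 <> []) by (subst; discriminate).
      apply conn_step with (last l1 x).
      + apply (IH (w :: l2)); [now rewrite e, <- app_assoc|assumption].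
      + apply he; exists (removelast l1), l2; left.
        rewrite e, (app_removelast_last x hne) at 1; now rewrite <- !app_assoc.
      + rewrite e; apply in_or_app; left; apply in_or_app; right; now left. }
  rewrite <- hl; apply (key _ []); [now rewrite app_nil_r|discriminate].
Qed.

Lemma joined_conn (G : graph) x y : joined G x y <-> @conn G (fun _ => True) x y.
Proof.
  split.
  - intros [l h]; apply path_between_conn in h; revert h; now apply conn_mono.
  - intros h.
    destruct (@shortest G (fun _ => True) (fun w => w = x) (fun w => w = y))
      as [f [n [_ [<- [<- [_ [_ [h1 [h2 _]]]]]]]]]; [eauto|].
    eexists; apply path_between_walk; assumption.
Qed.

Lemma two_connected_conn (G : graph) (v x y : G) :
  two_connected G -> x <> v -> y <> v -> conn (fun z => z <> v) x y.
Proof.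
  intros h hx hy.
  specialize (h v (exist _ x hx) (exist _ y hy)); apply joined_conn in h.
  (* Vertices of the induced graph carry proofs, so both ends are written as projections and
     generalised before the induction on [conn]. *)
  change x with (proj1_sig (exist (fun z => z <> v) x hx)).
  change y with (proj1_sig (exist (fun z => z <> v) y hy)).
  revert h; generalize (exist (fun z => z <> v) x hx), (exist (fun z => z <> v) y hy).
  intros a b h; induction h as [|b c h IH h1 _].
  - apply conn_refl, (proj2_sig a).
  - eapply conn_step; [exact IH|exact h1|apply (proj2_sig c)].
Qed.

Definition unavoidable (G : graph) : Prop :=
  induced_subgraph K_infty G \/
  exists H : graph, induced_subgraph H G /\
    (clean_ladder H \/
     Theta_infty H \/
     F_infty H \/
     F_Delta_infty H \/
     L_infty H \/
     L_Delta_infty H \/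
     L_nabla_Delta_infty H).

(** * The subgraph induced on the range of a function *)

(** Obstructions are described by indexed vertices of [G], and this is the subgraph that they
    induce. The index map need not be injective, so a vertex may have several names. *)
Definition range_graph {G : graph} {I : Type} (c : I -> G) : graph :=
  induced G (fun x => exists i, x = c i).

Definition into {G : graph} {I : Type} (c : I -> G) (i : I) : range_graph c :=
  exist (fun x => exists i, x = c i) (c i) (ex_intro (fun j => c i = c j) i eq_refl).

Lemma into_surj {G : graph} {I : Type} (c : I -> G) (x : range_graph c) :
  exists i, x = into c i.
Proof.
  destruct x as [x hx]; pose proof hx as [i ->]; exists i.
  unfold into; f_equal; apply proof_irrelevance.
Qed.

Lemma into_eq {G : graph} {I : Type} (c : I -> G) i j :
  into c i = into c j <-> c i = c j.
Proof.
  split; intros h; [now apply (f_equal (@proj1_sig _ _)) in h|].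
  now apply subset_eq_compat.
Qed.

Lemma into_adj {G : graph} {I : Type} (c : I -> G) (i j : I) :
  @adj (range_graph c) (into c i) (into c j) <-> adj (c i) (c j).
Proof. reflexivity. Qed.

Lemma into_adj1 {G : graph} {I : Type} (c : I -> G) (i j : I) :
  @adj (range_graph c) (into c i) (into c j) -> adj (c i) (c j).
Proof. exact (fun h => h). Qed.

Lemma range_induced {G : graph} {I : Type} (c : I -> G) :
  induced_subgraph (range_graph c) G.
Proof.
  exists (@proj1_sig _ _); split; [|reflexivity].
  intros [x hx] [y hy]; apply subset_eq_compat.
Qed.

Lemma into_ipath {G : graph} {I : Type} (c : I -> G) (w : nat -> I) (f : nat -> G) n :
  (forall i, i <= n -> c (w i) = f i) -> ipath f n -> ipath (fun i => into c (w i)) n.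
Proof.
  intros he [h1 [h2 h3]]; repeat split.
  - intros i hi; rewrite into_adj, !he by lia; auto.
  - intros i j hi hj h; apply (into_eq c) in h; rewrite !he in h by lia; auto.
  - intros i j hi hj h; apply (into_adj1 c) in h; rewrite !he in h by lia; auto.
Qed.

Lemma into_induced_ray {G : graph} {I : Type} (c : I -> G) (w : nat -> I) :
  induced_ray G (fun i => c (w i)) -> induced_ray (range_graph c) (fun i => into c (w i)).
Proof.
  intros [[h1 h2] h3]; repeat split.
  - intros i j h; apply (into_eq c) in h; now apply h1.
  - intros i; apply into_adj, h2.
  - intros i j h; apply (into_adj1 c) in h; apply h3 in h as [m h]; exists m.
    now rewrite !into_eq.
Qed.

Lemma into_on_ray {G : graph} {I : Type} (c : I -> G) (w : nat -> I) i :
  on_ray (fun i => into c (w i)) (into c i) <-> on_ray (fun i => c (w i)) (c i).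
Proof. split; intros [m h]; exists m; now apply into_eq. Qed.

(** * Thetas *)

(** [w n] is the interior of the [n]-th path and is never empty; whether [a] and [b] are adjacent is
    left open. *)
Definition theta_conf (G : graph) (a b : G) (w : nat -> nat -> G) (k : nat -> nat) :=
  a <> b /\
  (forall n, ipath (w n) (k n)) /\
  (forall n i, i <= k n -> adj a (w n i) <-> i = 0) /\
  (forall n i, i <= k n -> adj b (w n i) <-> i = k n) /\
  (forall n i, i <= k n -> w n i <> a /\ w n i <> b) /\
  (forall n m i j, n <> m -> i <= k n -> j <= k m ->
     w n i <> w m j /\ ~ adj (w n i) (w m j)).

Lemma theta_intro (H : graph) a b w k :
  theta_conf H a b w k ->
  (forall x, x = a \/ x = b \/ exists n i, i <= k n /\ x = w n i) ->
  Theta_infty H.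
Proof.
  intros [hab [hw [ha [hb [hav hd]]]]] hc.
  set (q := fun n => map (w n) (seq 0 (S (k n)))).
  (* [h n] runs along the whole [n]-th path: [a] at position 0, [w n i] at position [S i], and [b]
     at every position past [S (k n)]. *)
  set (h := fun n i => match i with 0 => a | S i => if i <=? k n then w n i else b end).
  assert (hend : forall n, h n (S (S (k n))) = b).
  { intros n; unfold h; destruct (Nat.leb_spec (S (k n)) (k n)); [lia|reflexivity]. }
  assert (hW : forall n i, i <= k n -> h n (S i) = w n i).
  { intros n i hi; unfold h; destruct (Nat.leb_spec i (k n)); [reflexivity|lia]. }
  assert (hq : forall n, a :: q n ++ [b] = map (h n) (seq 0 (S (S (S (k n)))))).
  { intros n; rewrite map_seq_ends, hend.
    change (h n 0) with a; f_equal; f_equal; unfold q; rewrite <- (seq_shift _ 0), map_map.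
    apply map_ext_in; intros i hi; apply in_seq in hi.
    rewrite hW; [reflexivity|lia]. }
  assert (F1 : forall n, path_between H a b (a :: q n ++ [b])).
  { intros n; rewrite hq.
    rewrite <- (hend n) at 1; apply (path_between_walk H (h n)).
    - intros [|i] hi.
      + rewrite hW by lia; apply ha; lia.
      + rewrite hW by lia; destruct (Nat.eq_dec i (k n)) as [->|hne].
        * rewrite hend; apply adj_sym, hb; lia.
        * rewrite hW by lia; apply hw; lia.
    - assert (hcase : forall i, i <= S (S (k n)) ->
        i = 0 \/ i = S (S (k n)) \/ exists j, i = S j /\ j <= k n).
      { intros [|i] hi; [tauto|]; right; destruct (Nat.eq_dec i (S (k n))) as [->|].
        - now left.
        - right; exists i; split; [reflexivity|lia]. }
      intros i j hi hj.
      destruct (hcase i hi) as [->|[->|[i' [-> hi']]]],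
        (hcase j hj) as [->|[->|[j' [-> hj']]]]; rewrite ?hend, ?hW by assumption;
        intros e; trivial; try (symmetry in e; now apply hav in e);
        try (now apply hav in e); try (exfalso; apply hab; now (exact e || symmetry)).
      f_equal; revert e; now apply hw. }
  assert (inq : forall n x, In x (q n) <-> exists i, i <= k n /\ x = w n i).
  { intros n x; unfold q; rewrite in_map_seq; split;
      intros [i [h1 h2]]; exists i; split; trivial; lia. }
  assert (F3 : forall m n x, In x (q m) -> In x (q n) -> m = n).
  { intros m n x h1 h2; apply inq in h1 as [i [h1 ->]], h2 as [j [h2 e]].
    destruct (Nat.eq_dec m n); [assumption|].
    now apply hd in e. }
  assert (F2 : forall n, In (w n 0) (q n)) by (intros n; apply inq; exists 0; split; [lia|easy]).
  assert (F4 : forall x, x = a \/ x = b \/ exists n, In x (q n)).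
  { intros x; destruct (hc x) as [h1|[h1|[n h1]]]; auto.
    right; right; exists n; now apply inq. }
  assert (F5 : forall x y, adj x y -> (x = a /\ y = b) \/ (x = b /\ y = a) \/
            exists n, path_edge (a :: q n ++ [b]) x y).
  { assert (half : forall n i y, i <= k n -> adj (w n i) y ->
      path_edge (a :: q n ++ [b]) (w n i) y /\ path_edge (a :: q n ++ [b]) y (w n i)).
    { intros n i y hi hxy; rewrite hq, !path_edge_map_seq.
      assert (hwi : forall i, i <= k n -> w n i = h n (S i)) by (intros; now rewrite hW).
      assert (E : exists i', 0 <= i' /\ S i' < 0 + S (S (S (k n))) /\
        (w n i = h n i' /\ y = h n (S i') \/ y = h n i' /\ w n i = h n (S i'))).
      { destruct (hc y) as [->|[->|[m [j [hj ->]]]]].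
        - apply adj_sym, ha in hxy; subst; [|assumption].
          exists 0; repeat split; try lia; right; split; trivial; now apply hwi.
        - apply adj_sym, hb in hxy; subst; [|assumption].
          exists (S (k n)); repeat split; try lia; left; split; [now apply hwi|].
          symmetry; apply hend.
        - destruct (Nat.eq_dec n m) as [->|hne]; [|now apply hd in hxy].
          apply hw in hxy as [->| ->]; trivial.
          + exists (S i); repeat split; try lia; left; split; apply hwi; lia.
          + exists (S j); repeat split; try lia; right; split; apply hwi; lia. }
      destruct E as [i' E]; split; exists i'; intuition lia. }
    intros x y hxy.
    destruct (hc x) as [->|[->|[n [i [hi ->]]]]], (hc y) as [->|[->|[m [j [hj ->]]]]];
      try (now apply adj_irrefl in hxy); auto;
      try (destruct (half n i _ hi hxy) as [h1 h2]; now eauto);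
      try (apply adj_sym in hxy; destruct (half m j _ hj hxy) as [h1 h2]; now eauto). }
  (* An edge from [a] to [b] has to be one of the paths of the theta; it is put at index 0, with
     empty interior, and the others are shifted. *)
  destruct (classic (adj a b)) as [hE|hE].
  - exists a, b, (fun n => match n with 0 => [] | S n => q n end).
    assert (F0 : path_between H a b [a; b]).
    { repeat split.
      - constructor; [intros [|[]]; congruence|constructor; [intros []|constructor]].
      - intros u v [l1 [l2 [e|e]]]; destruct l1 as [|? [|? [|? ?]]]; try discriminate;
          injection e as -> ->; [assumption|now apply adj_sym]. }
    split; [assumption|split; [intros [|n]; [exact F0|apply F1]|]]; repeat split.
    + intros [|m] [|n] hne e; try congruence.
      * pose proof (F2 n) as h2; rewrite <- e in h2; destruct h2.
      * pose proof (F2 m) as h2; rewrite e in h2; destruct h2.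
      * apply hne; f_equal; apply (F3 m n (w m 0)); [apply F2|rewrite <- e; apply F2].
    + intros [|m] [|n] x h1 h2; try contradiction; f_equal; eauto.
    + intros x; destruct (F4 x) as [h1|[h1|[n h1]]]; auto.
      right; right; now exists (S n).
    + intros x y hxy; destruct (F5 x y hxy) as [[-> ->]|[[-> ->]|[n hn]]].
      * exists 0, [], []; now left.
      * exists 0, [], []; now right.
      * now exists (S n).
  - exists a, b, q; repeat split; trivial; try apply F1.
    + intros m n hne e; apply hne, (F3 m n (w m 0)); [apply F2|rewrite <- e; apply F2].
    + intros x y hxy; destruct (F5 x y hxy) as [[-> ->]|[[-> ->]|hn]]; trivial;
        exfalso; apply hE; trivial; now apply adj_sym.
Qed.

(** One index type for thetas and both kinds of fans: in thetas [at_rim] repeats the second apex, in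
    fans [at_second] repeats the first. *)
Inductive apex_index := at_first | at_second | at_rim (i : nat) | at_link (n i : nat).

(** Truncating the index at [k] keeps the meaningless values beyond the end of a path out of the
    range graph. *)
Lemma clip {T} (f : nat -> T) i k : i <= k -> f (Nat.min i k) = f i.
Proof. intros h; now rewrite Nat.min_l. Qed.

Lemma theta_unavoidable (G : graph) (a b : G) w k :
  theta_conf G a b w k -> unavoidable G.
Proof.
  intros [hab [hw [ha [hb [hav hd]]]]].
  set (c := fun i => match i with
    | at_first => a | at_link n i => w n (Nat.min i (k n)) | _ => b end).
  right; exists (range_graph c); split; [apply range_induced|]; right; left.
  apply theta_intro with (into c at_first) (into c at_second)
    (fun n i => into c (at_link n i)) k.
  - split; [now rewrite into_eq|].
    split; [intros n; apply (into_ipath c (at_link n) (w n));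
      [intros; cbn; now apply clip|apply hw]|].
    split; [|split; [|split]].
    + intros n i hi; rewrite into_adj; simpl; rewrite clip by assumption; now apply ha.
    + intros n i hi; rewrite into_adj; simpl; rewrite clip by assumption; now apply hb.
    + intros n i hi; rewrite !into_eq; simpl; rewrite clip by assumption; now apply hav.
    + intros n m i j hne hi hj; rewrite into_eq, into_adj; simpl.
      rewrite !clip by assumption; now apply hd.
  - intros x; destruct (into_surj c x) as [[| |i|n i] ->]; auto.
    { right; left; now apply into_eq. }
    right; right; exists n, (Nat.min i (k n)); split; [lia|].
    apply into_eq; simpl; f_equal; lia.
Qed.

(** A shortest path in [P n] from the neighbours of [a] to those of [b] meets each neighbourhood
    only at its end; different [P n] are disjoint and nonadjacent, and so are these paths. *)
Lemma theta_of_sets (G : graph) (a b : G) (P : nat -> G -> Prop) :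
  a <> b ->
  (forall n, ~ P n a /\ ~ P n b) ->
  (forall n m x y, n <> m -> P n x -> P m y -> x <> y /\ ~ adj x y) ->
  (forall n, exists x y, adj a x /\ adj b y /\ conn (P n) x y) ->
  unavoidable G.
Proof.
  intros hab hP hd hc.
  destruct (choice_fun (fun n (fk : (nat -> G) * nat) => let (f, k) := fk in
    walk (P n) f k /\ adj a (f 0) /\ adj b (f k) /\
    (forall i, i <= k -> adj a (f i) -> i = 0) /\
    (forall i, i <= k -> adj b (f i) -> i = k) /\ ipath f k)) as [fk h].
  { intros n; destruct (shortest (P n) (adj a) (adj b)) as [f [k hf]]; [apply hc|].
    now exists (f, k). }
  apply theta_unavoidable with a b (fun n => fst (fk n)) (fun n => snd (fk n)).
  split; [assumption|].
  split; [intros n|split; [intros n i hi|split; [intros n i hi|split; [intros n i hi|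
    intros n m i j hne hi hj]]]].
  - specialize (h n); destruct (fk n); apply h.
  - specialize (h n); destruct (fk n) as [f k]; simpl in *; split; [now apply h|].
    intros ->; apply h.
  - specialize (h n); destruct (fk n) as [f k]; simpl in *; split; [now apply h|].
    intros ->; apply h.
  - pose proof (hP n) as h1; specialize (h n); destruct (fk n) as [f k]; simpl in *.
    assert (P n (f i)) by now apply h.
    split; intros e; rewrite e in *; tauto.
  - pose proof (h n) as hn; pose proof (h m) as hm; destruct (fk n), (fk m); simpl in *.
    apply (hd n m); trivial; [now apply hn|now apply hm].
Qed.

Lemma K_infty_unavoidable (G : graph) (f : nat -> G) :
  (forall i j, i < j -> adj (f i) (f j)) -> unavoidable G.
Proof.
  intros h; left; exists f.
  assert (h' : forall i j, i <> j -> adj (f i) (f j)).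
  { intros i j hij; destruct (lt_eq_lt_dec i j) as [[hl|]|hl]; [auto|easy|].
    now apply adj_sym, h. }
  split.
  - intros i j e; destruct (Nat.eq_dec i j) as [|hne]; [assumption|].
    apply h' in hne; rewrite e in hne; now apply adj_irrefl in hne.
  - intros i j; split; [|apply h'].
    intros ha ->; now apply adj_irrefl in ha.
Qed.

(** By Ramsey's theorem the common neighbours contain an infinite clique or an infinite independent
    set; the latter supplies paths with one interior vertex each. *)
Lemma common_neighbours (G : graph) (a b : G) :
  a <> b -> infset (fun x => adj a x /\ adj b x) -> unavoidable G.
Proof.
  intros hab h; apply infset_sequence in h as [f [hf h]].
  destruct (ramsey (fun i j => adj (f i) (f j))) as [e [he [hC|hC]]].
  - now apply (K_infty_unavoidable G (fun i => f (e i))).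
  - apply (theta_of_sets G a b (fun n x => x = f (e n))); trivial.
    + intros n; split; intros ->; destruct (h (e n)) as [h1 h2];
        [now apply adj_irrefl in h1|now apply adj_irrefl in h2].
    + intros n m x y hne -> ->; split.
      * intros e'; apply hf, (increasing_inj e) in e'; auto.
      * intros ha; destruct (lt_eq_lt_dec n m) as [[hl|]|hl]; [|contradiction|].
        -- now apply (hC n m).
        -- now apply (hC m n), adj_sym.
    + intros n; exists (f (e n)), (f (e n)); repeat split; try apply h.
      now apply conn_refl.
Qed.

(** * Subdivisions *)

Lemma path_between_rev (G : graph) (x y : G) l :
  path_between G x y l -> path_between G y x (rev l).
Proof.
  intros [h1 [h2 [h3 h4]]]; destruct l as [|z l]; [discriminate|].
  injection h2 as ->; repeat split.
  - now apply NoDup_rev.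
  - assert (hne : x :: l <> []) by discriminate.
    now rewrite (app_removelast_last x hne), h3, rev_app_distr.
  - simpl; apply last_last.
  - intros u v [l1 [l2 e]]; apply h4; exists (rev l2), (rev l1).
    rewrite <- (rev_involutive (x :: l)).
    destruct e as [-> | ->]; [right|left]; rewrite rev_app_distr; simpl;
      now rewrite <- !app_assoc.
Qed.

(** It suffices to describe the paths along one orientation [E] of the edges. *)
Lemma subdivision_intro (B : graph) (Sd : B -> B -> Prop) (H : graph)
    (E : B -> B -> Prop) (phi : B -> H) (h : B -> B -> nat -> H) (m : B -> B -> nat) :
  (forall u v : B, adj u v <-> E u v \/ E v u) ->
  (forall u v, E u v -> ~ E v u) ->
  (forall u v, Sd u v -> Sd v u) ->
  Injective phi ->
  (forall u v, E u v -> h u v 0 = phi u /\ h u v (S (m u v)) = phi v) ->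
  (forall u v i, E u v -> i <= m u v -> adj (h u v i) (h u v (S i))) ->
  (forall u v i j, E u v -> 1 <= i <= m u v -> 1 <= j <= m u v ->
     h u v i = h u v j -> i = j) ->
  (forall u v, E u v -> ~ Sd u v -> m u v = 0) ->
  (forall u v w i, E u v -> 1 <= i <= m u v -> h u v i <> phi w) ->
  (forall u v u' v' i j, E u v -> E u' v' -> 1 <= i <= m u v -> 1 <= j <= m u' v' ->
     h u v i = h u' v' j -> u = u' /\ v = v') ->
  (forall x, (exists u, x = phi u) \/
     exists u v i, E u v /\ 1 <= i <= m u v /\ x = h u v i) ->
  (forall x y, adj x y -> exists u v i, E u v /\ i <= m u v /\
     ((x = h u v i /\ y = h u v (S i)) \/ (y = h u v i /\ x = h u v (S i)))) ->
  subdivision B Sd H.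
Proof.
  intros hE hEo hS hphi hends hadj hinj hns hint hdis hcov hcova.
  set (q := fun u v => map (h u v) (seq 1 (m u v))).
  (* [subdivision] demands a path for both orientations of an edge; against [E] it is the reversed
     list. *)
  set (p := fun u v => if excluded_middle_informative (E u v) then q u v else rev (q v u)).
  assert (pE : forall u v, E u v -> p u v = q u v).
  { intros u v e; unfold p; now destruct (excluded_middle_informative (E u v)). }
  assert (pE' : forall u v, E v u -> p u v = rev (q v u)).
  { intros u v e; unfold p; destruct (excluded_middle_informative (E u v)); [|easy].
    now apply hEo in e. }
  assert (hq : forall u v, E u v ->
    phi u :: q u v ++ [phi v] = map (h u v) (seq 0 (S (S (m u v))))).
  { intros u v e; rewrite map_seq_ends; destruct (hends u v e) as [-> ->]; reflexivity. }
  assert (hne : forall u v, E u v -> u <> v).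
  { intros u v e ->; now apply (hEo v v). }
  assert (hpb : forall u v, E u v -> path_between H (phi u) (phi v) (phi u :: q u v ++ [phi v])).
  { intros u v e; rewrite hq by assumption; destruct (hends u v e) as [h0 h1].
    rewrite <- h0, <- h1 at 1; apply path_between_walk.
    - intros i hi; apply hadj; [assumption|lia].
    - assert (hcase : forall i, i <= S (m u v) ->
        i = 0 \/ i = S (m u v) \/ 1 <= i <= m u v) by (intros; lia).
      intros i j hi hj eij.
      destruct (hcase i hi) as [->|[->|hi']], (hcase j hj) as [->|[->|hj']]; trivial.
      + exfalso; rewrite h0, h1 in eij; now apply hphi, hne in eij.
      + rewrite h0 in eij; symmetry in eij; now apply hint in eij.
      + exfalso; rewrite h0, h1 in eij; symmetry in eij; now apply hphi, hne in eij.
      + rewrite h1 in eij; symmetry in eij; now apply hint in eij.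
      + rewrite h0 in eij; now apply hint in eij.
      + rewrite h1 in eij; now apply hint in eij.
      + revert eij; now apply hinj. }
  assert (hrev : forall u v, phi v :: rev (q u v) ++ [phi u] = rev (phi u :: q u v ++ [phi v])).
  { intros u v; simpl; rewrite rev_app_distr; reflexivity. }
  assert (hin : forall u v x, adj u v -> In x (p u v) ->
    exists u' v' i, E u' v' /\ 1 <= i <= m u' v' /\ x = h u' v' i /\
      ((u = u' /\ v = v') \/ (u = v' /\ v = u'))).
  { intros u v x a hx; apply hE in a as [a|a].
    - rewrite pE in hx by assumption; apply in_map_seq in hx as [i [hi ->]].
      exists u, v, i; repeat split; auto; lia.
    - rewrite pE', <- in_rev in hx by assumption; apply in_map_seq in hx as [i [hi ->]].
      exists v, u, i; repeat split; auto; lia. }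
  exists phi, p.
  split; [assumption|split; [|split; [|split; [|split; [|split; [|split]]]]]].
  - intros u v a; apply hE in a as [e|e].
    + rewrite pE by assumption; now apply hpb.
    + rewrite pE', hrev by assumption; now apply path_between_rev, hpb.
  - intros u v a; apply hE in a as [e|e].
    + now rewrite (pE u v), (pE' v u) by assumption.
    + now rewrite (pE v u), (pE' u v), rev_involutive by assumption.
  - intros u v a hs; apply hE in a as [e|e].
    + rewrite pE by assumption; unfold q; now rewrite hns.
    + rewrite pE' by assumption; unfold q; rewrite hns; auto.
  - intros u v w a hx; apply hin in hx as [u' [v' [i [h1 [h2 [h3 _]]]]]]; [|assumption].
    symmetry in h3; now apply hint in h3.
  - intros u v u' v' x a a' hx hx'.
    apply hin in hx as [u1 [v1 [i [h1 [h2 [-> h3]]]]]]; [|assumption].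
    apply hin in hx' as [u2 [v2 [j [h4 [h5 [h6 h7]]]]]]; [|assumption].
    apply hdis in h6 as [-> ->]; trivial.
    destruct h3 as [[-> ->]|[-> ->]], h7 as [[-> ->]|[-> ->]]; auto.
  - intros x; destruct (hcov x) as [hx|[u [v [i [h1 [h2 ->]]]]]]; [now left|right].
    exists u, v; split; [apply hE; now left|].
    rewrite pE by assumption; apply in_map_seq; exists i; split; [lia|easy].
  - intros x y a; destruct (hcova x y a) as [u [v [i [h1 [h2 h3]]]]].
    exists u, v; split; [apply hE; now left|].
    rewrite pE, hq, path_edge_map_seq by assumption.
    exists i; repeat split; trivial; lia.
Qed.

(** After case analysis on two vertices, the premise [E u v] computes to [False], [True] or an
    equation; only the last kind is kept. *)
Ltac drop_edge := lazymatch goal with |- ?P -> _ =>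
  let Q := eval hnf in P in
  lazymatch Q with False => intros [] | True => intros _ | _ => idtac end end.

(** * Fans *)

Lemma increasing_interval e j : increasing e -> e 0 <= j -> exists n, e n <= j < e (S n).
Proof.
  intros he h0.
  destruct (greatest (fun n => e n <= j) j) as [n [h1 h2]]; [now exists 0| |].
  - intros n hn; pose proof (increasing_ge e n he); lia.
  - exists n; split; [assumption|]; destruct (le_lt_dec (e (S n)) j) as [h|]; [|assumption].
    specialize (h2 _ h); lia.
Qed.

Lemma ray_step {G : graph} (R : nat -> G) i j :
  induced_ray G R -> adj (R i) (R j) -> j = S i \/ i = S j.
Proof.
  intros [[h1 _] h3] h; destruct (h3 i j h) as [n [[e1 e2]|[e1 e2]]];
    apply h1 in e1, e2; lia.
Qed.

Lemma ray_inj {G : graph} (R : nat -> G) i j : induced_ray G R -> R i = R j -> i = j.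
Proof. intros [[h1 _] _]; apply h1. Qed.

Lemma ray_adj {G : graph} (R : nat -> G) i : induced_ray G R -> adj (R i) (R (S i)).
Proof. intros [[_ h1] _]; apply h1. Qed.

Lemma induced_ray_intro {G : graph} (R : nat -> G) :
  (forall i, adj (R i) (R (S i))) -> (forall i j, i < j -> R i <> R j) ->
  (forall i j, i < j -> adj (R i) (R j) -> j = S i) -> induced_ray G R.
Proof.
  intros h1 h2 h3; repeat split; trivial.
  - intros i j e; destruct (lt_eq_lt_dec i j) as [[hl|]|hl]; trivial; exfalso.
    + now apply (h2 i j).
    + now apply (h2 j i).
  - intros i j ha; destruct (lt_eq_lt_dec i j) as [[hl|<-]|hl].
    + exists i; left; split; [easy|]; f_equal; auto.
    + now apply adj_irrefl in ha.
    + exists j; right; split; [easy|]; f_equal; apply h3; trivial; now apply adj_sym.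
Qed.

Lemma induced_ray_tail {G : graph} (R : nat -> G) a :
  induced_ray G R -> induced_ray G (fun i => R (a + i)).
Proof.
  intros h; apply induced_ray_intro.
  - intros i; replace (a + S i) with (S (a + i)) by lia; now apply ray_adj.
  - intros i j hij e; apply (ray_inj R) in e; [lia|assumption].
  - intros i j hij e; apply ray_step in e; [lia|assumption].
Qed.

(** The spoke [w n] starts on the rim, at its foot [R (s n)], and [k n = 0] makes it a single edge.
    The last clause concerns only rim vertices from the first foot on, as [fan_unavoidable] cuts off
    the part before it. *)
Definition fan_conf (G : graph) (v : G) (R : nat -> G) (s : nat -> nat)
    (w : nat -> nat -> G) (k : nat -> nat) :=
  induced_ray G R /\ increasing s /\ ~ on_ray R v /\
  (forall n, w n 0 = R (s n)) /\
  (forall n i, 1 <= i <= k n -> ~ on_ray R (w n i) /\ w n i <> v) /\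
  (forall n, ipath (w n) (k n)) /\
  (forall n i j, 1 <= i <= k n -> adj (w n i) (R j) -> i = 1 /\ j = s n) /\
  (forall n m i j, n <> m -> 1 <= i <= k n -> 1 <= j <= k m ->
     w n i <> w m j /\ ~ adj (w n i) (w m j)) /\
  (forall n i, i <= k n -> adj v (w n i) <-> i = k n) /\
  (forall j, s 0 <= j -> adj v (R j) -> exists n, j = s n /\ k n = 0).

Lemma fan_intro (H : graph) v R s w k :
  fan_conf H v R s w k -> s 0 = 0 ->
  (forall x, x = v \/ on_ray R x \/ exists n i, 1 <= i <= k n /\ x = w n i) ->
  F_infty H.
Proof.
  intros [hR [hs [hv [h0 [hw [hp [hwR [hd [hvw hvR]]]]]]]]] hs0 hc.
  (* The branch vertices are [v] and the feet [R (s n)]. Along each edge, [h] gives the vertices by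
     position and [m] the number of interior ones; [E] orients spokes towards the apex and the rim
     forwards. *)
  set (h := fun (x y : fan_vertex) i => match x, y with
    | fan_rim n, fan_apex => if i <=? k n then w n i else v
    | fan_rim n, fan_rim _ => R (s n + i)
    | _, _ => v end).
  set (m := fun (x y : fan_vertex) => match x, y with
    | fan_rim n, fan_apex => k n
    | fan_rim n, fan_rim _ => s (S n) - s n - 1
    | _, _ => 0 end).
  set (E := fun (x y : fan_vertex) => match x, y with
    | fan_rim n, fan_apex => True
    | fan_rim n, fan_rim l => l = S n
    | _, _ => False end).
  assert (hW : forall n i, i <= k n -> h (fan_rim n) fan_apex i = w n i).
  { intros n i hi; unfold h; destruct (Nat.leb_spec i (k n)); [reflexivity|lia]. }
  assert (hend : forall n, h (fan_rim n) fan_apex (S (k n)) = v).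
  { intros n; unfold h; destruct (Nat.leb_spec (S (k n)) (k n)); [lia|reflexivity]. }
  assert (hss : forall n, s n < s (S n)) by (intros; apply hs; lia).
  apply (subdivision_intro F_infty_graph (fun _ _ => True) H E
    (fun x => match x with fan_apex => v | fan_rim n => R (s n) end) h m).
  - intros [|i] [|j]; simpl; tauto.
  - intros [|i] [|j]; simpl; try tauto; lia.
  - trivial.
  - intros [|i] [|j] e; trivial.
    + exfalso; apply hv; now exists (s j).
    + exfalso; apply hv; now exists (s i).
    + apply (ray_inj R), (increasing_inj s) in e; trivial; congruence.
  - intros [|i] [|j]; drop_edge.
    + split; [rewrite hW by lia; apply h0|apply hend].
    + simpl; intros ->; split; f_equal; [lia|specialize (hss i); lia].
  - intros [|n] [|l] i; drop_edge.
    + intros hi; change (i <= k n) in hi; rewrite hW by assumption.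
      destruct (Nat.eq_dec i (k n)) as [->|hne].
      * rewrite hend; apply adj_sym, hvw; lia.
      * rewrite hW by lia; apply hp; lia.
    + intros _ _; simpl; replace (s n + S i) with (S (s n + i)) by lia; now apply ray_adj.
  - intros [|n] [|l] i j; drop_edge.
    + intros hi hj; change (1 <= i <= k n) in hi; change (1 <= j <= k n) in hj.
      rewrite !hW by lia; apply hp; lia.
    + intros _ hi hj e; apply (ray_inj R) in e; [lia|assumption].
  - tauto.
  - intros [|n] [|l] [|n'] i; drop_edge.
    + intros hi; change (1 <= i <= k n) in hi; rewrite hW by lia; now apply hw.
    + intros hi e; change (1 <= i <= k n) in hi; rewrite hW in e by lia.
      apply (proj1 (hw n i hi)); now exists (s n').
    + intros _ hi e; apply hv; now exists (s n + i).
    + intros _ hi e; apply (ray_inj R) in e; [|assumption]; simpl in hi.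
      destruct (lt_eq_lt_dec n n') as [[hl|<-]|hl]; [|lia|apply hs in hl; lia].
      apply (increasing_le s n n' hs) in hl; lia.
  - intros [|n] [|l] [|n'] [|l'] i j e1 e2; try (exact (False_ind _ e1));
      try (exact (False_ind _ e2)); intros hi hj e.
    + change (1 <= i <= k n) in hi; change (1 <= j <= k n') in hj.
      rewrite !hW in e by lia; split; [|easy].
      destruct (Nat.eq_dec n n') as [->|hne]; [easy|].
      exfalso; revert e; now apply hd.
    + change (1 <= i <= k n) in hi; rewrite hW in e by lia.
      exfalso; apply (proj1 (hw n i hi)); now exists (s n' + j).
    + change (1 <= j <= k n') in hj; rewrite hW in e by lia.
      exfalso; apply (proj1 (hw n' j hj)); now exists (s n + i).
    + simpl in e1, e2, hi, hj; subst l l'; apply (ray_inj R) in e; [|assumption].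
      enough (n = n') by (subst; auto).
      destruct (lt_eq_lt_dec n n') as [[hl|]|hl]; trivial; exfalso.
      * apply (increasing_le s n n' hs) in hl; simpl in *; lia.
      * apply (increasing_le s n' n hs) in hl; simpl in *; lia.
  - intros x; destruct (hc x) as [->|[[j ->]|[n [i [hi ->]]]]].
    + left; now exists fan_apex.
    + destruct (increasing_interval s j hs) as [n hn]; [lia|].
      destruct (Nat.eq_dec j (s n)) as [->|]; [left; now exists (fan_rim n)|].
      right; exists (fan_rim n), (fan_rim (S n)), (j - s n); simpl; repeat split; try lia.
      f_equal; lia.
    + right; exists (fan_rim n), fan_apex, i; repeat split; try apply hi.
      now rewrite hW by lia.
  - set (Q := fun x y => exists u v i, E u v /\ i <= m u v /\
      (x = h u v i /\ y = h u v (S i) \/ y = h u v i /\ x = h u v (S i))).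
    assert (Qsym : forall x y, Q x y -> Q y x).
    { intros x y [u [u' [i hi]]]; exists u, u', i; tauto. }
    assert (Qv : forall n, Q v (w n (k n))).
    { intros n; exists (fan_rim n), fan_apex, (k n); repeat split; [apply le_n|right].
      now rewrite hend, hW. }
    assert (Qw : forall n i, i < k n -> Q (w n i) (w n (S i))).
    { intros n i hi; exists (fan_rim n), fan_apex, i; repeat split; [simpl; lia|left].
      now rewrite !hW by lia. }
    assert (QR : forall j, Q (R j) (R (S j))).
    { intros j; destruct (increasing_interval s j hs) as [n hn]; [lia|].
      exists (fan_rim n), (fan_rim (S n)), (j - s n); simpl; repeat split; [lia|left].
      split; f_equal; lia. }
    assert (QvR : forall j, adj v (R j) -> Q v (R j)).
    { intros j a; apply hvR in a as [n [-> hk]]; [|lia].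
      rewrite <- h0, <- hk; apply Qv. }
    assert (Qvw : forall n i, i <= k n -> adj v (w n i) -> Q v (w n i)).
    { intros n i hi a; apply hvw in a as ->; trivial. }
    assert (QwR : forall n i j, 1 <= i <= k n -> adj (w n i) (R j) -> Q (w n i) (R j)).
    { intros n i j hi a; apply hwR in a as [-> ->]; [|assumption].
      rewrite <- h0; apply Qsym, Qw; lia. }
    intros x y a; change (Q x y).
    destruct (hc x) as [->|[[j ->]|[n [i [hi ->]]]]],
      (hc y) as [->|[[j' ->]|[n' [i' [hi' ->]]]]].
    + now apply adj_irrefl in a.
    + auto.
    + apply Qvw; [lia|assumption].
    + apply Qsym, QvR; now apply adj_sym.
    + apply ray_step in a as [->| ->]; auto.
    + apply Qsym, QwR; [assumption|now apply adj_sym].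
    + apply Qsym, Qvw; [lia|now apply adj_sym].
    + now apply QwR.
    + destruct (Nat.eq_dec n n') as [<-|hne]; [|now apply hd in a].
      apply hp in a as [->| ->]; try lia; [apply Qw|apply Qsym, Qw]; lia.
Qed.

(** The rim of a fan begins at a foot, so [R] is cut before [R (s 0)] and all positions on it are
    shifted by [s 0]. *)
Lemma fan_unavoidable (G : graph) v R s w k : fan_conf G v R s w k -> unavoidable G.
Proof.
  intros [hR [hs [hv [h0 [hw [hp [hwR [hd [hvw hvR]]]]]]]]].
  set (c := fun i => match i with
    | at_first | at_second => v
    | at_rim i => R (s 0 + i)
    | at_link n i => w n (Nat.min i (k n)) end).
  assert (hsn : forall n, s 0 <= s n).
  { intros [|n]; [lia|]; apply Nat.lt_le_incl, hs; lia. }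
  assert (htail : forall x, on_ray (fun i => R (s 0 + i)) x -> on_ray R x).
  { intros x [i ->]; now exists (s 0 + i). }
  right; exists (range_graph c); split; [apply range_induced|]; do 2 right; left.
  apply (fan_intro _ (into c at_first) (fun i => into c (at_rim i)) (fun n => s n - s 0)
    (fun n i => into c (at_link n i)) k); [|lia|].
  - split; [now apply (into_induced_ray c at_rim), induced_ray_tail|].
    split; [intros i j hij; specialize (hsn i); specialize (hs i j hij); lia|].
    split; [rewrite (into_on_ray c at_rim); intros h; now apply hv, htail|].
    split; [|split; [|split; [|split; [|split; [|split]]]]].
    + intros n; apply into_eq; simpl; rewrite h0; f_equal; specialize (hsn n); lia.
    + intros n i hi; rewrite (into_on_ray c at_rim), into_eq; simpl.
      rewrite clip by lia; split; [|now apply hw].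
      intros h; now apply (proj1 (hw n i hi)), htail.
    + intros n; apply (into_ipath c (at_link n) (w n)); [intros; now apply clip|apply hp].
    + intros n i j hi a; apply (into_adj1 c) in a; simpl in a; rewrite clip in a by lia.
      apply hwR in a; [lia|assumption].
    + intros n m i j hne hi hj; rewrite into_eq, into_adj; simpl.
      rewrite !clip by lia; now apply hd.
    + intros n i hi; rewrite into_adj; simpl; rewrite clip by assumption; now apply hvw.
    + intros j _ a; apply (into_adj1 c) in a; simpl in a.
      apply hvR in a as [n hn]; [|lia]; exists n; lia.
  - intros x; destruct (into_surj c x) as [[| |i|n i] ->].
    + now left.
    + left; now apply into_eq.
    + right; left; now exists i.
    + right; destruct (Nat.eq_dec (Nat.min i (k n)) 0) as [hi|hi].
      * left; exists (s n - s 0); apply into_eq; simpl; rewrite hi, h0; f_equal.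
        specialize (hsn n); lia.
      * right; exists n, (Nat.min i (k n)); split; [lia|].
        apply into_eq; simpl; f_equal; lia.
Qed.

(** All neighbours of [v] on [R] serve as feet, and every spoke is a single edge. *)
Lemma direct_fan (G : graph) v R :
  induced_ray G R -> ~ on_ray R v -> unbounded (fun j => adj v (R j)) -> unavoidable G.
Proof.
  intros hR hv h; apply enumerate in h as [e [he [h1 h2]]].
  apply (fan_unavoidable G v R e (fun n _ => R (e n)) (fun _ => 0)).
  split; [assumption|]; split; [assumption|]; split; [assumption|]; split; [easy|].
  split; [intros; lia|]; split; [|split; [intros; lia|split; [intros; lia|split]]].
  - intros n; repeat split; intros; try lia.
    now apply adj_irrefl in H1.
  - intros n i hi; split; [lia|auto].
  - intros j _ a; apply h2 in a as [n ->]; now exists n.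
Qed.

(** * Fans of triangles *)

(** In contrast to [fan_conf], the spoke [w n] starts off the rim, at the tip of the triangle over
    [R (lo n)] and [R (S (lo n))]. *)
Definition tfan_conf (G : graph) (v : G) (R : nat -> G) (lo : nat -> nat)
    (w : nat -> nat -> G) (k : nat -> nat) :=
  induced_ray G R /\ (forall n, S (lo n) < lo (S n)) /\ ~ on_ray R v /\
  (forall n i, i <= k n -> ~ on_ray R (w n i) /\ w n i <> v) /\
  (forall n, ipath (w n) (k n)) /\
  (forall n i j, i <= k n -> adj (w n i) (R j) <-> i = 0 /\ (j = lo n \/ j = S (lo n))) /\
  (forall n m i j, n <> m -> i <= k n -> j <= k m ->
     w n i <> w m j /\ ~ adj (w n i) (w m j)) /\
  (forall n i, i <= k n -> adj v (w n i) <-> i = k n) /\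
  (forall j, lo 0 <= j -> ~ adj v (R j)).

Lemma tfan_intro (H : graph) v R lo w k :
  tfan_conf H v R lo w k -> lo 0 = 0 ->
  (forall x, x = v \/ on_ray R x \/ exists n i, i <= k n /\ x = w n i) ->
  F_Delta_infty H.
Proof.
  intros [hR [hlo [hv [hw [hp [hwR [hd [hvw hvR]]]]]]]] hlo0 hc.
  (* [R (r j)] represents rim vertex [j] of [F_Delta_graph]: the feet of triangle [n] have numbers
     [2 * n] and [2 * n + 1]. Hence [r] can leave gaps only after odd numbers, exactly where the rim
     may be subdivided. *)
  set (r := fun j => lo (Nat.div2 j) + Nat.b2n (Nat.odd j)).
  assert (r2 : forall n, r (2 * n) = lo n).
  { intros n; unfold r; rewrite Nat.div2_double, Nat.odd_even; simpl; lia. }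
  assert (r21 : forall n, r (2 * n + 1) = S (lo n)).
  { intros n; unfold r; rewrite Nat.add_1_r, Nat.div2_succ_double, <- Nat.add_1_r.
    rewrite Nat.odd_odd; simpl; lia. }
  assert (par : forall j, exists n, j = 2 * n \/ j = 2 * n + 1).
  { intros j; destruct (Nat.Even_or_Odd j) as [[n h]|[n h]]; exists n; lia. }
  assert (hr : increasing r).
  { apply increasing_S; intros j; destruct (par j) as [n [->| ->]].
    - rewrite r2; replace (S (2 * n)) with (2 * n + 1) by lia; rewrite r21; lia.
    - rewrite r21; replace (S (2 * n + 1)) with (2 * S n) by lia; rewrite r2; apply hlo. }
  assert (hr0 : r 0 = 0) by exact (eq_trans (r2 0) hlo0).
  assert (hrS : forall j, r j < r (S j)) by (intros; apply hr; lia).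
  set (h := fun (x y : tfan_vertex) i => match x, y with
    | tfan_spoke n, tfan_apex => if i <=? k n then w n i else v
    | tfan_spoke n, tfan_rim j => if i =? 0 then w n 0 else R (r j)
    | tfan_rim j, tfan_rim _ => R (r j + i)
    | _, _ => v end).
  set (m := fun (x y : tfan_vertex) => match x, y with
    | tfan_spoke n, tfan_apex => k n
    | tfan_rim j, tfan_rim _ => r (S j) - r j - 1
    | _, _ => 0 end).
  set (E := fun (x y : tfan_vertex) => match x, y with
    | tfan_spoke n, tfan_apex => True
    | tfan_spoke n, tfan_rim j => j = 2 * n \/ j = 2 * n + 1
    | tfan_rim j, tfan_rim l => l = S j
    | _, _ => False end).
  assert (hW : forall n i, i <= k n -> h (tfan_spoke n) tfan_apex i = w n i).
  { intros n i hi; unfold h; destruct (Nat.leb_spec i (k n)); [reflexivity|lia]. }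
  assert (hend : forall n, h (tfan_spoke n) tfan_apex (S (k n)) = v).
  { intros n; unfold h; destruct (Nat.leb_spec (S (k n)) (k n)); [lia|reflexivity]. }
  assert (spR : forall n j, j = 2 * n \/ j = 2 * n + 1 -> adj (w n 0) (R (r j))).
  { intros n j [->| ->]; rewrite ?r2, ?r21; apply hwR; auto; lia. }
  assert (gap : forall j l i, 1 <= i <= r (S j) - r j - 1 -> r j + i <> r l).
  { intros j l i hi e; destruct (lt_eq_lt_dec j l) as [[hl|<-]|hl]; [|lia|apply hr in hl; lia].
    apply (increasing_le r j l hr) in hl; lia. }
  apply (subdivision_intro F_Delta_graph F_Delta_subdividable H E
    (fun x => match x with
      | tfan_apex => v | tfan_spoke n => w n 0 | tfan_rim j => R (r j) end) h m).
  - intros [|i|i] [|j|j]; simpl; tauto.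
  - intros [|i|i] [|j|j]; simpl; try tauto; lia.
  - intros [|i|i] [|j|j]; simpl; try tauto.
    intros [n hn]; exists n; tauto.
  - assert (hwv : forall n, w n 0 <> v) by (intros n; apply hw; lia).
    assert (hwr : forall n j, w n 0 <> R j).
    { intros n j e; apply (proj1 (hw n 0 (Nat.le_0_l _))); now exists j. }
    assert (hvr : forall j, v <> R j) by (intros j e; apply hv; now exists j).
    intros [|i|i] [|j|j] e; trivial;
      try (now apply hwv in e); try (now apply hwr in e); try (now apply hvr in e);
      try (symmetry in e; (now apply hwv in e) || (now apply hwr in e) || now apply hvr in e).
    + f_equal; destruct (Nat.eq_dec i j); [assumption|].
      exfalso; revert e; apply hd; trivial; lia.
    + apply (ray_inj R), (increasing_inj r) in e; trivial; congruence.
  - intros [|n|n] [|l|l]; drop_edge.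
    + split; [apply hW; lia|apply hend].
    + easy.
    + simpl; intros ->; split; f_equal; [lia|specialize (hrS n); lia].
  - intros [|n|n] [|l|l] i; drop_edge.
    + intros hi; change (i <= k n) in hi; rewrite hW by assumption.
      destruct (Nat.eq_dec i (k n)) as [->|hne].
      * rewrite hend; apply adj_sym, hvw; lia.
      * rewrite hW by lia; apply hp; lia.
    + intros e hi; simpl in hi; replace i with 0 by lia; now apply spR.
    + intros _ _; simpl; replace (r n + S i) with (S (r n + i)) by lia; now apply ray_adj.
  - intros [|n|n] [|l|l] i j; drop_edge; try (simpl; lia).
    + intros hi hj; change (1 <= i <= k n) in hi; change (1 <= j <= k n) in hj.
      rewrite !hW by lia; apply hp; lia.
    + intros _ hi hj e; apply (ray_inj R) in e; [lia|assumption].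
  - intros [|n|n] [|l|l]; drop_edge; simpl; try tauto.
    intros -> hS; destruct (par n) as [q [->| ->]].
    + rewrite r2; replace (S (2 * q)) with (2 * q + 1) by lia; rewrite r21; lia.
    + exfalso; apply hS; exists q; lia.
  - intros [|n|n] [|l|l] u i; drop_edge; try (simpl; lia).
    + intros hi; change (1 <= i <= k n) in hi; rewrite hW by lia.
      destruct u as [|n'|n'].
      * apply hw; lia.
      * destruct (Nat.eq_dec n n') as [<-|hne].
        -- intros e; apply hp in e; lia.
        -- apply hd; trivial; lia.
      * intros e; apply (proj1 (hw n i (proj2 hi))); now exists (r n').
    + intros _ hi e; simpl in hi, e; destruct u as [|n'|n'].
      * apply hv; eexists; symmetry; exact e.
      * apply (proj1 (hw n' 0 (Nat.le_0_l _))); eexists; symmetry; exact e.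
      * apply (ray_inj R) in e; [|assumption]; now apply gap in e.
  - intros [|n|n] [|l|l] [|n'|n'] [|l'|l'] i j e1 e2; try (exact (False_ind _ e1));
      try (exact (False_ind _ e2)); intros hi hj e; try (simpl in hi; lia);
      try (simpl in hj; lia).
    + change (1 <= i <= k n) in hi; change (1 <= j <= k n') in hj.
      rewrite !hW in e by lia; split; [|easy].
      destruct (Nat.eq_dec n n') as [->|hne]; [easy|].
      exfalso; revert e; apply hd; trivial; lia.
    + change (1 <= i <= k n) in hi; rewrite hW in e by lia.
      exfalso; apply (proj1 (hw n i (proj2 hi))); now exists (r n' + j).
    + change (1 <= j <= k n') in hj; rewrite hW in e by lia.
      exfalso; apply (proj1 (hw n' j (proj2 hj))); now exists (r n + i).
    + simpl in e1, e2, hi, hj; subst l l'; apply (ray_inj R) in e; [|assumption].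
      enough (n = n') by (subst; auto).
      destruct (lt_eq_lt_dec n n') as [[hl|]|hl]; trivial; exfalso.
      * apply (increasing_le r n n' hr) in hl; simpl in *; lia.
      * apply (increasing_le r n' n hr) in hl; simpl in *; lia.
  - intros x; destruct (hc x) as [->|[[j ->]|[n [i [hi ->]]]]].
    + left; now exists tfan_apex.
    + destruct (increasing_interval r j hr) as [n hn]; [lia|].
      destruct (Nat.eq_dec j (r n)) as [->|]; [left; now exists (tfan_rim n)|].
      right; exists (tfan_rim n), (tfan_rim (S n)), (j - r n); simpl; repeat split; try lia.
      f_equal; lia.
    + destruct (Nat.eq_dec i 0) as [->|]; [left; now exists (tfan_spoke n)|].
      right; exists (tfan_spoke n), tfan_apex, i; repeat split; simpl; try lia.
      symmetry; apply hW; lia.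
  - set (Q := fun x y => exists u v i, E u v /\ i <= m u v /\
      (x = h u v i /\ y = h u v (S i) \/ y = h u v i /\ x = h u v (S i))).
    assert (Qsym : forall x y, Q x y -> Q y x).
    { intros x y [u [u' [i hi]]]; exists u, u', i; tauto. }
    assert (Qvw : forall n i, i <= k n -> adj v (w n i) -> Q v (w n i)).
    { intros n i hi a; apply hvw in a as ->; trivial.
      exists (tfan_spoke n), tfan_apex, (k n); repeat split; [apply le_n|right].
      now rewrite hend, hW. }
    assert (Qw : forall n i, i < k n -> Q (w n i) (w n (S i))).
    { intros n i hi; exists (tfan_spoke n), tfan_apex, i; repeat split; [simpl; lia|left].
      now rewrite !hW by lia. }
    assert (QR : forall j, Q (R j) (R (S j))).
    { intros j; destruct (increasing_interval r j hr) as [n hn]; [lia|].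
      exists (tfan_rim n), (tfan_rim (S n)), (j - r n); simpl; repeat split; [lia|left].
      split; f_equal; lia. }
    assert (QwR : forall n i j, i <= k n -> adj (w n i) (R j) -> Q (w n i) (R j)).
    { intros n i j hi a; apply hwR in a as [-> hj]; [|assumption].
      destruct hj as [->| ->].
      - exists (tfan_spoke n), (tfan_rim (2 * n)), 0; split; [now left|].
        split; [lia|left]; split; [easy|]; change (R (lo n) = R (r (2 * n))); now rewrite r2.
      - exists (tfan_spoke n), (tfan_rim (2 * n + 1)), 0; split; [now right|].
        split; [lia|left]; split; [easy|].
        change (R (S (lo n)) = R (r (2 * n + 1))); now rewrite r21. }
    intros x y a; change (Q x y).
    destruct (hc x) as [->|[[j ->]|[n [i [hi ->]]]]],
      (hc y) as [->|[[j' ->]|[n' [i' [hi' ->]]]]].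
    + now apply adj_irrefl in a.
    + apply hvR in a; [easy|lia].
    + now apply Qvw.
    + apply adj_sym, hvR in a; [easy|lia].
    + apply ray_step in a as [->| ->]; auto.
    + apply Qsym, QwR; [assumption|now apply adj_sym].
    + apply Qsym, Qvw; [lia|now apply adj_sym].
    + now apply QwR.
    + destruct (Nat.eq_dec n n') as [<-|hne]; [|now apply hd in a].
      apply hp in a as [->| ->]; try lia; [apply Qw|apply Qsym, Qw]; lia.
Qed.

Lemma tfan_unavoidable (G : graph) v R lo w k : tfan_conf G v R lo w k -> unavoidable G.
Proof.
  intros [hR [hlo [hv [hw [hp [hwR [hd [hvw hvR]]]]]]]].
  set (c := fun i => match i with
    | at_first | at_second => v
    | at_rim i => R (lo 0 + i)
    | at_link n i => w n (Nat.min i (k n)) end).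
  assert (hl : forall n, lo 0 <= lo n).
  { induction n as [|n IH]; [lia|]; specialize (hlo n); lia. }
  assert (htail : forall x, on_ray (fun i => R (lo 0 + i)) x -> on_ray R x).
  { intros x [i ->]; now exists (lo 0 + i). }
  right; exists (range_graph c); split; [apply range_induced|]; do 3 right; left.
  apply (tfan_intro _ (into c at_first) (fun i => into c (at_rim i)) (fun n => lo n - lo 0)
    (fun n i => into c (at_link n i)) k); [|lia|].
  - split; [now apply (into_induced_ray c at_rim), induced_ray_tail|].
    split; [intros i; specialize (hl i); specialize (hlo i); lia|].
    split; [rewrite (into_on_ray c at_rim); intros h; now apply hv, htail|].
    split; [|split; [|split; [|split; [|split]]]].
    + intros n i hi; rewrite (into_on_ray c at_rim), into_eq; simpl.
      rewrite clip by lia; split; [|now apply hw].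
      intros h; now apply (proj1 (hw n i hi)), htail.
    + intros n; apply (into_ipath c (at_link n) (w n)); [intros; now apply clip|apply hp].
    + intros n i j hi; rewrite into_adj; simpl; rewrite clip by lia.
      rewrite hwR by assumption; specialize (hl n); lia.
    + intros n m i j hne hi hj; rewrite into_eq, into_adj; simpl.
      rewrite !clip by lia; now apply hd.
    + intros n i hi; rewrite into_adj; simpl; rewrite clip by assumption; now apply hvw.
    + intros j _ a; apply (into_adj1 c) in a; simpl in a; apply hvR in a; [easy|lia].
  - intros x; destruct (into_surj c x) as [[| |i|n i] ->].
    + now left.
    + left; now apply into_eq.
    + right; left; now exists i.
    + right; right; exists n, (Nat.min i (k n)); split; [lia|].
      apply into_eq; simpl; f_equal; lia.
Qed.

(** * Infinitely many disjoint finite sets *)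

Definition finite_disjoint {V : Type} (P : nat -> V -> Prop) :=
  (forall n, exists l, forall x, P n x -> In x l) /\
  (forall n m x, P n x -> P m x -> n = m).

Definition nonadjacent_subsequence {G : graph} (P : nat -> G -> Prop) :=
  exists e, increasing e /\
    forall i j x y, i <> j -> P (e i) x -> P (e j) y -> ~ adj x y.

(** If Ramsey's theorem yields sets that are pairwise joined by edges, some vertex of a finite set
    sees infinitely many later sets, by the pigeonhole principle. Repeating this among those later
    sets gives any number of hubs with a common infinite [N]. *)
Lemma hubs (G : graph) (P : nat -> G -> Prop) :
  finite_disjoint P ->
  nonadjacent_subsequence P \/
  forall K, exists xs, NoDup xs /\ length xs = K /\ exists N, unbounded N /\
    forall x, In x xs -> (exists m, P m x) /\
      forall n, N n -> ~ P n x /\ exists y, P n y /\ adj x y.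
Proof.
  intros [hfin hdis].
  destruct (ramsey (fun i j => exists x y, P i x /\ P j y /\ adj x y)) as [e [he [hC|hC]]].
  - right.
    assert (H : forall K, exists xs, NoDup xs /\ length xs = K /\ exists N, unbounded N /\
      forall x, In x xs -> (exists m, P m x) /\
        forall n, N n -> ~ P (e n) x /\ exists y, P (e n) y /\ adj x y).
    { induction K as [|K [xs [h1 [h2 [N [h3 h4]]]]]].
      - exists []; repeat split; [constructor|]; exists (fun _ => True).
        split; [intros n; exists n; split; [lia|easy]|intros x []].
      - destruct (h3 0) as [i0 [_ hi0]]; destruct (hfin (e i0)) as [l hl].
        destruct (unbounded_pigeonhole l (fun x i => N i /\ i0 < i /\ P (e i0) x /\
          exists y, P (e i) y /\ adj x y)) as [x [hx hN]].
        { intros M; destruct (h3 (S (M + i0))) as [i [hi1 hi2]].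
          destruct (hC i0 i) as [x [y [hx [hy ha]]]]; [lia|].
          exists i; split; [lia|]; exists x; split; [auto|].
          split; [assumption|]; split; [lia|]; split; [assumption|]; eauto. }
        destruct (hN 0) as [i1 [_ [_ [_ [hPx _]]]]].
        exists (x :: xs); split; [|split; [simpl; congruence|]].
        + constructor; [|assumption]; intros hin.
          destruct (h4 x hin) as [_ h5]; now apply (h5 i0 hi0).
        + eexists; split; [exact hN|]; intros x' [<-|hx'].
          * split; [eauto|]; intros i [_ [h6 [h7 h8]]]; split; [|assumption].
            intros h9; apply (hdis _ _ _ h7), (increasing_inj e) in h9; trivial; lia.
          * destruct (h4 x' hx') as [h5 h6]; split; [assumption|].
            intros n [h7 _]; auto. }
    intros K; destruct (H K) as [xs [h1 [h2 [N [h3 h4]]]]].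
    exists xs; repeat split; trivial; exists (fun n => exists i, N i /\ n = e i); split.
    + intros M; destruct (h3 M) as [i [hi1 hi2]]; exists (e i).
      split; [pose proof (increasing_ge e i he); lia|eauto].
    + intros x hx; destruct (h4 x hx) as [h5 h6]; split; [assumption|].
      intros n [i [hi ->]]; auto.
  - left; exists e; split; [assumption|]; intros i j x y hij hx hy ha.
    destruct (lt_eq_lt_dec i j) as [[hl|]|hl]; [|contradiction|].
    + apply (hC i j hl); eauto.
    + apply (hC j i hl); exists y, x; repeat split; trivial; now apply adj_sym.
Qed.

Lemma list_pigeonhole {T} (xs : list T) M (R : T -> nat -> Prop) :
  NoDup xs -> S M < length xs -> (forall x, In x xs -> exists j, j <= M /\ R x j) ->
  exists x y j, In x xs /\ In y xs /\ x <> y /\ R x j /\ R y j.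
Proof.
  intros hnd hlen hR.
  destruct (choice_fun (fun x j => In x xs -> j <= M /\ R x j)) as [c hc].
  { intros x; destruct (classic (In x xs)) as [h|h]; [|now exists 0].
    destruct (hR x h) as [j hj]; eauto. }
  apply NNPP; intros hn.
  assert (h : NoDup (map c xs)).
  { apply NoDup_map_NoDup_ForallPairs; [|assumption].
    intros x y hx hy e; apply NNPP; intros hne; apply hn; exists x, y, (c x).
    repeat split; trivial; [now apply hc|rewrite e; now apply hc]. }
  assert (hl : length (map c xs) <= length (seq 0 (S M))).
  - apply NoDup_incl_length; [assumption|]; intros j hj.
    apply in_map_iff in hj as [x [<- hx]]; apply in_seq.
    destruct (hc x hx); lia.
  - rewrite length_map, length_seq in hl; lia.
Qed.

(** Each [P n] has at most one vertex on each of [M + 1] levels, so two of [M + 2] hubs see the same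
    vertex of [P n]. One pair of hubs recurs for infinitely many [n] and so has infinitely many
    common neighbours. *)
Lemma bounded_levels (G : graph) (P : nat -> G -> Prop) (lev : G -> nat) M :
  finite_disjoint P ->
  (forall n x, P n x -> lev x <= M) ->
  (forall n x y, P n x -> P n y -> lev x = lev y -> x = y) ->
  nonadjacent_subsequence P \/ unavoidable G.
Proof.
  intros hfd hM hinj; destruct (hubs G P hfd) as [h|h]; [now left|right].
  destruct (h (S (S M))) as [xs [h1 [h2 [N [h3 h4]]]]].
  destruct (unbounded_pigeonhole (list_prod xs xs) (fun p n =>
    fst p <> snd p /\ exists y, P n y /\ adj (fst p) y /\ adj (snd p) y))
    as [[a b] [_ hN]].
  { intros n0; destruct (h3 n0) as [n [hn hNn]]; exists n; split; [assumption|].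
    destruct (list_pigeonhole xs M (fun x j => exists y, P n y /\ adj x y /\ lev y = j))
      as [a [b [j [ha [hb [hab [[y [hy1 [hy2 hy3]]] [z [hz1 [hz2 hz3]]]]]]]]]].
    - assumption.
    - lia.
    - intros x hx; destruct (proj2 (h4 x hx) n hNn) as [_ [y [hy1 hy2]]].
      exists (lev y); split; [now apply (hM n)|now exists y].
    - exists (a, b); split; [now apply in_prod|]; split; [assumption|].
      assert (y = z) as <- by (apply (hinj n); congruence).
      eauto. }
  destruct (enumerate _ hN) as [e [he [hP _]]]; simpl in hP.
  destruct (choice_fun (fun n y => P (e n) y /\ adj a y /\ adj b y)) as [y hy].
  { intros n; apply hP. }
  apply (common_neighbours G a b); [apply (hP 0)|].
  apply (infset_image y (fun _ => True)).
  - intros i j eij; apply (increasing_inj e); [assumption|].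
    apply (proj2 hfd (e i) (e j) (y i)); [apply hy|rewrite eij; apply hy].
  - intros n; exists n; split; [lia|easy].
  - intros n _; apply hy.
Qed.

Definition on_path {V : Type} (f : nat -> V) k x := exists i, i <= k /\ x = f i.

Lemma on_path_finite {V : Type} (f : nat -> V) k :
  exists l, forall x, on_path f k x -> In x l.
Proof.
  exists (map f (seq 0 (S k))); intros x [i [hi ->]]; apply in_map_seq.
  exists i; split; [lia|easy].
Qed.

Lemma walk_on_path {G : graph} (A : G -> Prop) f k : walk A f k -> walk (on_path f k) f k.
Proof. intros [h1 h2]; split; [|assumption]; intros i hi; now exists i. Qed.

(** If the paths are pairwise adjacent, two hubs [a], [b] see all of them at
    bounded level, so bounded initial pieces of the paths link [a] to [b]. *)
Lemma levelled_paths (G : graph) (A : G -> Prop) (lev : G -> nat)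
    (f : nat -> nat -> G) (k d : nat -> nat) :
  (forall x y, A x -> A y -> adj x y -> lev y <= S (lev x)) ->
  (forall n, walk A (f n) (k n)) ->
  (forall n i, i <= k n -> lev (f n i) = d n + i) ->
  (forall n m i j, i <= k n -> j <= k m -> f n i = f m j -> n = m) ->
  nonadjacent_subsequence (fun n => on_path (f n) (k n)) \/ unavoidable G.
Proof.
  intros hlip hw hlev hdis.
  assert (hfd : finite_disjoint (fun n => on_path (f n) (k n))).
  { split; [intros n; apply on_path_finite|].
    intros n m x [i [hi ->]] [j [hj e]]; eauto. }
  destruct (hubs G _ hfd) as [h|h]; [now left|right].
  destruct (h 2) as [xs [h1 [h2 [N [h3 h4]]]]].
  destruct xs as [|a [|b [|? ?]]]; try discriminate.
  destruct (enumerate _ h3) as [e [he [hN _]]].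
  (* Hubs lie on paths and hence in [A], so their neighbours on the paths are at most one level
     higher than themselves. *)
  set (M := S (Nat.max (lev a) (lev b))).
  set (P := fun n x => on_path (f (e n)) (k (e n)) x /\ lev x <= M).
  assert (hA : forall n x, on_path (f n) (k n) x -> A x).
  { intros n x [i [hi ->]]; now apply hw. }
  destruct (bounded_levels G P lev M) as [[e' [he' hna]]|]; [| | |clear hfd|assumption].
  - split.
    + intros n; destruct (on_path_finite (f (e n)) (k (e n))) as [l hl]; exists l.
      intros x [hx _]; auto.
    + intros n m x [hx _] [hy _]; apply (increasing_inj e); [assumption|].
      now apply (proj2 hfd _ _ x).
  - intros n x; apply proj2.
  - intros n x y [[i [hi ->]] _] [[j [hj ->]] _] eq; rewrite !hlev in eq by assumption.
    f_equal; lia.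
  - assert (ha := h4 a (or_introl eq_refl)).
    assert (hb := h4 b (or_intror (or_introl eq_refl))).
    assert (near : forall c n, In c [a; b] -> exists y, P n y /\ adj c y).
    { intros c n hc; destruct (h4 c hc) as [[m hm] h5].
      destruct (h5 (e n) (hN n)) as [_ [y [hy1 hy2]]]; exists y; split; [|assumption].
      split; [assumption|].
      assert (lev y <= S (lev c)) by (apply hlip; eauto).
      destruct hc as [<-|[<-|[]]]; lia. }
    apply (theta_of_sets G a b (fun n => P (e' n))).
    + inversion h1; subst; intros ->; apply H1; now left.
    + intros n; split; intros [h5 _].
      * now apply (proj2 ha _ (hN (e' n))).
      * now apply (proj2 hb _ (hN (e' n))).
    + intros n m x y hne hx hy; split.
      * intros ->; apply hne, (increasing_inj (fun n => e (e' n))).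
        -- now apply increasing_comp.
        -- destruct hx as [[i [hi ->]] _], hy as [[j [hj eq]] _].
           now apply hdis in eq.
      * now apply (hna n m).
    + intros n; destruct (near a (e' n)) as [x [hx hax]]; [now left|].
      destruct (near b (e' n)) as [y [hy hby]]; [right; now left|].
      exists x, y; repeat split; trivial.
      destruct hx as [[i [hi ->]] hx], hy as [[j [hj ->]] hy].
      rewrite hlev in hx, hy by assumption.
      (* Levels grow by one along the path, so its part up to level [M] is an initial segment, and
         it contains both [x] and [y]. *)
      apply (walk_conn _ _ (Nat.min (k (e (e' n))) (M - d (e (e' n))))); try lia; split.
      * intros t ht; split; [exists t; split; [lia|easy]|rewrite hlev; lia].
      * intros t ht; apply hw; lia.
Qed.

(** * Geodesic trees *)

(** [anc u n] is the vertex at level [n] on a fixed geodesic from [r] to [u]. *)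
Definition geodesic_tree {G : graph} (A : G -> Prop) (r : G) (lev : G -> nat)
    (anc : G -> nat -> G) :=
  A r /\ lev r = 0 /\
  (forall x y, A x -> A y -> adj x y -> lev y <= S (lev x)) /\
  (forall u n, A u -> n <= lev u -> A (anc u n) /\ lev (anc u n) = n) /\
  (forall u, A u -> anc u (lev u) = u) /\
  (forall u n, A u -> n < lev u -> adj (anc u n) (anc u (S n))) /\
  (forall u m n, A u -> m <= n -> n <= lev u -> anc (anc u n) m = anc u m) /\
  (forall u, A u -> anc u 0 = r).

(** [lev] is the distance from [r] inside [A], and [par] chooses a neighbour one level lower.
    Reading all geodesics off the iterates of the one function [par] makes them agree from any
    common vertex down. *)
Lemma geodesic_tree_exists {G : graph} (A : G -> Prop) r :
  A r -> (forall x, A x -> conn A r x) -> exists lev anc, geodesic_tree A r lev anc.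
Proof.
  intros hr hc.
  set (wl := fun n x => exists f, walk A f n /\ f 0 = r /\ f n = x).
  assert (wlS : forall n x y, wl n x -> adj x y -> A y -> wl (S n) y).
  { intros n x y [f [[h1 h2] [h3 h4]]] ha hy.
    exists (fun i => if i <=? n then f i else y); repeat split.
    - intros i hi; destruct (Nat.leb_spec i n); auto.
    - intros i hi; destruct (Nat.leb_spec i n), (Nat.leb_spec (S i) n); try lia; auto.
      replace i with n by lia; now rewrite h4.
    - assumption.
    - destruct (Nat.leb_spec (S n) n); [lia|reflexivity]. }
  destruct (choice_fun (fun x n => A x -> wl n x /\ forall m, wl m x -> n <= m)) as [lev hlev].
  { intros x; destruct (classic (A x)) as [hx|hx]; [|now exists 0].
    destruct (least (fun n => wl n x)) as [n hn]; [|now exists n].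
    destruct (conn_walk _ _ _ (hc x hx)) as [f [n hf]]; now exists n, f. }
  assert (hlip : forall x y, A x -> A y -> adj x y -> lev y <= S (lev x)).
  { intros x y hx hy ha; apply (hlev y hy); apply wlS with x; trivial; now apply hlev. }
  assert (hr0 : lev r = 0).
  { enough (lev r <= 0) by lia; apply (hlev r hr); exists (fun _ => r).
    repeat split; trivial; intros; lia. }
  destruct (choice_fun (fun y x => A y -> 0 < lev y -> A x /\ adj x y /\ lev y = S (lev x)))
    as [par hpar].
  { intros y; destruct (classic (A y /\ 0 < lev y)) as [[hy hl]|hn]; [|exists y; tauto].
    destruct (proj1 (hlev y hy)) as [f [[h1 h2] [h3 h4]]].
    destruct (lev y) as [|n] eqn:en; [lia|].
    exists (f n); intros _ _; assert (hfn : A (f n)) by (apply h1; lia).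
    assert (ha : adj (f n) y) by (rewrite <- h4; apply h2; lia).
    repeat split; trivial.
    assert (lev (f n) <= n).
    { apply (hlev _ hfn); exists f; repeat split; trivial; intros; [apply h1|apply h2]; lia. }
    specialize (hlip _ _ hfn hy ha); lia. }
  assert (hit : forall u j, A u -> j <= lev u ->
    A (Nat.iter j par u) /\ lev (Nat.iter j par u) = lev u - j).
  { intros u j hu; induction j as [|j IH]; intros hj; simpl; [split; [assumption|lia]|].
    destruct IH as [h1 h2]; [lia|]; destruct (hpar _ h1) as [h3 [h4 h5]]; [lia|].
    split; [assumption|lia]. }
  exists lev, (fun u n => Nat.iter (lev u - n) par u).
  split; [assumption|]; split; [assumption|]; split; [assumption|].
  split; [|split; [|split; [|split]]].
  - intros u n hu hn; destruct (hit u (lev u - n) hu) as [h1 h2]; [lia|].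
    split; [assumption|lia].
  - intros u _; now rewrite Nat.sub_diag.
  - intros u n hu hn; destruct (hit u (lev u - S n) hu) as [h1 h2]; [lia|].
    replace (lev u - n) with (S (lev u - S n)) by lia; simpl; apply hpar; [assumption|lia].
  - intros u m n hu hmn hn; destruct (hit u (lev u - n) hu) as [h1 h2]; [lia|].
    rewrite h2, <- Nat.iter_add; f_equal; lia.
  - intros u hu; destruct (hit u (lev u - 0) hu) as [h1 h2]; [lia|].
    destruct (proj1 (hlev _ h1)) as [f [_ [h3 h4]]].
    rewrite <- h4, <- h3; f_equal; lia.
Qed.

(** Call a vertex big if infinitely many elements of [U] lie above it. A big vertex without a big
    child has elements of [U] above infinitely many children, which is a star; if every big vertex
    has a big child, following these from [r] gives the ray of a comb. *)
Lemma star_or_comb {G : graph} (A U : G -> Prop) r lev anc :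
  geodesic_tree A r lev anc -> (forall u, U u -> A u) -> infset U ->
  (exists x (u : nat -> G), A x /\
    (forall n, U (u n) /\ lev x < lev (u n) /\ anc (u n) (lev x) = x) /\
    (forall n m, n <> m -> anc (u n) (S (lev x)) <> anc (u m) (S (lev x)))) \/
  (exists R, R 0 = r /\ (forall n, A (R n) /\ lev (R n) = n /\ adj (R n) (R (S n))) /\
    (forall n, infset (fun u => U u /\ n <= lev u /\ anc u n = R n))).
Proof.
  intros [hr [hr0 [hlip [hanc [hself [hstep [hco h0]]]]]]] hUA hU.
  set (big := fun x => A x /\ infset (fun u => U u /\ lev x <= lev u /\ anc u (lev x) = x)).
  destruct (classic (exists x, big x /\
    forall y, ~ (big y /\ lev y = S (lev x) /\ adj x y))) as [[x [[hx hbig] hno]]|hall].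
  - left.
    destruct (greedy (fun l u => U u /\ lev x < lev u /\ anc u (lev x) = x /\
      forall u', In u' l -> anc u' (S (lev x)) <> anc u (S (lev x)))) as [u hu].
    { intros l; apply NNPP; intros hn.
      destruct (infset_pigeonhole l (fun u' u => U u /\ lev x < lev u /\
        anc u (lev x) = x /\ anc u' (S (lev x)) = anc u (S (lev x)))) as [u' [hu' hinf]].
      (* Adding [x] to the avoided list excludes the case [u = x], so [u] lies strictly above
         [x]. *)
      { intros l'; destruct (hbig (x :: l')) as [u [[h1 [h2 h3]] h4]].
        exists u; split; [|intros h; apply h4; now right].
        assert (h5 : lev x < lev u).
        { destruct (Nat.eq_dec (lev x) (lev u)) as [e|]; [|lia].
          exfalso; apply h4; left; rewrite <- h3, e; auto. }
        apply NNPP; intros hn'; apply hn; exists u; repeat split; trivial.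
        intros u' hu' e; apply hn'; eauto 6. }
      destruct (hinf []) as [w [[hw1 [hw2 [hw3 hw4]]] _]].
      destruct (hanc w (S (lev x))) as [h1 h2]; [auto|lia|].
      apply (hno (anc w (S (lev x)))); split; [|split; [assumption|]].
      - split; [assumption|]; rewrite h2; revert hinf; apply infset_mono.
        intros v [hv1 [hv2 [hv3 hv4]]]; repeat split; [assumption|lia|congruence].
      - rewrite <- hw3 at 1; apply hstep; auto. }
    exists x, u; split; [assumption|]; split.
    + intros n; destruct (hu n); tauto.
    + assert (hlt : forall n m, n < m -> anc (u n) (S (lev x)) <> anc (u m) (S (lev x))).
      { intros n m hnm; apply hu, in_map_seq; exists n; split; [lia|easy]. }
      intros n m hne; destruct (lt_eq_lt_dec n m) as [[hl|]|hl]; [auto|contradiction|].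
      apply not_eq_sym; auto.
  - right.
    destruct (choice_fun (fun x y => big x -> big y /\ lev y = S (lev x) /\ adj x y))
      as [g hg].
    { intros x; destruct (classic (big x)) as [hx|hx]; [|now exists x].
      apply NNPP; intros hn; apply hall; exists x; split; [assumption|].
      intros y hy; apply hn; now exists y. }
    set (R := fun n => Nat.iter n g r).
    assert (hR : forall n, big (R n) /\ lev (R n) = n).
    { induction n as [|n [h1 h2]].
      - split; [split; [assumption|]|assumption].
        revert hU; apply infset_mono; intros u hu; change (R 0) with r.
        rewrite hr0; repeat split; [assumption|lia|auto].
      - destruct (hg _ h1) as [h3 [h4 _]]; split; [exact h3|]; simpl.
        now rewrite h4, h2. }
    exists R; split; [reflexivity|]; split.
    + intros n; destruct (hR n) as [h1 h2]; repeat split; [apply h1|assumption|].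
      apply (hg _ h1).
    + intros n; destruct (hR n) as [[_ h1] h2]; now rewrite h2 in h1.
Qed.

(** The level equals the index on [R], and an edge raises the level by at most one, so there are no
    chords. *)
Lemma geodesic_ray {G : graph} (A : G -> Prop) lev (R : nat -> G) :
  (forall x y, A x -> A y -> adj x y -> lev y <= S (lev x)) ->
  (forall n, A (R n) /\ lev (R n) = n /\ adj (R n) (R (S n))) -> induced_ray G R.
Proof.
  intros hlip hR; apply induced_ray_intro.
  - intros i; apply hR.
  - intros i j hij e; destruct (hR i) as [_ [h1 _]], (hR j) as [_ [h2 _]]; rewrite e in h1; lia.
  - intros i j hij ha; destruct (hR i) as [h0 [h1 _]], (hR j) as [h0' [h2 _]].
    specialize (hlip _ _ h0 h0' ha); lia.
Qed.

(** * Rerouting a ray *)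

Lemma monotone_gap (lo hi : nat -> nat) c :
  (forall n, lo n <= hi n) -> (forall n, c + hi n < lo (S n)) ->
  forall n m, n < m -> c + hi n < lo m.
Proof.
  intros h1 h2 n m hnm; induction hnm as [|m hnm IH]; [apply h2|].
  specialize (h1 m); specialize (h2 m); lia.
Qed.

(** The new ray replaces the segment of [R] strictly between [lo n] and [hi n]
    by [t n]. The vertex [R i] has position [2 i], the vertex [t n] has
    position [2 lo n + 1]. *)
Lemma reroute (G : graph) (R t : nat -> G) (lo hi : nat -> nat) :
  induced_ray G R ->
  (forall n, S (S (lo n)) <= hi n) ->
  (forall n, hi n < lo (S n)) ->
  (forall n, ~ on_ray R (t n)) ->
  (forall n j, adj (t n) (R j) -> lo n <= j <= hi n) ->
  (forall n, adj (t n) (R (lo n)) /\ adj (t n) (R (hi n))) ->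
  (forall n m, n <> m -> t n <> t m /\ ~ adj (t n) (t m)) ->
  exists R' s, induced_ray G R' /\ (forall n, S (s n) < s (S n)) /\
    (forall n, R' (s n) = t n) /\
    (forall i, (exists n, i = s n /\ R' i = t n) \/ (exists j, R' i = R j)).
Proof.
  intros hR hlh hgap hoff hin hends hd.
  assert (hmono : forall n m, n < m -> hi n < lo m).
  { apply (monotone_gap lo hi 0); [intros n; specialize (hlh n); lia|assumption]. }
  assert (tri : forall n m, n = m \/ hi n < lo m \/ hi m < lo n).
  { intros n m; destruct (lt_eq_lt_dec n m) as [[hl|]|hl]; auto. }
  set (pos := fun p x => (exists i, p = 2 * i /\ x = R i /\ forall n, ~ (lo n < i < hi n)) \/
    (exists n, p = 2 * lo n + 1 /\ x = t n)).
  assert (hpt : forall n x, pos (2 * lo n + 1) x -> x = t n).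
  { intros n x [[i [h _]]|[m [h ->]]]; [lia|].
    destruct (tri n m) as [->|[h'|h']]; trivial; pose proof (hlh n); pose proof (hlh m); lia. }
  assert (hhi : forall n, pos (2 * hi n) (R (hi n))).
  { intros n; left; exists (hi n); repeat split; trivial.
    intros m; pose proof (hlh n); pose proof (hlh m);
      destruct (tri n m) as [->|[h|h]]; lia. }
  (* The occupied positions in increasing order give the new ray; as none is skipped, vertices with
     no occupied position between them are consecutive. *)
  destruct (enumerate (fun p => exists x, pos p x)) as [e [he [hpos hsurj]]].
  { intros N; exists (2 * lo N + 1); split; [|exists (t N); right; now exists N].
    enough (N <= lo N) by lia; apply increasing_ge.
    intros i j hij; specialize (hmono i j hij); specialize (hlh i); lia. }
  destruct (choice_fun (fun n x => pos (e n) x) hpos) as [R' hR'].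
  assert (hbetween : forall i p, e i < p -> (exists x, pos p x) -> e (S i) <= p).
  { intros i p hp hx; destruct (hsurj p hx) as [j ->].
    destruct (le_lt_dec j i) as [h|h].
    - destruct (Nat.eq_dec j i) as [->|]; [lia|]; specialize (he j i ltac:(lia)); lia.
    - destruct (Nat.eq_dec j (S i)) as [->|]; [lia|]; specialize (he (S i) j ltac:(lia)); lia. }
  assert (heS : forall i, e i < e (S i)) by (intros; apply he; lia).
  assert (hstep : forall i, adj (R' i) (R' (S i))).
  { intros i.
    assert (key : forall p x, e i < p -> pos p x ->
      (forall q y, e i < q -> q < p -> ~ pos q y) -> pos p (R' (S i))).
    { intros p x h1 h2 h3.
      assert (e (S i) = p) as <-; [|apply hR'].
      assert (e (S i) <= p) by (apply hbetween; eauto).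
      destruct (Nat.eq_dec (e (S i)) p); [assumption|].
      exfalso; apply (h3 (e (S i)) (R' (S i))); [apply heS|lia|apply hR']. }
    destruct (hR' i) as [[j [h1 [h2 h3]]]|[n [h1 h2]]].
    - destruct (classic (exists n, j = lo n)) as [[n ->]|hn].
      + assert (h : pos (2 * lo n + 1) (R' (S i))).
        { apply (key _ (t n)); [lia| |intros; lia]; right; now exists n. }
        apply hpt in h; rewrite h, h2; apply adj_sym, hends.
      + assert (h : pos (2 * S j) (R' (S i))).
        { apply (key _ (R (S j))); [lia| |].
          - left; exists (S j); repeat split; trivial; intros n hn'.
            apply (h3 n); enough (lo n <> j) by lia; intros <-; apply hn; eauto.
          - intros q y hq1 hq2 [[i' [e1 _]]|[n [e1 _]]]; [lia|].
            apply hn; exists n; lia. }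
        destruct h as [[j' [e1 [e2 _]]]|[n [e1 _]]]; [|lia].
        rewrite e2, h2; replace j' with (S j) by lia; now apply ray_adj.
    - assert (h : pos (2 * hi n) (R' (S i))).
      { apply (key _ (R (hi n))); [specialize (hlh n); lia|apply hhi|].
        intros q y hq1 hq2 [[i' [e1 [_ e2]]]|[m [e1 _]]].
        - apply (e2 n); lia.
        - pose proof (hlh n); pose proof (hlh m);
            destruct (tri n m) as [<-|[h'|h']]; lia. }
      destruct h as [[j' [e1 [e2 _]]]|[m [e1 _]]]; [|lia].
      rewrite e2, h2; replace j' with (hi n) by lia; apply hends. }
  assert (hne : forall i j, i < j -> R' i <> R' j).
  { intros i j hij; specialize (he i j hij).
    destruct (hR' i) as [[i' [h1 [-> _]]]|[n [h1 ->]]], (hR' j) as [[j' [h3 [-> _]]]|[m [h3 ->]]].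
    - intros h; apply ray_inj in h; [lia|assumption].
    - intros h; apply (hoff m); eexists; symmetry; exact h.
    - intros h; apply (hoff n); eexists; exact h.
    - apply hd; intros ->; lia. }
  assert (hadj : forall i j, i < j -> adj (R' i) (R' j) -> j = S i).
  { intros i j hij ha; pose proof (he i j hij) as heij.
    (* An edge between two vertices of the new ray leaves no occupied position between theirs. *)
    assert (hno : forall q, e i < q -> q < e j -> ~ exists y, pos q y).
    { intros q hq1 hq2 [y hy].
      destruct (hR' i) as [[i' [h1 [h2 h2']]]|[n [h1 h2]]],
        (hR' j) as [[j' [h3 [h4 h4']]]|[m [h3 h4]]]; rewrite h2, h4 in ha.
      - apply ray_step in ha; [|assumption].
        destruct hy as [[q' [e1 _]]|[n [e1 _]]]; [lia|].
        apply (h4' n); specialize (hlh n); lia.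
      - apply adj_sym, hin in ha; lia.
      - apply hin in ha; pose proof (h4' n) as h5; pose proof (hlh n).
        destruct hy as [[q' [e1 [_ e2]]]|[m [e1 _]]].
        + apply (e2 n); lia.
        + pose proof (hlh m); destruct (tri n m) as [<-|[h'|h']]; lia.
      - apply (proj2 (hd n m ltac:(intros ->; lia)) ha). }
    destruct (Nat.eq_dec j (S i)) as [|hne']; [assumption|].
    exfalso; apply (hno (e (S i))); [apply heS|apply he; lia|apply hpos]. }
  destruct (choice_fun (fun n i => 2 * lo n + 1 = e i)) as [s hs].
  { intros n; apply hsurj; exists (t n); right; now exists n. }
  assert (hst : forall n, R' (s n) = t n) by (intros n; apply hpt; rewrite hs; apply hR').
  exists R', s; split; [now apply induced_ray_intro|split; [|split; [assumption|]]].
  (* [R (hi n)] lies strictly between [t n] and [t (S n)] on the new ray, so these are not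
     consecutive. *)
  - intros n; destruct (hsurj (2 * hi n)) as [i hi']; [eauto|].
    assert (h1 : e (s n) < e i) by (rewrite <- hs, <- hi'; specialize (hlh n); lia).
    assert (h2 : e i < e (s (S n))) by (rewrite <- hs, <- hi'; specialize (hgap n); lia).
    assert (s n < i).
    { destruct (le_lt_dec i (s n)) as [h|]; [|assumption].
      destruct (Nat.eq_dec i (s n)) as [->|]; [lia|]; specialize (he i (s n) ltac:(lia)); lia. }
    assert (i < s (S n)); [|lia].
    destruct (le_lt_dec (s (S n)) i) as [h|]; [|assumption].
    destruct (Nat.eq_dec (s (S n)) i) as [<-|]; [lia|].
    specialize (he (s (S n)) i ltac:(lia)); lia.
  - intros i; destruct (hR' i) as [[j [_ [h _]]]|[n [h1 h2]]]; [right; eauto|left].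
    exists n; split; [|assumption]; apply (increasing_inj e); [assumption|].
    now rewrite <- hs.
Qed.

(** * Links attached to a ray *)

(** The link [w n] either starts on the ray, at [R (lo n)] (when [o] is true),
    or it starts next to the ray, all neighbours of [w n 0] on [R] being between
    [R (lo n)] and [R (hi n)]. *)
Definition side {G : graph} (o : bool) (R : nat -> G) (w : nat -> nat -> G)
    (k lo hi : nat -> nat) :=
  (forall n i, i <= k n -> on_ray R (w n i) -> o = true /\ i = 0) /\
  (forall n i j, 1 <= i <= k n -> adj (w n i) (R j) -> o = true /\ i = 1 /\ j = lo n) /\
  (forall n, if o then w n 0 = R (lo n) /\ hi n = lo n
     else adj (w n 0) (R (lo n)) /\ adj (w n 0) (R (hi n)) /\ lo n <= hi n /\
       forall j, adj (w n 0) (R j) -> lo n <= j <= hi n) /\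
  (forall n, S (hi n) < lo (S n)).

Lemma side_le {G : graph} {o} {R : nat -> G} {w k lo hi} n :
  side o R w k lo hi -> lo n <= hi n.
Proof. intros [_ [_ [h _]]]; specialize (h n); destruct o; destruct h; [lia|tauto]. Qed.

Lemma side_gap {G : graph} {o} {R : nat -> G} {w k lo hi n m} :
  side o R w k lo hi -> n < m -> S (hi n) < lo m.
Proof.
  intros h; apply (monotone_gap lo hi 1); [|apply h].
  intros n'; exact (side_le n' h).
Qed.

Lemma side_off {G : graph} {R : nat -> G} {w k lo hi} : side false R w k lo hi ->
  (forall n i, i <= k n -> ~ on_ray R (w n i)) /\
  (forall n i j, i <= k n -> adj (w n i) (R j) -> i = 0 /\ lo n <= j <= hi n).
Proof.
  intros [h1 [h2 [h3 _]]]; split.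
  - intros n i hi0 h; apply h1 in h; [|assumption]; destruct h; discriminate.
  - intros n i j hi0 h; destruct (Nat.eq_dec i 0) as [->|hne].
    + split; [easy|]; now apply h3.
    + apply h2 in h; [|lia]; destruct h; discriminate.
Qed.

Lemma side_sub {G : graph} o (R : nat -> G) w k lo hi e :
  increasing e -> side o R w k lo hi ->
  side o R (fun n => w (e n)) (fun n => k (e n)) (fun n => lo (e n)) (fun n => hi (e n)).
Proof.
  intros he hs; pose proof hs as [h1 [h2 [h3 h4]]]; split; [|split; [|split]].
  - intros n; apply h1.
  - intros n; apply h2.
  - intros n; apply h3.
  - intros n; apply (side_gap hs); apply he; lia.
Qed.

Definition disjoint_links {G : graph} (z : nat -> nat -> G) (k : nat -> nat) :=
  (forall n, ipath (z n) (k n)) /\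
  (forall n m i j, n <> m -> i <= k n -> j <= k m ->
     z n i <> z m j /\ ~ adj (z n i) (z m j)).

Lemma disjoint_links_sub {G : graph} (z : nat -> nat -> G) k e :
  increasing e -> disjoint_links z k ->
  disjoint_links (fun n => z (e n)) (fun n => k (e n)).
Proof.
  intros he [h1 h2]; split; [auto|]; intros n m i j hne hi hj.
  apply h2; trivial; intros e'; apply hne; now apply (increasing_inj e).
Qed.

(** The cases are a single foot, a triangle, and neighbours spread over a longer segment. Each calls
    for its own treatment, so the links are made uniform by passing to a subsequence. *)
Lemma side_trichotomy (lo hi : nat -> nat) : (forall n, lo n <= hi n) ->
  exists e, increasing e /\ ((forall n, hi (e n) = lo (e n)) \/
    (forall n, hi (e n) = S (lo (e n))) \/ (forall n, S (S (lo (e n))) <= hi (e n))).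
Proof.
  intros h.
  destruct (homogeneous (fun n => hi n = lo n)) as [e [he [h1|h1]]]; [eauto|].
  destruct (homogeneous (fun n => hi (e n) = S (lo (e n)))) as [e' [he' h2]].
  exists (fun n => e (e' n)); split; [now apply increasing_comp|].
  destruct h2 as [h2|h2]; [auto|right; right]; intros n.
  specialize (h (e (e' n))); specialize (h1 (e' n)); specialize (h2 n); lia.
Qed.

Definition prepend {V : Type} (x : V) (f : nat -> V) (i : nat) :=
  match i with 0 => x | S i => f i end.

Lemma ipath_prepend {G : graph} (x : G) f n :
  ipath f n -> (forall i, i <= n -> f i <> x) ->
  (forall i, i <= n -> adj x (f i) <-> i = 0) -> ipath (prepend x f) (S n).
Proof.
  intros [h1 [h2 h3]] hx ha; repeat split.
  - intros [|i] hi; simpl; [apply ha; lia|apply h1; lia].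
  - intros [|i] [|j] hi hj; simpl; intros e; trivial.
    + symmetry in e; apply hx in e; [easy|lia].
    + apply hx in e; [easy|lia].
    + f_equal; apply h2; trivial; lia.
  - intros [|i] [|j] hi hj; simpl; intros a.
    + now apply adj_irrefl in a.
    + apply ha in a; lia.
    + apply adj_sym, ha in a; lia.
    + apply h3 in a; lia.
Qed.

(** A single foot is prepended to its link, giving a fan; triangles give a fan of triangles; in the
    wide case [R] is rerouted through the vertices [z n 0], which thereby become the feet of a
    fan. *)
Lemma fan_of_uniform_links (G : graph) v R z k lo up :
  induced_ray G R -> ~ on_ray R v -> (forall j, ~ adj v (R j)) ->
  side false R z k lo up -> disjoint_links z k ->
  (forall n i, i <= k n -> z n i <> v) ->
  (forall n i, i <= k n -> adj v (z n i) <-> i = k n) ->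
  (forall n, up n = lo n) \/ (forall n, up n = S (lo n)) \/
    (forall n, S (S (lo n)) <= up n) ->
  unavoidable G.
Proof.
  intros hR hv hvR hs hl hzv hvz htri.
  pose proof (fun n => side_le n hs) as h3; destruct (side_off hs) as [h1 h2].
  destruct hs as [_ [_ [h4 h5]]], hl as [h6 h7].
  destruct htri as [ht|[ht|ht]].
  - apply (fan_unavoidable G v R lo (fun n => prepend (R (lo n)) (z n)) (fun n => S (k n))).
    split; [assumption|]; split; [apply increasing_S; intros n; specialize (h3 n);
      specialize (h5 n); lia|].
    split; [assumption|]; split; [reflexivity|].
    split; [|split; [|split; [|split; [|split]]]].
    + intros n [|i] hi; [lia|]; simpl; split; [apply h1|apply hzv]; lia.
    + intros n; apply ipath_prepend; [apply h6| |].
      * intros i hi e; apply (h1 n i hi); now exists (lo n).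
      * intros i hi; split.
        -- intros a; apply adj_sym, h2 in a; tauto.
        -- intros ->; apply adj_sym, h4.
    + intros n [|i] j hi; [lia|]; simpl; intros a; apply h2 in a; [|lia].
      specialize (ht n); lia.
    + intros n m [|i] [|j] hne hi hj; try lia; simpl; apply h7; trivial; lia.
    + intros n [|i] hi; simpl; [split; [intros a; now apply hvR in a|lia]|].
      rewrite hvz by lia; lia.
    + intros j _ a; now apply hvR in a.
  - apply (tfan_unavoidable G v R lo z k).
    split; [assumption|]; split; [intros n; specialize (h5 n); rewrite ht in h5; lia|].
    split; [assumption|]; split; [auto|]; split; [assumption|].
    split; [|split; [assumption|split; [assumption|auto]]].
    intros n i j hi; split.
    + intros a; apply h2 in a; [|assumption]; rewrite ht in a; lia.
    + intros [-> [->| ->]]; [apply h4|rewrite <- ht; apply h4].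
  - destruct (reroute G R (fun n => z n 0) lo up) as [R' [s [g1 [g2 [g3 g4]]]]]; trivial.
    + intros n; specialize (h5 n); lia.
    + intros n; apply h1; lia.
    + intros n j a; apply (h2 n 0 j); [lia|assumption].
    + intros n; split; apply h4.
    + intros n m hne; apply h7; trivial; lia.
    + apply (fan_unavoidable G v R' s z k).
      assert (hoff : forall x, ~ on_ray R x -> (forall n, x <> z n 0) -> ~ on_ray R' x).
      { intros x hx hxz [i e]; destruct (g4 i) as [[n [_ e']]|[j e']].
        - apply (hxz n); congruence.
        - apply hx; exists j; congruence. }
      split; [assumption|]; split; [apply increasing_S; intros n; specialize (g2 n); lia|].
      split; [apply hoff; [assumption|intros n; apply not_eq_sym, hzv; lia]|].
      split; [intros n; now rewrite g3|].
      split; [|split; [assumption|split; [|split; [|split; [assumption|]]]]].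
      * intros n i hi; split; [|apply hzv; lia]; apply hoff; [apply h1; lia|].
        intros m e; destruct (Nat.eq_dec n m) as [<-|hne].
        -- apply h6 in e; lia.
        -- revert e; apply h7; trivial; lia.
      * intros n i j hi a; destruct (g4 j) as [[m [-> e']]|[j' e']]; rewrite e' in a.
        -- destruct (Nat.eq_dec n m) as [<-|hne].
           ++ apply h6 in a; [split; [lia|easy]|lia|lia].
           ++ apply h7 in a; [easy|assumption|lia|lia].
        -- apply h2 in a; lia.
      * intros n m i j hne hi hj; apply h7; trivial; lia.
      * intros j _ a; destruct (g4 j) as [[m [-> e']]|[j' e']]; rewrite e' in a.
        -- apply hvz in a; [|lia]; eauto.
        -- now apply hvR in a.
Qed.

Lemma fan_of_links (G : graph) v R z k lo hi :
  induced_ray G R -> ~ on_ray R v -> (forall j, ~ adj v (R j)) ->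
  side false R z k lo hi -> disjoint_links z k ->
  (forall n i, i <= k n -> z n i <> v) ->
  (forall n i, i <= k n -> adj v (z n i) <-> i = k n) ->
  unavoidable G.
Proof.
  intros hR hv hvR hs hl hzv hvz; destruct (side_trichotomy lo hi) as [e [he htri]].
  { intros n; apply (side_le _ hs). }
  apply (side_sub false R z k lo hi e he) in hs.
  apply (disjoint_links_sub z k e he) in hl.
  apply (fan_of_uniform_links G v R _ _ _ _ hR hv hvR hs hl); trivial;
    intros n i hi0; auto.
Qed.

(** * A vertex of infinite degree *)

Lemma bound_upto (Q : nat -> nat -> Prop) k :
  (forall i, i <= k -> exists B, forall j, Q i j -> j < B) ->
  exists B, forall i j, i <= k -> Q i j -> j < B.
Proof.
  induction k as [|k IH]; intros h.
  - destruct (h 0 (le_n 0)) as [B hB]; exists B; intros i j hi; replace i with 0 by lia; auto.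
  - destruct IH as [B hB]; [auto|]; destruct (h (S k) (le_n _)) as [B' hB'].
    exists (B + B'); intros i j hi hq; destruct (Nat.eq_dec i (S k)) as [->|].
    + specialize (hB' j hq); lia.
    + specialize (hB i j ltac:(lia) hq); lia.
Qed.

Lemma bound_list {T} (Q : T -> nat -> Prop) (l : list T) :
  (forall x, In x l -> exists B, forall j, Q x j -> j < B) ->
  exists B, forall x j, In x l -> Q x j -> j < B.
Proof.
  induction l as [|y l IH]; intros h; [exists 0; intros x j []|].
  destruct IH as [B hB]; [intros x hx; apply h; now right|].
  destruct (h y (or_introl eq_refl)) as [B' hB']; exists (B + B').
  intros x j [<-|hx] hq; [specialize (hB' j hq)|specialize (hB x j hx hq)]; lia.
Qed.

Lemma not_unbounded (P : nat -> Prop) : ~ unbounded P -> exists B, forall j, P j -> j < B.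
Proof.
  intros h; apply not_all_ex_not in h as [B hB]; exists B; intros j hj.
  destruct (le_lt_dec B j); [|assumption]; exfalso; apply hB; eauto.
Qed.

(** The geodesics from the children of [x] up to the [u n] are disjoint, since a common vertex has
    only one ancestor at the level of the children. They begin next to [x] and end next to [v], so
    nonadjacent ones form a theta. *)
Lemma star_unavoidable (G : graph) v (x : G) r lev anc (u : nat -> G) :
  geodesic_tree (fun y => y <> v) r lev anc -> x <> v ->
  (forall n, adj v (u n) /\ lev x < lev (u n) /\ anc (u n) (lev x) = x) ->
  (forall n m, n <> m -> anc (u n) (S (lev x)) <> anc (u m) (S (lev x))) ->
  unavoidable G.
Proof.
  intros [_ [_ [hlip [hanc [hself [hstep [hco _]]]]]]] hx hu hne.
  assert (huv : forall n, u n <> v).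
  { intros n e; destruct (hu n) as [h _]; rewrite e in h; now apply adj_irrefl in h. }
  set (f := fun n i => anc (u n) (S (lev x) + i)).
  set (k := fun n => lev (u n) - S (lev x)).
  assert (hk : forall n i, i <= k n -> S (lev x) + i <= lev (u n)).
  { intros n i; unfold k; destruct (hu n) as [_ [h _]]; lia. }
  assert (hdis : forall n m i j, i <= k n -> j <= k m -> f n i = f m j -> n = m).
  { intros n m i j hi hj e; apply NNPP; intros hnm; apply (hne n m hnm).
    assert (i = j) as <-.
    { apply (f_equal lev) in e; unfold f in e; rewrite !(fun u n hu hn =>
        proj2 (hanc u n hu hn)) in e; auto; lia. }
    rewrite <- (hco (u n) _ (S (lev x) + i)), <- (hco (u m) _ (S (lev x) + i)); auto; try lia.
    unfold f in e; now rewrite e. }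
  destruct (levelled_paths G (fun y => y <> v) lev f k (fun _ => S (lev x)))
    as [[e [he hna]]|]; trivial.
  - intros n; split.
    + intros i hi; now apply hanc, hk.
    + intros i hi; unfold f; replace (S (lev x) + S i) with (S (S (lev x) + i)) by lia.
      apply hstep; [apply huv|specialize (hk n (S i) hi); lia].
  - intros n i hi; now apply hanc, hk.
  - apply (theta_of_sets G x v (fun n => on_path (f (e n)) (k (e n)))); trivial.
    + intros n; split; intros [i [hi e']].
      * destruct (hanc (u (e n)) (S (lev x) + i)) as [_ h]; auto.
        unfold f in e'; rewrite <- e' in h; lia.
      * destruct (hanc (u (e n)) (S (lev x) + i)) as [h _]; auto.
    + intros n m y y' hnm hy hy'; split; [|now apply (hna n m)].
      intros <-; destruct hy as [i [hi ->]], hy' as [j [hj e']].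
      apply hdis in e'; trivial; now apply hnm, (increasing_inj e).
    + intros n; set (m := e n); exists (f m 0), (f m (k m)); destruct (hu m) as [h1 [h2 h3]].
      repeat split.
      * unfold f; rewrite Nat.add_0_r; rewrite <- h3 at 1; apply hstep; auto.
      * unfold f; replace (S (lev x) + k m) with (lev (u m)) by (unfold k; lia).
        now rewrite hself.
      * apply (walk_conn _ (f m) (k m)); try lia; split; [intros i hi; now exists i|].
        intros i hi; unfold f; replace (S (lev x) + S i) with (S (S (lev x) + i)) by lia.
        apply hstep; [apply huv|specialize (hk m (S i) hi); lia].
Qed.

(** The edges between the branches and [R] have to be controlled. A vertex off [R] with infinitely
    many neighbours on [R] gives a fan at once, and a vertex of [R] adjacent to infinitely many
    branches gives a theta with [v]. Otherwise the branches can be thinned out until their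
    neighbours on [R] are far apart. *)
Lemma comb_unavoidable (G : graph) v r lev anc (R : nat -> G) :
  geodesic_tree (fun y => y <> v) r lev anc ->
  (forall n, R n <> v /\ lev (R n) = n /\ adj (R n) (R (S n))) ->
  (forall n, infset (fun u => adj v u /\ n <= lev u /\ anc u n = R n)) ->
  unavoidable G.
Proof.
  intros [_ [_ [hlip [hanc [hself [hstep [hco _]]]]]]] hRl hinf.
  assert (hR : induced_ray G R).
  { apply (geodesic_ray (fun y => y <> v) lev); assumption. }
  destruct (classic (exists y, ~ on_ray R y /\ unbounded (fun j => adj y (R j))))
    as [[y [h1 h2]]|hbd].
  { now apply (direct_fan G y R). }
  assert (hb : forall y, ~ on_ray R y -> exists B, forall j, adj y (R j) -> j < B).
  { intros y hy; apply not_unbounded; intros h; apply hbd; eauto. }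
  clear hbd.
  assert (hvR : ~ on_ray R v) by (intros [n e]; now apply (proj1 (hRl n))).
  destruct (hb v hvR) as [B0 hB0].
  assert (branch : forall N, exists fkd : (nat -> G) * nat * nat,
    let '(f, k, d) := fkd in
    N <= d /\ walk (fun y => y <> v) f k /\ (forall i, i <= k -> lev (f i) = d + i) /\
    (forall i, i <= k -> ~ on_ray R (f i)) /\ adj v (f k) /\
    exists m, N <= m /\ adj (f 0) (R m)).
  { intros N.
    (* Avoiding the [R j] with [j < B0] puts [u] off [R]. The branch is the part of the geodesic to
       [u] after the last level where it agrees with [R]. *)
    destruct (hinf N (map R (seq 0 B0))) as [u [[hu1 [hu2 hu3]] hu4]].
    assert (huv : u <> v) by (intros ->; now apply adj_irrefl in hu1).
    assert (huR : ~ on_ray R u).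
    { intros [j ->]; apply hu4, in_map_seq; exists j; split; [|easy].
      specialize (hB0 j hu1); lia. }
    destruct (greatest (fun n => n <= lev u /\ anc u n = R n) (lev u))
      as [n [[hn1 hn2] hn3]]; [eauto|tauto|].
    assert (hNn : N <= n) by auto.
    assert (hlt : n < lev u).
    { destruct (Nat.eq_dec n (lev u)) as [->|]; [|lia].
      exfalso; apply huR; exists (lev u); rewrite <- hn2; symmetry; now apply hself. }
    exists (fun i => anc u (S n + i), lev u - S n, S n).
    split; [lia|]; split; [|split; [|split; [|split]]].
    - split; [intros i hi; apply hanc; [assumption|lia]|].
      intros i hi; replace (S n + S i) with (S (S n + i)) by lia; apply hstep; [assumption|lia].
    - intros i hi; apply hanc; [assumption|lia].
    - intros i hi [j e]; destruct (hanc u (S n + i)) as [_ h]; [assumption|lia|].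
      rewrite e in h; rewrite (proj1 (proj2 (hRl j))) in h; subst j.
      assert (S n + i <= n); [apply hn3; split; [lia|assumption]|lia].
    - replace (S n + (lev u - S n)) with (lev u) by lia; now rewrite hself.
    - exists n; split; [assumption|]; rewrite Nat.add_0_r, <- hn2; apply adj_sym, hstep;
        assumption. }
  (* The levels of each new branch lie above those of all earlier branches, which makes the branches
     disjoint. *)
  destruct (greedy (fun l (x : (nat -> G) * nat * nat) =>
    let '(f, k, d) := x in
    B0 <= d /\ walk (fun y => y <> v) f k /\ (forall i, i <= k -> lev (f i) = d + i) /\
    (forall i, i <= k -> ~ on_ray R (f i)) /\ adj v (f k) /\
    (exists m, B0 <= m /\ adj (f 0) (R m)) /\
    (forall x', In x' l -> snd x' + snd (fst x') < d))) as [F hF].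
  { intros l.
    destruct (bound_list (fun (x : (nat -> G) * nat * nat) j => j <= snd x + snd (fst x)) l)
      as [B hB].
    { intros x _; exists (S (snd x + snd (fst x))); intros; lia. }
    destruct (branch (B + B0)) as [[[f k] d] [h1 [h2 [h3 [h4 [h5 [m [h6 h7]]]]]]]].
    exists (f, k, d); repeat split; trivial; try apply h2; [lia| |].
    - exists m; split; [lia|assumption].
    - intros x hx; specialize (hB x _ hx (le_n _)); lia. }
  clear branch.
  set (f := fun n => fst (fst (F n))); set (k := fun n => snd (fst (F n)));
    set (d := fun n => snd (F n)).
  assert (hf : forall n, walk (fun y => y <> v) (f n) (k n) /\
    (forall i, i <= k n -> lev (f n i) = d n + i) /\
    (forall i, i <= k n -> ~ on_ray R (f n i)) /\ adj v (f n (k n)) /\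
    (exists m, B0 <= m /\ adj (f n 0) (R m)) /\ (forall n', n' < n -> d n' + k n' < d n)).
  { intros n; specialize (hF n); unfold f, k, d.
    assert (hin : forall n', n' < n -> In (F n') (map F (seq 0 n))).
    { intros n' hn'; apply in_map_seq; exists n'; split; [lia|easy]. }
    destruct (F n) as [[fn kn] dn]; simpl.
    destruct hF as [h1 [h2 [h3 [h4 [h5 [h6 h7]]]]]]; split; [assumption|].
    split; [assumption|]; split; [assumption|]; split; [assumption|]; split; [assumption|].
    auto. }
  assert (hdis : forall n m i j, i <= k n -> j <= k m -> f n i = f m j -> n = m).
  { intros n m i j hi hj e; apply (f_equal lev) in e.
    rewrite (proj1 (proj2 (hf n))), (proj1 (proj2 (hf m))) in e by assumption.
    destruct (lt_eq_lt_dec n m) as [[hl|]|hl]; trivial.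
    - destruct (hf m) as [_ [_ [_ [_ [_ h]]]]]; specialize (h n hl); lia.
    - destruct (hf n) as [_ [_ [_ [_ [_ h]]]]]; specialize (h m hl); lia. }
  destruct (levelled_paths G (fun y => y <> v) lev f k d) as [[e [he hna]]|]; trivial;
    [apply hf|apply hf|].
  set (P := fun n => on_path (f (e n)) (k (e n))).
  assert (hP : forall n x, P n x -> x <> v /\ ~ on_ray R x).
  { intros n x [i [hi ->]]; split; now apply hf. }
  assert (hPd : forall n m x y, n <> m -> P n x -> P m y -> x <> y /\ ~ adj x y).
  { intros n m x y hnm hx hy; split; [|now apply (hna n m)].
    intros ->; destruct hx as [i [hi ->]], hy as [j [hj e']].
    apply hdis in e'; trivial; now apply hnm, (increasing_inj e). }
  assert (hPw : forall n, walk (P n) (f (e n)) (k (e n))).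
  { intros n; apply (walk_on_path (fun y => y <> v)), hf. }
  destruct (classic (exists j, unbounded (fun n => exists x, P n x /\ adj x (R j))))
    as [[j hj]|hbj].
  { apply enumerate in hj as [e' [he' [hj _]]].
    apply (theta_of_sets G (R j) v (fun n => P (e' n))).
    - apply hRl.
    - intros n; split; intros h; apply hP in h; [apply h; now exists j|tauto].
    - intros n m x y hnm; apply hPd; intros h; now apply hnm, (increasing_inj e').
    - intros n; destruct (hj n) as [x [hx ha]].
      exists x, (f (e (e' n)) (k (e (e' n)))); repeat split.
      + now apply adj_sym.
      + apply hf.
      + destruct hx as [i [hi ->]]; apply (walk_conn _ _ (k (e (e' n)))); trivial. }
  assert (hb' : forall j, exists B, forall n, (exists x, P n x /\ adj x (R j)) -> n < B).
  { intros j; apply not_unbounded; intros h; apply hbj; eauto. }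
  assert (hPb : forall n, exists B, forall x j, P n x -> adj x (R j) -> j < B).
  { intros n; destruct (bound_upto (fun i j => adj (f (e n) i) (R j)) (k (e n))) as [B hB].
    - intros i hi; apply hb, (hP n); now exists i.
    - exists B; intros x j [i [hi ->]] ha; exact (hB i j hi ha). }
  destruct (greedy (fun l n => forall m, In m l -> m < n /\
    forall x y i j, P m x -> P n y -> adj x (R i) -> adj y (R j) -> S i < j)) as [g hg].
  { intros l.
    destruct (bound_list (fun m j => exists x, P m x /\ adj x (R j)) l) as [B hB].
    { intros m _; destruct (hPb m) as [B hB]; exists B; intros j [x [h1 h2]]; eauto. }
    destruct (bound_upto (fun j n => exists x, P n x /\ adj x (R j)) (S B)) as [B1 hB1].
    { intros j _; apply hb'. }
    destruct (bound_list (fun m j => j = m) l) as [B2 hB2].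
    { intros m _; exists (S m); intros; lia. }
    (* Chosen branches have neighbours on [R] only below [B], and a branch numbered [B1] or higher
       has none up to [S B]; [B2] makes the numbers increase. *)
    exists (B1 + B2); intros m hm; split; [specialize (hB2 m m hm eq_refl); lia|].
    intros x y i j hx hy ha ha'.
    assert (i < B) by (apply (hB m); eauto).
    destruct (le_lt_dec j (S B)) as [hj|]; [|lia].
    assert (B1 + B2 < B1); [|lia]; apply (hB1 j); eauto. }
  assert (hg' : forall n m, n < m -> g n < g m /\
    forall x y i j, P (g n) x -> P (g m) y -> adj x (R i) -> adj y (R j) -> S i < j).
  { intros n m hnm; apply (hg m), in_map_seq; exists n; split; [lia|easy]. }
  assert (hginc : increasing g) by (intros n m hnm; now apply hg').
  (* From [B0] on the ray has no neighbours of [v], yet every branch still starts next to it. *)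
  set (R1 := fun i => R (B0 + i)).
  destruct (choice_fun (fun n (zk : (nat -> G) * nat) => let (z, q) := zk in
    walk (P (g n)) z q /\ (exists j, adj (z 0) (R1 j)) /\ adj v (z q) /\
    (forall i, i <= q -> (exists j, adj (z i) (R1 j)) -> i = 0) /\
    (forall i, i <= q -> adj v (z i) -> i = q) /\ ipath z q)) as [zq hzq].
  { intros n; destruct (shortest (P (g n)) (fun x => exists j, adj x (R1 j)) (adj v))
      as [z [q h]]; [|now exists (z, q)].
    destruct (hf (e (g n))) as [_ [_ [_ [h1 [[m [hm h2]] _]]]]].
    exists (f (e (g n)) 0), (f (e (g n)) (k (e (g n)))); repeat split; trivial.
    - exists (m - B0); unfold R1; now replace (B0 + (m - B0)) with m by lia.
    - apply (walk_conn _ _ (k (e (g n)))); trivial; lia. }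
  set (z := fun n => fst (zq n)); set (q := fun n => snd (zq n)).
  assert (hz : forall n, walk (P (g n)) (z n) (q n) /\ (exists j, adj (z n 0) (R1 j)) /\
    adj v (z n (q n)) /\
    (forall i, i <= q n -> (exists j, adj (z n i) (R1 j)) -> i = 0) /\
    (forall i, i <= q n -> adj v (z n i) -> i = q n) /\ ipath (z n) (q n)).
  { intros n; specialize (hzq n); unfold z, q; destruct (zq n); assumption. }
  destruct (choice_fun (fun n j => adj (z n 0) (R1 j) /\
    forall j', adj (z n 0) (R1 j') -> j <= j')) as [lo hlo].
  { intros n; apply least, hz. }
  destruct (choice_fun (fun n j => adj (z n 0) (R1 j) /\
    forall j', adj (z n 0) (R1 j') -> j' <= j)) as [hi hhi].
  { intros n; destruct (hPb (g n)) as [B hB]; apply (greatest _ B); [apply hz|].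
    intros j ha; apply hB in ha; [lia|apply (hz n); lia]. }
  apply (fan_of_links G v R1 z q lo hi).
  - now apply induced_ray_tail.
  - intros [j ej]; apply hvR; now exists (B0 + j).
  - intros j ha; apply hB0 in ha; lia.
  - split; [|split; [|split]].
    + intros n i hi' [j ej]; exfalso; apply (hP (g n) (z n i)); [now apply hz|].
      now exists (B0 + j).
    + intros n i j hi' ha; exfalso.
      assert (i = 0); [|lia]; destruct (hz n) as [_ [_ [_ [h _]]]]; apply h; [lia|eauto].
    + intros n; split; [apply hlo|]; split; [apply hhi|]; split; [now apply hlo, hhi|].
      intros j ha; split; [now apply hlo|now apply hhi].
    + intros n; destruct (hg' n (S n)) as [_ h]; [lia|].
      specialize (h (z n 0) (z (S n) 0) (B0 + hi n) (B0 + lo (S n))).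
      assert (S (B0 + hi n) < B0 + lo (S n)); [|lia].
      apply h; [apply (hz n); lia|apply (hz (S n)); lia|apply hhi|apply hlo].
  - split; [intros n; apply hz|].
    intros n m i j hnm hi' hj; apply (hPd (g n) (g m)).
    + intros h; now apply hnm, (increasing_inj g).
    + now apply (hz n).
    + now apply (hz m).
  - intros n i hi'; apply (hP (g n)), (hz n); assumption.
  - intros n i hi'; split; [|intros ->; apply hz].
    destruct (hz n) as [_ [_ [_ [_ [h _]]]]]; auto.
Qed.

Lemma infinite_degree (G : graph) (v : G) :
  two_connected G -> infset (adj v) -> unavoidable G.
Proof.
  intros hG hv; destruct (hv []) as [r [hr _]].
  assert (hrv : r <> v) by (intros ->; now apply adj_irrefl in hr).
  destruct (geodesic_tree_exists (fun y => y <> v) r hrv) as [lev [anc ht]].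
  { intros x hx; now apply two_connected_conn. }
  destruct (star_or_comb _ (adj v) r lev anc ht) as [[x [u [h1 [h2 h3]]]]|[R [_ [h1 h2]]]].
  - intros u hu ->; now apply adj_irrefl in hu.
  - assumption.
  - now apply (star_unavoidable G v x r lev anc u).
  - now apply (comb_unavoidable G v r lev anc R).
Qed.

(** * Clean ladders *)

Lemma locally_finite_range {G : graph} {I : Type} (c : I -> G) :
  locally_finite G -> locally_finite (range_graph c).
Proof.
  intros h x; destruct (h (proj1_sig x)) as [l hl].
  assert (h' : exists l', forall y : range_graph c, In (proj1_sig y) l -> In y l').
  { clear hl; induction l as [|z l [l' IH]]; [exists []; intros y []|].
    destruct (classic (exists y : range_graph c, proj1_sig y = z)) as [[y <-]|hn].
    - exists (y :: l'); intros y' [e|hy']; [left|right; auto].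
      destruct y, y'; simpl in e; now apply subset_eq_compat.
    - exists l'; intros y' [e|hy']; [exfalso; eauto|auto]. }
  destruct h' as [l' hl']; exists l'; intros y ha; apply hl', hl, ha.
Qed.

(** Rungs arbitrarily far out can be chosen with increasing ends on both rails; as paths with two
    vertices they show that the rails are in the same end. *)
Lemma clean_ladder_intro (L : graph) (W X : nat -> L) :
  locally_finite L -> induced_ray L W -> induced_ray L X -> disjoint_rays W X ->
  (forall x, on_ray W x \/ on_ray X x) -> adj (W 0) (X 0) ->
  (forall i j i' j', adj (W i) (X j) -> adj (W i') (X j') -> i < i' -> j' < j ->
     i' = S i /\ j = S j') ->
  (forall N, exists i j, N <= i /\ N <= j /\ adj (W i) (X j)) ->
  clean_ladder L.
Proof.
  intros hl hW hX hd hc h0 hcr hr; exists W, X; split.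
  - split; [assumption|]; split; [assumption|]; split; [assumption|]; split; [assumption|].
    split; [assumption|]; split; [|assumption].
    destruct (greedy (fun l (p : nat * nat) => adj (W (fst p)) (X (snd p)) /\
      forall q, In q l -> fst q < fst p /\ snd q < snd p)) as [f hf].
    { intros l; destruct (bound_list (fun (q : nat * nat) j => j <= fst q + snd q) l)
        as [B hB].
      { intros q _; exists (S (fst q + snd q)); intros; lia. }
      destruct (hr B) as [i [j [h1 [h2 h3]]]]; exists (i, j); split; [assumption|].
      intros q hq; specialize (hB q _ hq (le_n _)); simpl; lia. }
    assert (hlt : forall m n, m < n -> fst (f m) < fst (f n) /\ snd (f m) < snd (f n)).
    { intros m n hmn; apply (proj2 (hf n)), in_map_seq; exists m; split; [lia|easy]. }
    exists (fun n => [W (fst (f n)); X (snd (f n))]); split.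
    + intros n; exists (fst (f n)), (snd (f n)); repeat split.
      * constructor; [intros [e|[]]; symmetry in e; revert e; apply hd|].
        constructor; [intros []|constructor].
      * intros u v [l1 [l2 [e|e]]]; destruct l1 as [|? [|? [|? ?]]]; try discriminate;
          injection e as <- <-; [|apply adj_sym]; apply hf.
    + intros m n x [<-|[<-|[]]] [e|[e|[]]].
      * apply ray_inj in e; [|assumption].
        destruct (lt_eq_lt_dec m n) as [[h|]|h]; trivial; apply hlt in h; lia.
      * symmetry in e; now apply hd in e.
      * now apply hd in e.
      * apply ray_inj in e; [|assumption].
        destruct (lt_eq_lt_dec m n) as [[h|]|h]; trivial; apply hlt in h; lia.
  - intros [i j] [i' j'] [h1 [h2 [h3 h4]]]; now apply hcr.
Qed.

(** Any rung can be made the initial one by cutting the rails there: the condition on crosses and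
    the rungs far out pass to the tails. *)
Lemma clean_unavoidable (G : graph) (W X : nat -> G) :
  locally_finite G -> induced_ray G W -> induced_ray G X -> disjoint_rays W X ->
  (forall i j i' j', adj (W i) (X j) -> adj (W i') (X j') -> i < i' -> j' < j ->
     i' = S i /\ j = S j') ->
  (forall N, exists i j, N <= i /\ N <= j /\ adj (W i) (X j)) ->
  unavoidable G.
Proof.
  intros hl hW hX hd hcr hr; destruct (hr 0) as [a [b [_ [_ hab]]]].
  set (c := fun i : nat + nat => match i with inl i => W (a + i) | inr j => X (b + j) end).
  right; exists (range_graph c); split; [apply range_induced|]; left.
  apply (clean_ladder_intro _ (fun i => into c (inl i)) (fun j => into c (inr j))).
  - now apply locally_finite_range.
  - now apply (into_induced_ray c inl), induced_ray_tail.
  - now apply (into_induced_ray c inr), induced_ray_tail.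
  - intros i j e; apply (into_eq c) in e; now apply hd in e.
  - intros x; destruct (into_surj c x) as [[i|j] ->]; [left|right]; eexists; reflexivity.
  - apply into_adj; simpl; now rewrite !Nat.add_0_r.
  - intros i j i' j' h1 h2 h3 h4; apply (into_adj1 c) in h1, h2.
    destruct (hcr _ _ _ _ h1 h2); lia.
  - intros N; destruct (hr (N + a + b)) as [i [j [h1 [h2 h3]]]].
    exists (i - a), (j - b); split; [lia|]; split; [lia|]; apply into_adj; simpl.
    now replace (a + (i - a)) with i by lia; replace (b + (j - b)) with j by lia.
Qed.

(** * Ladders with ties *)

(** Reading links from their other end lets the one predicate [side] describe both rails. *)
Definition reversed {V : Type} (w : nat -> nat -> V) (k : nat -> nat) n i := w n (k n - i).

(** An edge between the rails is allowed only if it is itself a link. Such links arise when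
    rerouting puts a vertex next to one rail onto the other. *)
Definition rails {G : graph} (A B : nat -> G) (w : nat -> nat -> G) (k : nat -> nat) :=
  induced_ray G A /\ induced_ray G B /\ disjoint_rays A B /\ disjoint_links w k /\
  (forall i j, adj (A i) (B j) -> exists n, k n = 1 /\ A i = w n 0 /\ B j = w n 1).

Lemma side_ext {G : graph} o (R : nat -> G) w w' k lo hi :
  (forall n i, i <= k n -> w n i = w' n i) -> side o R w k lo hi -> side o R w' k lo hi.
Proof.
  intros e [h1 [h2 [h3 h4]]]; split; [|split; [|split; [|assumption]]].
  - intros n i hi'; rewrite <- e by assumption; exact (h1 n i hi').
  - intros n i j hi'; rewrite <- e by lia; exact (h2 n i j hi').
  - intros n; rewrite <- e by lia; apply h3.
Qed.

Lemma side_reversed2 {G : graph} o (R : nat -> G) w k lo hi :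
  side o R w k lo hi -> side o R (reversed (reversed w k) k) k lo hi.
Proof.
  apply side_ext; intros n i h; unfold reversed; f_equal; lia.
Qed.

Lemma ipath_reversed {G : graph} (f : nat -> G) n :
  ipath f n -> ipath (fun i => f (n - i)) n.
Proof.
  intros [h1 [h2 h3]]; repeat split.
  - intros i hi; apply adj_sym; replace (n - i) with (S (n - S i)) by lia; apply h1; lia.
  - intros i j hi hj e; apply h2 in e; lia.
  - intros i j hi hj e; apply h3 in e; lia.
Qed.

Lemma rails_swap {G : graph} (A B : nat -> G) w k :
  rails A B w k -> rails B A (reversed w k) k.
Proof.
  intros [h1 [h2 [h3 [[h4 h5] h6]]]]; split; [assumption|]; split; [assumption|].
  split; [intros i j e; now apply (h3 j i)|]; split; [split|].
  - intros n; now apply (ipath_reversed (w n)).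
  - intros n m i j hne hi hj; apply h5; trivial; lia.
  - intros i j ha; apply adj_sym, h6 in ha as [n [h7 [h8 h9]]]; exists n.
    unfold reversed; now rewrite h7.
Qed.

(** Where a link stops short of a rail, its feet there belong to the tie too; in the intended case
    [hi n = S (lo n)] they span one edge. *)
Definition tie_set (L : graph) (o o' : bool) (A B : nat -> L) (w : nat -> nat -> L)
    (k lo hi lo' hi' : nat -> nat) n (x : L) :=
  (exists i, i <= k n /\ x = w n i) \/
  (o = false /\ (x = A (lo n) \/ x = A (hi n))) \/
  (o' = false /\ (x = B (lo' n) \/ x = B (hi' n))).

Lemma tie_set_rail (L : graph) o o' (A B : nat -> L) w k lo hi lo' hi' :
  rails A B w k -> side o A w k lo hi -> (o = false -> forall n, hi n = S (lo n)) ->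
  forall n j, tie_set L o o' A B w k lo hi lo' hi' n (A j) <-> lo n <= j <= hi n.
Proof.
  intros [hA [_ [hd _]]] [h1 [h2 [h3 h4]]] ho n j; split.
  - intros [[i [hi0 e]]|[[hof [e|e]]|[_ [e|e]]]].
    + destruct (h1 n i hi0) as [-> ->]; [now exists j|].
      destruct (h3 n) as [h5 h6]; rewrite h5 in e; apply ray_inj in e; [lia|assumption].
    + apply ray_inj in e; [|assumption]; rewrite (ho hof n); lia.
    + apply ray_inj in e; [|assumption]; rewrite (ho hof n) in *; lia.
    + now apply hd in e.
    + now apply hd in e.
  - intros hj; destruct o.
    + left; exists 0; split; [lia|]; destruct (h3 n) as [-> h5]; f_equal; lia.
    + right; left; split; [easy|]; rewrite (ho eq_refl n) in *.
      destruct (Nat.eq_dec j (lo n)) as [->|]; [now left|right; f_equal; lia].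
Qed.

Lemma tie_set_swap (L : graph) o o' (A B : nat -> L) w k lo hi lo' hi' n x :
  tie_set L o o' A B w k lo hi lo' hi' n x <->
  tie_set L o' o B A (reversed w k) k lo' hi' lo hi n x.
Proof.
  assert (h : (exists i, i <= k n /\ x = w n i) <->
    exists i, i <= k n /\ x = reversed w k n i).
  { unfold reversed; split; intros [i [hi0 ->]]; exists (k n - i); split; try lia;
      f_equal; lia. }
  unfold tie_set; rewrite h; tauto.
Qed.

(** The flags say which ends of the ties lie on their rail, [false] standing for a triangle. Every
    [J n] is connected without rail edges, and by [Jedge] and [Jdis] no other edge leaves it, so it
    is a component. The combination [true, false] becomes [false, true] by exchanging the rails and
    is treated only in that form. *)
Lemma tie_ladder (L : graph) o o' (A B : nat -> L) w k lo hi lo' hi' :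
  rails A B w k -> side o A w k lo hi -> side o' B (reversed w k) k lo' hi' ->
  (o = false -> forall n, hi n = S (lo n)) ->
  (o' = false -> forall n, hi' n = S (lo' n)) ->
  lo 0 = 0 -> lo' 0 = 0 ->
  (forall x, on_ray A x \/ on_ray B x \/ exists n i, i <= k n /\ x = w n i) ->
  match o, o' with
  | true, true => L_infty L
  | false, true => L_Delta_infty L
  | false, false => L_nabla_Delta_infty L
  | true, false => True
  end.
Proof.
  intros hr hs hs' ho ho' h0 h0' hc.
  set (J := tie_set L o o' A B w k lo hi lo' hi').
  assert (JA : forall n j, J n (A j) <-> lo n <= j <= hi n) by now apply tie_set_rail.
  assert (JB : forall n j, J n (B j) <-> lo' n <= j <= hi' n).
  { intros n j; unfold J; rewrite tie_set_swap.
    apply tie_set_rail; trivial; now apply rails_swap. }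
  assert (Jw : forall n i, i <= k n -> J n (w n i)) by (intros n i h; left; eauto).
  assert (JA' : forall n m j, J n (A j) -> J m (A j) -> n = m).
  { intros n m j h1 h2; apply JA in h1, h2.
    destruct (lt_eq_lt_dec n m) as [[h|]|h]; trivial; apply (side_gap hs) in h;
      lia. }
  assert (JB' : forall n m j, J n (B j) -> J m (B j) -> n = m).
  { intros n m j h1 h2; apply JB in h1, h2.
    destruct (lt_eq_lt_dec n m) as [[h|]|h]; trivial; apply (side_gap hs') in h;
      lia. }
  pose proof hr as [hA [hB [hd [[hw hwd] hrung]]]].
  pose proof hs as [hs1 [hs2 [hs3 hs4]]]; pose proof hs' as [hs1' [hs2' [hs3' hs4']]].
  assert (Jdis : forall n m x, J n x -> J m x -> n = m).
  { intros n m x hn hm; destruct (hc x) as [[j ->]|[[j ->]|[p [i [hi0 ->]]]]]; eauto.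
    assert (key : forall n, J n (w p i) -> n = p).
    { clear n m hn hm; intros n hn.
      pose proof hn as [[i' [hi1 e]]|[[_ e]|[_ e]]].
      - destruct (Nat.eq_dec n p) as [|hne]; [assumption|].
        exfalso; symmetry in e; revert e; now apply hwd.
      - destruct e as [e|e]; rewrite e in hn; eapply JA'; try exact hn; rewrite <- e; auto.
      - destruct e as [e|e]; rewrite e in hn; eapply JB'; try exact hn; rewrite <- e; auto. }
    rewrite (key n hn), (key m hm); reflexivity. }
  assert (wB : forall n i, i <= k n -> on_ray B (w n i) -> o' = true /\ i = k n).
  { intros n i hi0 h; destruct (hs1' n (k n - i)) as [h1 h2]; [lia| |split; [assumption|lia]].
    unfold reversed; now replace (k n - (k n - i)) with i by lia. }
  assert (offR : forall (x y : L), adj x y ->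
    (~ on_ray A x \/ ~ on_ray A y) -> (~ on_ray B x \/ ~ on_ray B y) ->
    off_rays_adj L A B x y).
  { intros x y ha h1 h2; split; [assumption|]; split.
    - intros [i [[-> ->]|[-> ->]]]; destruct h1 as [h1|h1]; apply h1; eexists; reflexivity.
    - intros [i [[-> ->]|[-> ->]]]; destruct h2 as [h2|h2]; apply h2; eexists; reflexivity. }
  assert (offw : forall n i, i < k n -> off_rays_adj L A B (w n i) (w n (S i))).
  { intros n i hi0; apply offR.
    - now apply hw.
    - right; intros h; apply hs1 in h; lia.
    - left; intros h; apply wB in h; lia. }
  assert (endA : forall n j, o = false -> lo n <= j <= hi n ->
    off_rays_adj L A B (w n 0) (A j)).
  { intros n j hof hj; apply offR.
    - specialize (hs3 n); rewrite hof in hs3; rewrite (ho hof n) in *.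
      assert (j = lo n \/ j = S (lo n)) as [->| ->] by lia; apply hs3.
    - left; intros h; apply hs1 in h; [|lia]; destruct h; congruence.
    - right; intros [j' e]; now apply hd in e. }
  assert (endB : forall n j, o' = false -> lo' n <= j <= hi' n ->
    off_rays_adj L A B (w n (k n)) (B j)).
  { intros n j hof hj; apply offR.
    - specialize (hs3' n); rewrite hof in hs3'; rewrite (ho' hof n) in *.
      unfold reversed in hs3'; rewrite Nat.sub_0_r in hs3'.
      assert (j = lo' n \/ j = S (lo' n)) as [->| ->] by lia; apply hs3'.
    - right; intros [j' e]; symmetry in e; now apply hd in e.
    - left; intros h; apply wB in h; [|lia]; destruct h; congruence. }
  assert (Jedge : forall x y, off_rays_adj L A B x y -> exists n, J n x /\ J n y).
  { assert (hAw : forall j n i, i <= k n -> off_rays_adj L A B (w n i) (A j) -> J n (A j)).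
    { intros j n i hi0 [ha [hna _]]; destruct (Nat.eq_dec i 0) as [->|hne].
      (* If the link starts on [A], an edge from [w n 0] to [A] is a rail edge, since [A] is
         induced; such edges have been deleted. *)
      - specialize (hs3 n); destruct o eqn:eo.
        + destruct hs3 as [e _]; exfalso; apply hna; rewrite e in ha |- *; now apply hA.
        + now apply JA, hs3.
      - destruct (hs2 n i j) as [h1 [h2 ->]]; [lia|assumption|].
        apply JA; split; [lia|]; now apply (side_le _ hs). }
    assert (hBw : forall j n i, i <= k n -> off_rays_adj L A B (w n i) (B j) -> J n (B j)).
    { intros j n i hi0 [ha [_ hnb]]; destruct (Nat.eq_dec i (k n)) as [->|hne].
      - specialize (hs3' n); unfold reversed in hs3'; rewrite Nat.sub_0_r in hs3'.
        destruct o' eqn:eo.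
        + destruct hs3' as [e _]; exfalso; apply hnb; rewrite e in ha |- *; now apply hB.
        + now apply JB, hs3'.
      - destruct (hs2' n (k n - i) j) as [h1 [h2 ->]]; [lia| |].
        { unfold reversed; now replace (k n - (k n - i)) with i by lia. }
        apply JB; split; [lia|]; now apply (side_le _ hs'). }
    assert (hAB : forall i j, adj (A i) (B j) -> exists n, J n (A i) /\ J n (B j)).
    { intros i j ha; apply hrung in ha as [n [h1 [-> ->]]]; exists n; split; apply Jw; lia. }
    intros x y h; pose proof (off_rays_adj_sym _ _ _ _ _ h) as h'.
    destruct (hc x) as [[i ->]|[[i ->]|[n [i [hi0 ->]]]]],
      (hc y) as [[j ->]|[[j ->]|[m [j [hj ->]]]]].
    - exfalso; destruct h as [h1 [h2 h3]]; now apply h2, hA.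
    - now apply hAB, h.
    - exists m; split; eauto.
    - destruct (hAB j i) as [n hn]; [apply h'|exists n; tauto].
    - exfalso; destruct h as [h1 [h2 h3]]; now apply h3, hB.
    - exists m; split; eauto.
    - exists n; split; eauto.
    - exists n; split; eauto.
    - exists n; split; [auto|].
      destruct (Nat.eq_dec n m) as [<-|hne]; [auto|].
      destruct h as [ha _]; now apply hwd in ha. }
  set (D := delete_ray_edges L A B).
  assert (Jcomp : forall n, component D (J n)).
  { intros n; exists (w n 0); intros y; rewrite joined_conn; split.
    - intros hy.
      assert (hwi : forall i, i <= k n -> @conn D (fun _ => True) (w n 0) (w n i)).
      { induction i as [|i IH]; intros hi0; [now apply conn_refl|].
        apply (@conn_step D _ _ (w n i)); [apply IH; lia|apply offw; lia|easy]. }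
      destruct hy as [[i [hi0 ->]]|[[hof hy]|[hof hy]]]; [auto| |].
      + apply (@conn_step D _ _ (w n 0)); [now apply hwi, Nat.le_0_l| |easy].
        pose proof (side_le n hs); destruct hy as [->| ->]; apply endA; trivial; lia.
      + apply (@conn_step D _ _ (w n (k n))); [now apply hwi| |easy].
        pose proof (side_le n hs'); destruct hy as [->| ->]; apply endB; trivial; lia.
    - intros h; induction h as [_|y z h IH ha _]; [apply Jw; lia|].
      destruct (Jedge y z ha) as [m [h1 h2]]; now rewrite (Jdis n m y IH h1). }
  assert (Jtie : forall n, tie L A B (J n)).
  { intros n; split; [apply Jcomp|].
    pose proof (side_le n hs); pose proof (side_le n hs').
    split; [exists (lo n); apply JA|exists (lo' n); apply JB]; lia. }
  assert (Jpath : forall n, induced_path_in_tie L A B (J n) (w n 0) (w n (k n))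
      (map (w n) (seq 0 (S (k n))))).
  { intros n; split; [|split].
    - apply (path_between_walk D (w n)); [apply offw|apply hw].
    - intros u hu; apply in_map_seq in hu as [i [hi0 ->]]; apply Jw; lia.
    - intros u v hu hv [_ [_ [ha _]]]; apply in_map_seq in hu as [i [hi0 ->]], hv as [j [hj ->]].
      apply path_edge_map_seq; apply hw in ha as [->| ->]; try lia.
      + exists i; repeat split; auto; lia.
      + exists j; repeat split; auto; lia. }
  assert (main : forall T : (forall L : graph, (nat -> L) -> (nat -> L) -> (L -> Prop) -> Prop),
    (forall n, T L A B (J n)) -> ladder_with_ties T L).
  { intros T hT; exists A, B; cbv zeta; split; [assumption|]; split; [assumption|].
    split; [assumption|]; split; [|split; [|split]].
    - intros x hxA hxB; destruct (hc x) as [h|[h|[n [i [hi0 ->]]]]]; try contradiction.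
      exists (J n); repeat split; auto; apply Jtie.
    - intros x y h; destruct (Jedge x y h) as [n [h1 h2]].
      exists (J n); repeat split; auto; try apply Jtie; apply h.
    - exists J; split; [intros n; split; [apply Jtie|apply hT]|].
      intros m n hmn e; apply hmn, (Jdis m n (w m 0)); [apply Jw; lia|].
      apply e, Jw; lia.
    - exists (J 0); pose proof (side_le 0 hs).
      pose proof (side_le 0 hs').
      repeat split; try apply Jtie; [apply hT|apply JA; lia|apply JB; lia]. }
  assert (inpath : forall n x, J n x -> (o = false -> x <> A (lo n) /\ x <> A (hi n)) ->
    (o' = false -> x <> B (lo' n) /\ x <> B (hi' n)) -> In x (map (w n) (seq 0 (S (k n))))).
  { intros n x [[i [hi0 ->]]|[[hof hx]|[hof hx]]] h1 h2.
    - apply in_map_seq; exists i; split; [lia|easy].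
    - destruct (h1 hof); tauto.
    - destruct (h2 hof); tauto. }
  assert (lastB : forall n, o' = true -> w n (k n) = B (lo' n)).
  { intros n e; specialize (hs3' n); rewrite e in hs3'; unfold reversed in hs3'.
    now rewrite Nat.sub_0_r in hs3'. }
  assert (spanA : forall n, span A (J n) (lo n) (hi n)).
  { intros n; pose proof (side_le n hs).
    split; [apply JA; lia|]; split; [apply JA; lia|]; intros i; apply JA. }
  assert (spanB : forall n, span B (J n) (lo' n) (hi' n)).
  { intros n; pose proof (side_le n hs').
    split; [apply JB; lia|]; split; [apply JB; lia|]; intros i; apply JB. }
  (* A start on [B] would force [k n = 0], and its edge to [A (lo n)] would be a rung; but rungs are
     links with two vertices, and different links are disjoint. *)
  assert (startA : o = false -> forall n, ~ on_ray A (w n 0) /\ ~ on_ray B (w n 0)).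
  { intros hof n; split; [intros h; apply hs1 in h; [|lia]; destruct h; congruence|].
    intros h; pose proof h as [j ej]; apply wB in h as [h1 h2]; [|lia].
    destruct (endA n (lo n) hof) as [ha _].
    { pose proof (side_le n hs); lia. }
    rewrite ej in ha; apply adj_sym, hrung in ha as [m [h3 [h4 h5]]].
    rewrite <- ej in h5; destruct (Nat.eq_dec n m) as [<-|hne]; [lia|].
    revert h5; apply hwd; trivial; lia. }
  destruct o eqn:eo, o' eqn:eo'; trivial.
  - apply main; intros n; exists (lo n), (lo' n), (map (w n) (seq 0 (S (k n)))).
    assert (e1 : w n 0 = A (lo n)) by apply hs3.
    assert (e2 : hi n = lo n) by apply hs3.
    assert (e3 : hi' n = lo' n) by apply hs3'.
    split; [|split; [|split]].
    + intros j; rewrite JA; lia.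
    + intros j; rewrite JB; lia.
    + rewrite <- e1, <- (lastB n) by easy; apply Jpath.
    + intros x y; split.
      * intros h; apply (Jpath n); trivial; apply inpath; try apply h; discriminate.
      * intros h; apply path_edge_map_seq in h as [i [_ [hi0 h]]].
        assert (hoff := offw n i ltac:(lia)).
        destruct h as [[-> ->]|[-> ->]]; (split; [apply Jw; lia|split; [apply Jw; lia|]]);
          [|apply off_rays_adj_sym]; assumption.
  - left; apply main; intros n.
    exists (lo n), (lo' n), (w n 0), (map (w n) (seq 0 (S (k n)))).
    assert (e3 : hi' n = lo' n) by apply hs3'.
    pose proof (ho eq_refl n) as e2.
    split; [rewrite <- e2; apply spanA|]; split; [rewrite <- e3 at 2; apply spanB|].
    split; [apply Jw; lia|]; split; [now apply startA|]; split; [now apply startA|].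
    split; [apply endA; trivial; lia|]; split; [apply endA; trivial; lia|].
    split; [rewrite <- (lastB n) by easy; apply Jpath|].
    intros x hx h1 h2; apply inpath; trivial; [|discriminate]; now rewrite e2.
  - apply main; intros n.
    exists (lo n), (lo' n), (w n 0), (w n (k n)), (map (w n) (seq 0 (S (k n)))).
    pose proof (ho eq_refl n) as e2; pose proof (ho' eq_refl n) as e3.
    assert (startB : ~ on_ray A (w n (k n)) /\ ~ on_ray B (w n (k n))).
    { split; intros h; [apply hs1 in h; [|lia]|apply wB in h; [|lia]]; destruct h; discriminate. }
    split; [rewrite <- e2; apply spanA|]; split; [rewrite <- e3; apply spanB|].
    split; [apply Jw; lia|]; split; [now apply startA|]; split; [now apply startA|].
    split; [apply Jw; lia|]; split; [apply startB|]; split; [apply startB|].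
    split; [apply endA; trivial; lia|]; split; [apply endA; trivial; lia|].
    split; [apply endB; trivial; lia|]; split; [apply endB; trivial; lia|].
    split; [apply Jpath|].
    intros x hx h1 h2 h3 h4; apply inpath; trivial; intros _; [now rewrite e2|now rewrite e3].
Qed.

Lemma side_into {G : graph} {I : Type} (c : I -> G) (a : nat -> I) (b : nat -> nat -> I)
    o (R : nat -> G) w k lo hi :
  (forall i, c (a i) = R (lo 0 + i)) -> (forall n i, i <= k n -> c (b n i) = w n i) ->
  side o R w k lo hi ->
  side o (fun i => into c (a i)) (fun n i => into c (b n i)) k
    (fun n => lo n - lo 0) (fun n => hi n - lo 0).
Proof.
  intros ha hb hs.
  assert (hl : forall n, lo 0 <= lo n).
  { intros [|n]; [lia|].
    assert (S (hi 0) < lo (S n)) by (apply (side_gap hs); lia).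
    pose proof (side_le 0 hs); lia. }
  assert (hle : forall n, lo n <= hi n) by (intros n; now apply (side_le _ hs)).
  destruct hs as [h1 [h2 [h3 h4]]]; split; [|split; [|split]].
  - intros n i hi0 [j e]; apply (into_eq c) in e; rewrite ha, hb in e by assumption.
    apply (h1 n); [assumption|eexists; exact e].
  - intros n i j hi0 e; apply (into_adj1 c) in e; rewrite ha, hb in e by lia.
    apply h2 in e; [|lia]; destruct e as [e1 [e2 e3]]; repeat split; trivial; lia.
  - intros n; specialize (h3 n); specialize (hl n); specialize (hle n); destruct o.
    + rewrite into_eq, ha, hb by lia; destruct h3 as [-> ->]; split; [|easy].
      f_equal; lia.
    + rewrite !into_adj, !ha, hb by lia.
      replace (lo 0 + (lo n - lo 0)) with (lo n) by lia.
      replace (lo 0 + (hi n - lo 0)) with (hi n) by lia.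
      destruct h3 as [e1 [e2 [e3 e4]]]; repeat split; trivial; try lia.
      * apply (into_adj1 c) in H; rewrite ha, hb in H by lia; apply e4 in H; lia.
      * apply (into_adj1 c) in H; rewrite ha, hb in H by lia; apply e4 in H; lia.
  - intros n; specialize (h4 n); pose proof (hl n); pose proof (hl (S n)); specialize (hle n); lia.
Qed.

(** Cutting both rails at the first feet of link 0 makes its tie contain the initial vertices. *)
Lemma ladder_unavoidable_oriented (G : graph) o o' (A B : nat -> G) w k lo hi lo' hi' :
  (o = true -> o' = true) ->
  rails A B w k -> side o A w k lo hi -> side o' B (reversed w k) k lo' hi' ->
  (o = false -> forall n, hi n = S (lo n)) ->
  (o' = false -> forall n, hi' n = S (lo' n)) ->
  unavoidable G.
Proof.
  intros hoo hr hs hs' ho ho'.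
  set (c := fun i : nat + nat + nat * nat => match i with
    | inl (inl i) => A (lo 0 + i) | inl (inr j) => B (lo' 0 + j)
    | inr (n, i) => w n (Nat.min i (k n)) end).
  assert (hl : forall o (A : nat -> G) w lo hi n, side o A w k lo hi -> lo 0 <= lo n).
  { intros o1 A1 w1 lo1 hi1 [|n] hs1; [lia|].
    assert (S (hi1 0) < lo1 (S n)) by (apply (side_gap hs1); lia).
    pose proof (side_le 0 hs1); lia. }
  assert (hcw : forall n i, i <= k n -> c (inr (n, i)) = w n i).
  { intros n i hi0; simpl; now rewrite clip. }
  assert (T : match o, o' with
    | true, true => L_infty (range_graph c)
    | false, true => L_Delta_infty (range_graph c)
    | false, false => L_nabla_Delta_infty (range_graph c)
    | true, false => True
    end).
  { apply (tie_ladder _ o o' (fun i => into c (inl (inl i))) (fun j => into c (inl (inr j)))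
      (fun n i => into c (inr (n, i))) k (fun n => lo n - lo 0) (fun n => hi n - lo 0)
      (fun n => lo' n - lo' 0) (fun n => hi' n - lo' 0)).
    - destruct hr as [hA [hB [hd [[hw hwd] hrung]]]]; split; [|split; [|split; [|split; [split|]]]].
      + now apply (into_induced_ray c (fun i => inl (inl i))), induced_ray_tail.
      + now apply (into_induced_ray c (fun j => inl (inr j))), induced_ray_tail.
      + intros i j e; apply (into_eq c) in e; now apply hd in e.
      + intros n; apply (into_ipath c (fun i => inr (n, i)) (w n)); auto.
      + intros n m i j hne hi0 hj; rewrite into_eq, into_adj, !hcw by assumption; now apply hwd.
      + intros i j e; apply (into_adj1 c), hrung in e as [n [h1 [h2 h3]]]; exists n.
        rewrite !into_eq, !hcw by lia; auto.
    - apply (side_into c (fun i => inl (inl i)) (fun n i => inr (n, i)) o A w); auto.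
    - apply (side_into c (fun i => inl (inr i)) (fun n i => inr (n, k n - i)) o' B
        (reversed w k)); auto.
      intros n i hi0; unfold reversed; rewrite hcw; [easy|lia].
    - intros h n; rewrite (ho h n); specialize (hl _ _ _ _ _ n hs); lia.
    - intros h n; rewrite (ho' h n); specialize (hl _ _ _ _ _ n hs'); lia.
    - lia.
    - lia.
    - intros x; destruct (into_surj c x) as [[[i|j]|[n i]] ->].
      + left; eexists; reflexivity.
      + right; left; eexists; reflexivity.
      + right; right; exists n, (Nat.min i (k n)); split; [lia|].
        apply into_eq; simpl; f_equal; lia. }
  right; exists (range_graph c); split; [apply range_induced|].
  destruct o, o'; try (specialize (hoo eq_refl); discriminate); tauto.
Qed.

Lemma ladder_unavoidable (G : graph) o o' (A B : nat -> G) w k lo hi lo' hi' :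
  rails A B w k -> side o A w k lo hi -> side o' B (reversed w k) k lo' hi' ->
  (o = false -> forall n, hi n = S (lo n)) ->
  (o' = false -> forall n, hi' n = S (lo' n)) ->
  unavoidable G.
Proof.
  intros hr hs hs' ho ho'; destruct o, o'.
  2: apply (ladder_unavoidable_oriented G false true B A (reversed w k) k lo' hi' lo hi);
    trivial; [now apply rails_swap|now apply side_reversed2].
  all: refine (ladder_unavoidable_oriented G _ _ A B w k lo hi lo' hi' _ hr hs hs' ho ho').
  all: (reflexivity || discriminate).
Qed.

Definition normal_side (o : bool) (lo hi : nat -> nat) :=
  o = false -> forall n, hi n = S (lo n).

(** A single foot is prepended to the link, a triangle is kept, and a wide set of neighbours
    disappears by rerouting [A] through [w n 0]; there [1 <= k n] keeps the new rail off [B]. Links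
    never get shorter, so this condition survives for a second use with the rails exchanged. *)
Lemma normalise_side (G : graph) (A B : nat -> G) w k lo hi o' lo' hi' :
  rails A B w k -> side false A w k lo hi -> side o' B (reversed w k) k lo' hi' ->
  (forall n, hi n = lo n) \/ (forall n, hi n = S (lo n)) \/
    ((forall n, S (S (lo n)) <= hi n) /\ forall n, 1 <= k n) ->
  exists A1 w1 k1 o lo1 hi1, rails A1 B w1 k1 /\ side o A1 w1 k1 lo1 hi1 /\
    normal_side o lo1 hi1 /\ side o' B (reversed w1 k1) k1 lo' hi' /\
    forall n, k n <= k1 n.
Proof.
  intros hr hs hs' hc.
  pose proof hr as [hA [hB [hd [[hw hwd] hrung]]]].
  pose proof hs as [hs1 [hs2 [hs3 hs4]]]; pose proof hs' as [hs1' [hs2' [hs3' hs4']]].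
  destruct (side_off hs) as [hoff hadj].
  assert (hnr : forall i j, ~ adj (A i) (B j)).
  { intros i j h; apply hrung in h as [n [_ [e _]]].
    apply (hoff n 0); [lia|]; exists i; now symmetry. }
  destruct hc as [hc|[hc|[hc hk]]].
  - assert (hlm : forall n m, n <> m -> lo n <> lo m /\ lo m <> S (lo n)).
    { intros n m hne; destruct (lt_eq_lt_dec n m) as [[h|]|h]; [|contradiction|];
        apply (side_gap hs) in h; rewrite hc in h; lia. }
    exists A, (fun n => prepend (A (lo n)) (w n)), (fun n => S (k n)), true, lo, hi.
    split; [|split; [|split; [discriminate|split; [|auto]]]].
    + split; [assumption|]; split; [assumption|]; split; [assumption|]; split; [split|].
      * intros n; apply ipath_prepend; [apply hw| |].
        -- intros i hi0 e; apply (hoff n i hi0); now exists (lo n).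
        -- intros i hi0; split.
           ++ intros h; apply adj_sym, hadj in h; tauto.
           ++ intros ->; apply adj_sym, hs3.
      * assert (key : forall n m j, n <> m -> j <= k m ->
          A (lo n) <> w m j /\ ~ adj (A (lo n)) (w m j)).
        { intros n m j hne hj; split.
          - intros e; apply (hoff m j hj); now exists (lo n).
          - intros h; apply adj_sym, hadj in h; [|assumption]; rewrite hc in h.
            destruct (hlm n m hne); lia. }
        intros n m [|i] [|j] hne hi0 hj; simpl.
        -- destruct (hlm n m hne), (hlm m n (not_eq_sym hne)); split.
           ++ intros e; now apply ray_inj in e.
           ++ intros h; apply ray_step in h; [lia|assumption].
        -- apply key; [assumption|lia].
        -- destruct (key m n i); [auto|lia|]; split; [auto|]; intros h; now apply H0, adj_sym.
        -- apply hwd; trivial; lia.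
      * intros i j h; now apply hnr in h.
    + split; [|split; [|split; [|assumption]]].
      * intros n [|i] hi0 h; [easy|]; exfalso; apply (hoff n i); [lia|exact h].
      * intros n [|i] j hi0 h; [lia|]; simpl in h; apply hadj in h; [|lia].
        rewrite hc in h; repeat split; lia.
      * intros n; split; [reflexivity|apply hc].
    + assert (hrev : forall n i, i <= k n ->
        reversed (fun n => prepend (A (lo n)) (w n)) (fun n => S (k n)) n i =
        reversed w k n i).
      { intros n i hi0; unfold reversed; now rewrite Nat.sub_succ_l. }
      assert (hrev' : forall n,
        reversed (fun n => prepend (A (lo n)) (w n)) (fun n => S (k n)) n (S (k n)) =
        A (lo n)).
      { intros n; unfold reversed; now rewrite Nat.sub_diag. }
      split; [|split; [|split; [|assumption]]].
      * intros n i hi0 h; destruct (Nat.eq_dec i (S (k n))) as [->|hne].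
        -- rewrite hrev' in h; destruct h as [j e]; now apply hd in e.
        -- rewrite hrev in h by lia; apply (hs1' n); [lia|assumption].
      * intros n i j hi0 h; destruct (Nat.eq_dec i (S (k n))) as [->|hne].
        -- rewrite hrev' in h; now apply hnr in h.
        -- rewrite hrev in h by lia; apply (hs2' n); [lia|assumption].
      * intros n; rewrite hrev by lia; apply hs3'.
  - exists A, w, k, false, lo, hi; split; [exact hr|split; [exact hs|]].
    split; [intros _; exact hc|split; [exact hs'|auto]].
  - destruct (reroute G A (fun n => w n 0) lo hi) as [A1 [s [g1 [g2 [g3 g4]]]]]; trivial.
    + intros n; specialize (hs4 n); lia.
    + intros n; apply hoff; lia.
    + intros n j h; now apply (hadj n 0 j); [lia|].
    + intros n; split; apply hs3.
    + intros n m hne; apply hwd; trivial; lia.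
    + assert (hB0 : forall n, ~ on_ray B (w n 0)).
      { intros n h; destruct (hs1' n (k n)) as [_ e]; [lia| |specialize (hk n); lia].
        unfold reversed; now rewrite Nat.sub_diag. }
      exists A1, w, k, true, s, s.
      split; [|split; [|split; [discriminate|split; [assumption|auto]]]].
      * split; [assumption|]; split; [assumption|]; split; [|split; [now split|]].
        -- intros i j e; destruct (g4 i) as [[n [_ e']]|[j' e']]; rewrite e' in e.
           ++ apply (hB0 n); now exists j.
           ++ now apply hd in e.
        -- intros i j h; destruct (g4 i) as [[n [_ e']]|[j' e']]; rewrite e' in h.
           ++ exists n; rewrite e'.
              (* An edge from the new rail vertex [w n 0] to [B] is possible only if [k n = 1] and
                 [w n 1] lies on [B]: the link is a single rung. *)
              destruct (hs2' n (k n) j) as [e1 [e2 e3]].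
              { specialize (hk n); lia. }
              { unfold reversed; now rewrite Nat.sub_diag. }
              repeat split; trivial; specialize (hs3' n); rewrite e1 in hs3'.
              unfold reversed in hs3'; rewrite e2 in hs3'; rewrite e3; symmetry; apply hs3'.
           ++ now apply hnr in h.
      * split; [|split; [|split; [|assumption]]].
        -- intros n i hi0 [j e]; split; [easy|].
           destruct (g4 j) as [[m [_ e']]|[j' e']]; rewrite e' in e.
           ++ destruct (Nat.eq_dec n m) as [<-|hne]; [apply hw in e; trivial; lia|].
              exfalso; revert e; apply hwd; trivial; lia.
           ++ exfalso; apply (hoff n i hi0); now exists j'.
        -- intros n i j hi0 h; split; [easy|].
           destruct (g4 j) as [[m [-> e']]|[j' e']]; rewrite e' in h.
           ++ destruct (Nat.eq_dec n m) as [<-|hne].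
              ** apply hw in h; [split; [lia|easy]|lia|lia].
              ** apply hwd in h; [easy|assumption|lia|lia].
           ++ apply hadj in h; lia.
        -- intros n; now rewrite g3.
Qed.

(** When a link is a single vertex [w n 0] seeing a wide segment of [A],
    rerouting [A] through it creates rungs, and these do not cross. *)
Lemma wide_vertex_links (G : graph) (A B : nat -> G) w k lo hi lo' hi' :
  locally_finite G -> rails A B w k ->
  side false A w k lo hi -> side false B (reversed w k) k lo' hi' ->
  (forall n, k n = 0) -> (forall n, S (S (lo n)) <= hi n) -> unavoidable G.
Proof.
  intros hl hr hs hs' hk hc.
  pose proof hr as [hA [hB [hd [[hw hwd] hrung]]]].
  pose proof hs as [hs1 [hs2 [hs3 hs4]]]; pose proof hs' as [hs1' [hs2' [hs3' hs4']]].
  assert (hoff : forall n, ~ on_ray A (w n 0)).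
  { intros n; apply (side_off hs); lia. }
  assert (hrev : forall n i, reversed w k n i = w n 0).
  { intros n i; unfold reversed; now rewrite hk. }
  assert (hoff' : forall n, ~ on_ray B (w n 0)).
  { intros n h; rewrite <- (hrev n 0) in h; apply hs1' in h; [|lia].
    destruct h; discriminate. }
  destruct (reroute G A (fun n => w n 0) lo hi) as [A1 [s [g1 [g2 [g3 g4]]]]]; trivial.
  - intros n; specialize (hs4 n); lia.
  - intros n; apply hs3.
  - intros n; split; apply hs3.
  - intros n m hne; apply hwd; trivial; lia.
  - assert (hsinc : increasing s) by (apply increasing_S; intros n; specialize (g2 n); lia).
    assert (hA1 : forall i j, adj (A1 i) (B j) -> exists n, i = s n /\ lo' n <= j <= hi' n).
    { intros i j h; destruct (g4 i) as [[n [-> e]]|[j' e]]; rewrite e in h.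
      - exists n; split; [easy|]; specialize (hs3' n); rewrite hrev in hs3'; now apply hs3'.
      - exfalso; apply hrung in h as [n [_ [h _]]]; apply (hoff n); exists j'; now symmetry. }
    apply (clean_unavoidable G A1 B); trivial.
    + intros i j e; destruct (g4 i) as [[n [_ e']]|[j' e']]; rewrite e' in e.
      * apply (hoff' n); now exists j.
      * now apply hd in e.
    + intros i j i' j' h1 h2 h3 h4; exfalso.
      apply hA1 in h1 as [n [-> h1]], h2 as [m [-> h2]].
      destruct (lt_eq_lt_dec n m) as [[h|<-]|h].
      * apply (side_gap hs') in h; lia.
      * lia.
      * apply hsinc in h; lia.
    + intros N; exists (s N), (lo' N); split; [now apply increasing_ge|].
      split.
      * apply increasing_ge; intros n m h; apply (side_gap hs') in h.
        pose proof (side_le n hs'); lia.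
      * rewrite g3; specialize (hs3' N); rewrite hrev in hs3'; apply hs3'.
Qed.

(** Nonadjacent rails are required because a rung could otherwise belong to a link that the
    subsequence drops. *)
Lemma rails_sub {G : graph} (A B : nat -> G) w k e :
  increasing e -> (forall i j, ~ adj (A i) (B j)) -> rails A B w k ->
  rails A B (fun n => w (e n)) (fun n => k (e n)).
Proof.
  intros he hn [h1 [h2 [h3 [h4 _]]]]; split; [assumption|]; split; [assumption|].
  split; [assumption|]; split; [now apply disjoint_links_sub|].
  intros i j h; now apply hn in h.
Qed.

(** On a subsequence either all links are single vertices or none is, and the feet on each rail are
    of one kind. Wide feet of single vertices go to [wide_vertex_links]; otherwise first [A] and
    then, after exchanging the rails, [B] is normalised. *)
Lemma links_unavoidable (G : graph) (A B : nat -> G) w k lo hi lo' hi' :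
  locally_finite G -> rails A B w k -> (forall i j, ~ adj (A i) (B j)) ->
  side false A w k lo hi -> side false B (reversed w k) k lo' hi' -> unavoidable G.
Proof.
  intros hl hr hn hs hs'.
  destruct (homogeneous (fun n => k n = 0)) as [e0 [he0 hk]].
  destruct (side_trichotomy (fun n => lo (e0 n)) (fun n => hi (e0 n))) as [e1 [he1 ht]].
  { intros n; apply (side_le _ hs). }
  destruct (side_trichotomy (fun n => lo' (e0 (e1 n))) (fun n => hi' (e0 (e1 n))))
    as [e2 [he2 ht']].
  { intros n; apply (side_le _ hs'). }
  set (e := fun n => e0 (e1 (e2 n))).
  assert (he : increasing e).
  { apply (increasing_comp e0 (fun n => e1 (e2 n))); [assumption|].
    now apply increasing_comp. }
  apply (rails_sub A B w k e he hn) in hr.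
  apply (side_sub false A w k lo hi e he) in hs.
  apply (side_sub false B (reversed w k) k lo' hi' e he) in hs'.
  change (side false B (reversed (fun n => w (e n)) (fun n => k (e n))) (fun n => k (e n))
    (fun n => lo' (e n)) (fun n => hi' (e n))) in hs'.
  assert (hke : (forall n, k (e n) = 0) \/ (forall n, 1 <= k (e n))).
  { destruct hk as [hk|hk]; [left|right]; intros n; [apply hk|].
    specialize (hk (e1 (e2 n))); change (k (e n) <> 0) in hk; lia. }
  assert (hte : (forall n, hi (e n) = lo (e n)) \/ (forall n, hi (e n) = S (lo (e n))) \/
    (forall n, S (S (lo (e n))) <= hi (e n))).
  { destruct ht as [ht|[ht|ht]]; [left|right; left|right; right]; intros n; apply ht. }
  assert (hte' : (forall n, hi' (e n) = lo' (e n)) \/ (forall n, hi' (e n) = S (lo' (e n))) \/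
    (forall n, S (S (lo' (e n))) <= hi' (e n))) by exact ht'.
  clear ht ht' hk he.
  set (w1 := fun n => w (e n)) in *; set (k1 := fun n => k (e n)) in *.
  assert (hA : (forall n, hi (e n) = lo (e n)) \/ (forall n, hi (e n) = S (lo (e n))) \/
    ((forall n, S (S (lo (e n))) <= hi (e n)) /\ (forall n, 1 <= k1 n)) \/ unavoidable G).
  { destruct hte as [ht|[ht|ht]]; auto.
    destruct hke as [hk|hk]; [do 3 right|auto].
    now apply (wide_vertex_links G A B w1 k1 _ _ _ _ hl hr hs hs'). }
  assert (hB : (forall n, hi' (e n) = lo' (e n)) \/ (forall n, hi' (e n) = S (lo' (e n))) \/
    ((forall n, S (S (lo' (e n))) <= hi' (e n)) /\ (forall n, 1 <= k1 n)) \/ unavoidable G).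
  { destruct hte' as [ht|[ht|ht]]; auto.
    destruct hke as [hk|hk]; [do 3 right|auto].
    apply (wide_vertex_links G B A (reversed w1 k1) k1 (fun n => lo' (e n))
      (fun n => hi' (e n)) (fun n => lo (e n)) (fun n => hi (e n)) hl); trivial.
    - now apply rails_swap.
    - now apply side_reversed2. }
  destruct hA as [hA|[hA|[hA|hA]]]; try exact hA.
  all: destruct hB as [hB|[hB|[hB|hB]]]; try exact hB.
  all: destruct (normalise_side G A B w1 k1 (fun n => lo (e n)) (fun n => hi (e n)) false
      (fun n => lo' (e n)) (fun n => hi' (e n)) hr hs hs')
    as [A1 [w2 [k2 [o [lo1 [hi1 [hr2 [hs2 [ho [hs2' hk2]]]]]]]]]]; auto.
  all: destruct (normalise_side G B A1 (reversed w2 k2) k2 (fun n => lo' (e n))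
      (fun n => hi' (e n)) o lo1 hi1)
    as [B1 [w3 [k3 [o' [lo2 [hi2 [hr3 [hs3 [ho' [hs3' hk3]]]]]]]]]];
    [now apply rails_swap|assumption|now apply side_reversed2| |
     now apply (ladder_unavoidable G o' o B1 A1 w3 k3 lo2 hi2 lo1 hi1)].
  all: try (now left); try (right; left; exact hB).
  all: right; right; split; [apply hB|]; intros n;
    apply Nat.le_trans with (k1 n); [apply hB|apply hk2].
Qed.

(** * Two rays of the same end *)

Lemma neighbours_list (G : graph) : locally_finite G ->
  forall l : list G, exists l', forall x y, In x l -> adj x y -> In y l'.
Proof.
  intros hl l; induction l as [|z l [l' IH]]; [exists []; intros x y []|].
  destruct (hl z) as [lz hz]; exists (lz ++ l'); intros x y [<-|hx] ha; apply in_or_app; eauto.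
Qed.

Lemma injective_bound {T} (f : nat -> T) (l : list T) :
  Injective f -> exists B, forall i, In (f i) l -> i < B.
Proof.
  intros hf; destruct (bound_list (fun x i => f i = x) l) as [B hB].
  - intros x _; destruct (classic (exists i, f i = x)) as [[i <-]|hn].
    + exists (S i); intros j e; apply hf in e; lia.
    + exists 0; intros j e; exfalso; eauto.
  - exists B; intros i hi; now apply (hB (f i) i).
Qed.

(** As the rays are disjoint and nonadjacent, a shortest path between them outside [F] has interior
    vertices, all off both rays. They connect the two neighbourhoods, and a shortest such connection
    is the link. *)
Lemma next_link (G : graph) (A B : nat -> G) :
  disjoint_rays A B -> (forall i j, ~ adj (A i) (B j)) ->
  (forall F : list G, exists i j, conn (fun x => ~ In x F) (A i) (B j)) ->
  forall F : list G, exists z k,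
    (forall i, i <= k -> ~ In (z i) F /\ ~ on_ray A (z i) /\ ~ on_ray B (z i)) /\
    (exists j, adj (z 0) (A j)) /\ (exists j, adj (z k) (B j)) /\
    (forall i j, i <= k -> adj (z i) (A j) -> i = 0) /\
    (forall i j, i <= k -> adj (z i) (B j) -> i = k) /\ ipath z k.
Proof.
  intros hd hn hF F.
  destruct (shortest (fun x => ~ In x F) (on_ray A) (on_ray B))
    as [f [n [[hw1 hw2] [[a ha] [[b hb] [hx [hy _]]]]]]].
  { destruct (hF F) as [i [j h]]; exists (A i), (B j); repeat split;
      [now exists i|now exists j|assumption]. }
  destruct n as [|[|n]].
  { exfalso; apply (hd a b); congruence. }
  { exfalso; apply (hn a b); rewrite <- ha, <- hb; apply hw2; lia. }
  destruct (shortest (fun x => ~ In x F /\ ~ on_ray A x /\ ~ on_ray B x)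
    (fun x => exists j, adj x (A j)) (fun x => exists j, adj x (B j)))
    as [z [k [[h1 _] [h2 [h3 [h4 [h5 h6]]]]]]].
  - exists (f 1), (f (S n)); split; [|split].
    + exists a; rewrite <- ha; apply adj_sym, hw2; lia.
    + exists b; rewrite <- hb; apply hw2; lia.
    + replace (S n) with (1 + n) by lia.
      change (f 1) with ((fun i => f (1 + i)) 0).
      apply (walk_conn _ (fun i => f (1 + i)) n); try lia; split.
      * intros i hi; split; [apply hw1; lia|]; split; intros h.
        -- apply hx in h; lia.
        -- apply hy in h; lia.
      * intros i hi; apply hw2; lia.
  - exists z, k; repeat split; trivial; try apply h6; try (now apply h1).
    + intros i j hi h; apply h4; eauto.
    + intros i j hi h; apply h5; eauto.
Qed.

(** By local finiteness only finitely many vertices have to be avoided at each stage, so links whose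
    feet move outwards can be chosen one after another. *)
Lemma ends_unavoidable (G : graph) (A B : nat -> G) :
  locally_finite G -> induced_ray G A -> induced_ray G B -> disjoint_rays A B ->
  (forall i j, ~ adj (A i) (B j)) ->
  (forall F : list G, exists i j, conn (fun x => ~ In x F) (A i) (B j)) ->
  unavoidable G.
Proof.
  intros hl hA hB hd hn hF.
  set (good := fun (zk : (nat -> G) * nat) => let (z, k) := zk in
    (forall i, i <= k -> ~ on_ray A (z i) /\ ~ on_ray B (z i)) /\
    (exists j, adj (z 0) (A j)) /\ (exists j, adj (z k) (B j)) /\
    (forall i j, i <= k -> adj (z i) (A j) -> i = 0) /\
    (forall i j, i <= k -> adj (z i) (B j) -> i = k) /\ ipath z k).
  set (after := fun (zk' zk : (nat -> G) * nat) =>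
    (forall i i', i <= snd zk -> i' <= snd zk' ->
      fst zk i <> fst zk' i' /\ ~ adj (fst zk i) (fst zk' i')) /\
    (forall i i' j j', i <= snd zk -> i' <= snd zk' ->
      adj (fst zk' i') (A j') -> adj (fst zk i) (A j) -> S j' < j) /\
    (forall i i' j j', i <= snd zk -> i' <= snd zk' ->
      adj (fst zk' i') (B j') -> adj (fst zk i) (B j) -> S j' < j)).
  destruct (greedy (fun l zk => good zk /\ forall zk', In zk' l -> after zk' zk))
    as [Z hZ].
  { intros l.
    set (P := flat_map (fun zk => map (fst zk) (seq 0 (S (snd zk)))) l).
    assert (hP : forall zk' i, In zk' l -> i <= snd zk' -> In (fst zk' i) P).
    { intros zk' i h1 h2; apply in_flat_map; exists zk'; split; [assumption|].
      apply in_map_seq; exists i; split; [lia|easy]. }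
    destruct (neighbours_list G hl P) as [nP hnP].
    destruct (injective_bound A nP (proj1 (proj1 hA))) as [a ha].
    destruct (injective_bound B nP (proj1 (proj1 hB))) as [b hb].
    destruct (neighbours_list G hl (map A (seq 0 (S (S a))))) as [nA hnA].
    destruct (neighbours_list G hl (map B (seq 0 (S (S b))))) as [nB hnB].
    (* Avoiding [P] and [nP] separates the new link from the old ones; avoiding [nA] and [nB] places
       its feet beyond [S a] and [S b], while old feet are below [a] and [b]. *)
    destruct (next_link G A B hd hn hF (P ++ nP ++ nA ++ nB))
      as [z [k [h1 [h2 [h3 [h4 [h5 h6]]]]]]].
    exists (z, k); split; [repeat split; trivial; try apply h6; now apply h1|].
    intros zk' hin; split; [|split]; simpl.
    - intros i i' hi hi'; destruct (h1 i hi) as [h7 _].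
      pose proof (hP zk' i' hin hi') as h8; split.
      + intros e; apply h7, in_or_app; left; now rewrite e.
      + intros h; apply h7, in_or_app; right; apply in_or_app; left.
        apply (hnP (fst zk' i')); [assumption|now apply adj_sym].
    - intros i i' j j' hi hi' h h'; destruct (h1 i hi) as [h7 _].
      assert (j' < a) by (apply ha, (hnP (fst zk' i')); auto).
      destruct (le_lt_dec j (S a)) as [hj|]; [exfalso|lia].
      apply h7; do 2 (apply in_or_app; right); apply in_or_app; left.
      apply (hnA (A j)); [apply in_map_seq; exists j; split; [lia|easy]|now apply adj_sym].
    - intros i i' j j' hi hi' h h'; destruct (h1 i hi) as [h7 _].
      assert (j' < b) by (apply hb, (hnP (fst zk' i')); auto).
      destruct (le_lt_dec j (S b)) as [hj|]; [exfalso|lia].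
      apply h7; do 3 (apply in_or_app; right).
      apply (hnB (B j)); [apply in_map_seq; exists j; split; [lia|easy]|now apply adj_sym]. }
  set (z := fun n => fst (Z n)); set (k := fun n => snd (Z n)).
  assert (hgood : forall n, (forall i, i <= k n -> ~ on_ray A (z n i) /\ ~ on_ray B (z n i)) /\
    (exists j, adj (z n 0) (A j)) /\ (exists j, adj (z n (k n)) (B j)) /\
    (forall i j, i <= k n -> adj (z n i) (A j) -> i = 0) /\
    (forall i j, i <= k n -> adj (z n i) (B j) -> i = k n) /\ ipath (z n) (k n)).
  { intros n; destruct (hZ n) as [h _]; unfold z, k; destruct (Z n); exact h. }
  assert (hafter : forall m n, m < n -> after (Z m) (Z n)).
  { intros m n hmn; apply hZ, in_map_seq; exists m; split; [lia|easy]. }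
  assert (bounds : forall (R : nat -> G) y, induced_ray G R -> (exists j, adj y (R j)) ->
    exists p : nat * nat, adj y (R (fst p)) /\ adj y (R (snd p)) /\ fst p <= snd p /\
      forall j, adj y (R j) -> fst p <= j <= snd p).
  { intros R y hR he; destruct (least _ he) as [a [ha1 ha2]].
    destruct (hl y) as [l hly]; destruct (injective_bound R l (proj1 (proj1 hR))) as [b hb].
    destruct (greatest _ b he) as [c [hc1 hc2]].
    { intros j h; apply Nat.lt_le_incl; auto. }
    exists (a, c); simpl; repeat split; auto. }
  destruct (choice_fun (fun n p => adj (z n 0) (A (fst p)) /\ adj (z n 0) (A (snd p)) /\
    fst p <= snd p /\ forall j, adj (z n 0) (A j) -> fst p <= j <= snd p)) as [pA hpA].
  { intros n; apply bounds; [assumption|apply hgood]. }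
  destruct (choice_fun (fun n p => adj (z n (k n)) (B (fst p)) /\ adj (z n (k n)) (B (snd p)) /\
    fst p <= snd p /\ forall j, adj (z n (k n)) (B j) -> fst p <= j <= snd p)) as [pB hpB].
  { intros n; apply bounds; [assumption|apply hgood]. }
  apply (links_unavoidable G A B z k (fun n => fst (pA n)) (fun n => snd (pA n))
    (fun n => fst (pB n)) (fun n => snd (pB n))); trivial.
  - split; [assumption|]; split; [assumption|]; split; [assumption|]; split; [split|].
    + intros n; apply hgood.
    + intros n m i j hne hi hj; destruct (lt_eq_lt_dec n m) as [[h|]|h]; [|contradiction|].
      * destruct (hafter n m h) as [h1 _]; destruct (h1 j i hj hi) as [h2 h3].
        split; [auto|]; intros h4; now apply h3, adj_sym.
      * destruct (hafter m n h) as [h1 _]; now apply h1.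
    + intros i j h; now apply hn in h.
  - split; [|split; [|split; [apply hpA|]]].
    + intros n i hi h; exfalso; exact (proj1 (proj1 (hgood n) i hi) h).
    + intros n i j hi h; destruct (hgood n) as [_ [_ [_ [h1 _]]]].
      apply h1 in h; lia.
    + intros n; destruct (hafter n (S n)) as [_ [h _]]; [lia|].
      apply (h 0 0); try lia; apply hpA.
  - split; [|split; [|split]].
    + intros n i hi h; exfalso.
      exact (proj2 (proj1 (hgood n) (k n - i) ltac:(lia)) h).
    + intros n i j hi h; destruct (hgood n) as [_ [_ [_ [_ [h1 _]]]]].
      apply h1 in h; lia.
    + intros n; unfold reversed; rewrite Nat.sub_0_r; apply hpB.
    + intros n; destruct (hafter n (S n)) as [_ [_ h]]; [lia|].
      apply (h (k (S n)) (k n)); try (unfold k; lia); apply hpB.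
Qed.

(** If there are no rungs with both ends beyond some [N], the tails from [N] on are nonadjacent. *)
Lemma clean_rays_unavoidable (G : graph) (A B : nat -> G) :
  locally_finite G -> induced_ray G A -> induced_ray G B -> disjoint_rays A B ->
  (forall i j i' j', adj (A i) (B j) -> adj (A i') (B j') -> i < i' -> j' < j ->
     i' = S i /\ j = S j') ->
  (forall F : list G, exists i j, conn (fun x => ~ In x F) (A i) (B j)) ->
  unavoidable G.
Proof.
  intros hl hA hB hd hcr hF.
  destruct (classic (forall N, exists i j, N <= i /\ N <= j /\ adj (A i) (B j))) as [h|h].
  { now apply (clean_unavoidable G A B). }
  apply not_all_ex_not in h as [N hN].
  apply (ends_unavoidable G (fun i => A (N + i)) (fun j => B (N + j))); trivial.
  - now apply induced_ray_tail.
  - now apply induced_ray_tail.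
  - intros i j; apply hd.
  - intros i j h; apply hN; exists (N + i), (N + j); repeat split; trivial; lia.
  - intros F.
    destruct (hF (F ++ map A (seq 0 N) ++ map B (seq 0 N))) as [i [j h]].
    pose proof (conn_in _ _ _ h) as [h1 h2].
    assert (N <= i).
    { destruct (le_lt_dec N i); [assumption|]; exfalso; apply h1, in_or_app; right.
      apply in_or_app; left; apply in_map_seq; exists i; split; [lia|easy]. }
    assert (N <= j).
    { destruct (le_lt_dec N j); [assumption|]; exfalso; apply h2, in_or_app; right.
      apply in_or_app; right; apply in_map_seq; exists j; split; [lia|easy]. }
    exists (i - N), (j - N).
    replace (N + (i - N)) with i by lia; replace (N + (j - N)) with j by lia.
    revert h; apply conn_mono; intros x hx hin; apply hx, in_or_app; now left.
Qed.

(** * Shortest linkages and their limits *)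

Definition linkage {G : graph} (A T : G -> Prop) (a b : G) f m g n :=
  walk A f m /\ walk A g n /\ f 0 = a /\ g 0 = b /\ T (f m) /\ T (g n) /\
  forall i j, i <= m -> j <= n -> f i <> g j.

Definition shortest_linkage {G : graph} (A T : G -> Prop) (a b : G) f m g n :=
  linkage A T a b f m g n /\
  forall f' m' g' n', linkage A T a b f' m' g' n' -> m + n <= m' + n'.

Lemma linkage_swap {G : graph} {A T : G -> Prop} {a b f m g n} :
  linkage A T a b f m g n -> linkage A T b a g n f m.
Proof.
  intros [h1 [h2 [h3 [h4 [h5 [h6 h7]]]]]]; repeat split; trivial; try apply h1; try apply h2.
  intros i j hi hj e; now apply (h7 j i).
Qed.

Lemma shortest_linkage_swap {G : graph} {A T : G -> Prop} {a b f m g n} :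
  shortest_linkage A T a b f m g n -> shortest_linkage A T b a g n f m.
Proof.
  intros [h1 h2]; split; [now apply linkage_swap|]; intros f' m' g' n' h.
  apply linkage_swap, h2 in h; lia.
Qed.

(** A shortcut on one path only discards vertices, so it preserves disjointness from the other. *)
Lemma shortest_linkage_induced {G : graph} {A T : G -> Prop} {a b f m g n} :
  shortest_linkage A T a b f m g n ->
  forall i j, i < j -> j <= m -> f i <> f j /\ (adj (f i) (f j) -> j = S i).
Proof.
  intros [[h1 [h2 [h3 [h4 [h5 [h6 h7]]]]]] hmin].
  assert (hd : forall i d, i + 1 + d <= m -> adj (f i) (f (i + 1 + d)) -> d = 0).
  { intros i d hi ha; enough (m + n <= m - d + n) by lia.
    apply (hmin (skip f i d) (m - d) g n).
    split; [now apply walk_skip|]; split; [assumption|]; unfold skip.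
    split; [assumption|]; split; [assumption|]; split; [|split; [assumption|]].
    - destruct (Nat.leb_spec (m - d) i); [lia|].
      now replace (m - d + d) with m by lia.
    - intros k j hk hj; destruct (Nat.leb_spec k i); apply h7; lia. }
  intros i j hij hj; split.
  - intros e; destruct (Nat.eq_dec j m) as [->|hne].
    + enough (m + n <= i + n) by lia; apply (hmin f i g n).
      split; [split; intros; apply h1; lia|]; split; [assumption|].
      split; [assumption|]; split; [assumption|]; split; [now rewrite e|].
      split; [assumption|]; intros k l hk hl; apply h7; lia.
    + assert (j - i = 0); [|lia]; apply (hd i); [lia|].
      replace (i + 1 + (j - i)) with (S j) by lia; rewrite e; apply h1; lia.
  - intros ha; assert (j - i - 1 = 0); [|lia]; apply (hd i); [lia|].
    now replace (i + 1 + (j - i - 1)) with j by lia.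
Qed.

(** Two crossing edges can be used to exchange the ends of the two paths; this
    saves vertices unless the cross is degenerate. *)
Lemma shortest_linkage_cross {G : graph} {A T : G -> Prop} {a b f m g n} :
  shortest_linkage A T a b f m g n ->
  forall i j i' j', i' <= m -> j <= n -> i < i' -> j' < j ->
  adj (f i) (g j) -> adj (f i') (g j') -> i' = S i /\ j = S j'.
Proof.
  intros h i j i' j' hi' hj hii hjj ha ha'.
  pose proof (shortest_linkage_induced h) as hf.
  pose proof (shortest_linkage_induced (shortest_linkage_swap h))
    as hg.
  destruct h as [[h1 [h2 [h3 [h4 [h5 [h6 h7]]]]]] hmin].
  set (f' := fun k => if k <=? i then f k else g (k - S i + j)).
  set (g' := fun k => if k <=? j' then g k else f (k - S j' + i')).
  (* The exchanged paths use one edge of the cross each. Minimality gives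
     [(i' - i) + (j - j') <= 2], and both differences are positive. *)
  enough (m + n <= (S i + (n - j)) + (S j' + (m - i'))) by lia.
  apply (hmin f' _ g').
  assert (hw : forall (p q : nat -> G) s t x y, walk A p s -> walk A q t -> x <= s -> y <= t ->
    adj (p x) (q y) ->
    walk A (fun k => if k <=? x then p k else q (k - S x + y)) (S x + (t - y))).
  { intros p q s t x y [hp1 hp2] [hq1 hq2] hx hy hxy; split.
    - intros k hk; destruct (Nat.leb_spec k x); [apply hp1|apply hq1]; lia.
    - intros k hk; destruct (Nat.leb_spec k x), (Nat.leb_spec (S k) x); try lia.
      + apply hp2; lia.
      + assert (k = x) as -> by lia; now rewrite Nat.sub_diag.
      + replace (S k - S x + y) with (S (k - S x + y)) by lia; apply hq2; lia. }
  split; [apply (hw f g m n); trivial; lia|].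
  split; [apply (hw g f n m); trivial; [lia|now apply adj_sym]|].
  split; [assumption|]; split; [assumption|]; split; [|split].
  - unfold f'; destruct (Nat.leb_spec (S i + (n - j)) i); [lia|].
    now replace (S i + (n - j) - S i + j) with n by lia.
  - unfold g'; destruct (Nat.leb_spec (S j' + (m - i')) j'); [lia|].
    now replace (S j' + (m - i') - S j' + i') with m by lia.
  - intros k l hk hl; unfold f', g'.
    destruct (Nat.leb_spec k i), (Nat.leb_spec l j').
    + apply h7; lia.
    + apply hf; lia.
    + apply not_eq_sym, hg; lia.
    + apply not_eq_sym, h7; lia.
Qed.

(** König's lemma: a prefix is good if infinitely many [h N] start with it, and as [l k] is finite,
    every good prefix has a good extension by one term. *)
Lemma compactness {T} (h : nat -> nat -> T) (l : nat -> list T) :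
  (forall N k, k <= N -> In (h N k) (l k)) ->
  exists c, forall K M, exists N, M <= N /\ forall k, k < K -> h N k = c k.
Proof.
  intros hl.
  set (good := fun s => unbounded (fun N => map (h N) (seq 0 (length s)) = s)).
  destruct (greedy (fun s x => good s -> good (s ++ [x]))) as [c hc].
  { intros s; destruct (classic (good s)) as [hs|hs]; [|exists (h 0 0); tauto].
    destruct (unbounded_pigeonhole (l (length s)) (fun x N =>
      map (h N) (seq 0 (length s)) = s /\ h N (length s) = x)) as [x [_ hx]].
    - intros M; destruct (hs (M + length s)) as [N [h1 h2]]; exists N; split; [lia|].
      exists (h N (length s)); split; [apply hl; lia|easy].
    - exists x; intros _; revert hx; apply unbounded_mono; intros N [h1 h2].
      rewrite length_app, Nat.add_comm; simpl length.
      change (1 + length s) with (S (length s)).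
      rewrite seq_S, map_app, h1; simpl; now rewrite h2. }
  assert (hgood : forall K, good (map c (seq 0 K))).
  { induction K as [|K IH].
    - intros N; exists N; split; [lia|reflexivity].
    - rewrite seq_S, map_app; now apply hc. }
  exists c; intros K M; destruct (hgood K M) as [N [h1 h2]]; exists N; split; [assumption|].
  rewrite length_map, length_seq in h2.
  intros k hk; apply (ext_in_map h2), in_seq; lia.
Qed.

(** Each requirement concerns finitely many vertices of [R], all realised by one approximant
    [f N]. *)
Lemma limit_induced_ray {G : graph} (R : nat -> G) (f : nat -> nat -> G) (m : nat -> nat) :
  (forall K, exists N, K < m N /\ forall k, k <= K -> R k = f N k) ->
  (forall N i, i < m N -> adj (f N i) (f N (S i))) ->
  (forall N i j, i < j -> j <= m N ->
     f N i <> f N j /\ (adj (f N i) (f N j) -> j = S i)) ->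
  induced_ray G R.
Proof.
  intros hR hf hi; apply induced_ray_intro; [intros i|intros i j hij..].
  - destruct (hR (S i)) as [N [h1 h2]]; rewrite !h2 by lia; apply hf; lia.
  - destruct (hR j) as [N [h1 h2]]; rewrite !h2 by lia; apply hi; lia.
  - destruct (hR j) as [N [h1 h2]]; rewrite !h2 by lia; apply hi; lia.
Qed.

(** For each [N] a shortest linkage to the outside of the ball of radius [N] around [a] and [b] is
    taken. Its paths have more than [N] edges and their [k]-th vertices lie in the finite ball of
    radius [k], so compactness applies. *)
Lemma clean_rays_exist (G : graph) (A : G -> Prop) (a b : G) :
  locally_finite G ->
  (forall F : list G, exists f m g n, linkage A (fun x => ~ In x F) a b f m g n) ->
  exists P Q, induced_ray G P /\ induced_ray G Q /\ disjoint_rays P Q /\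
    (forall i, A (P i) /\ A (Q i)) /\
    forall i j i' j', adj (P i) (Q j) -> adj (P i') (Q j') -> i < i' -> j' < j ->
      i' = S i /\ j = S j'.
Proof.
  intros hl hlink.
  destruct (choice_fun _ hl) as [nb hnb].
  set (ball := fix ball n := match n with
    | 0 => [a; b] | S n => ball n ++ flat_map nb (ball n) end).
  assert (hball : forall m n, m <= n -> incl (ball m) (ball n)).
  { intros m n hmn; induction hmn as [|n _ IH]; [apply incl_refl|].
    intros x hx; simpl; apply in_or_app; left; auto. }
  assert (hwb : forall f m, walk A f m -> In (f 0) [a; b] ->
    forall i, i <= m -> In (f i) (ball i)).
  { intros f m [_ hf] h0 i; induction i as [|i IH]; intros hi; [exact h0|].
    simpl; apply in_or_app; right; apply in_flat_map; exists (f i); split; [apply IH; lia|].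
    apply hnb, hf; lia. }
  set (T := fun N x => ~ In x (ball N)).
  destruct (choice_fun (fun N (s : (nat -> G) * nat * ((nat -> G) * nat)) =>
    let '((f, m), (g, n)) := s in shortest_linkage A (T N) a b f m g n)) as [s hs].
  { intros N.
    destruct (least (fun q => exists f m g n, linkage A (T N) a b f m g n /\ q = m + n))
      as [q [[f [m [g [n [h ->]]]]] hmin]].
    { destruct (hlink (ball N)) as [f [m [g [n h]]]]; exists (m + n), f, m, g, n; auto. }
    exists ((f, m), (g, n)); split; [assumption|]; intros f' m' g' n' h'.
    apply hmin; exists f', m', g', n'; auto. }
  set (f := fun N => fst (fst (s N))); set (m := fun N => snd (fst (s N))).
  set (g := fun N => fst (snd (s N))); set (n := fun N => snd (snd (s N))).
  assert (hfg : forall N, shortest_linkage A (T N) a b (f N) (m N) (g N) (n N)).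
  { intros N; specialize (hs N); unfold f, m, g, n.
    destruct (s N) as [[? ?] [? ?]]; exact hs. }
  clearbody f m g n; clear s hs.
  assert (hfb : forall N k, k <= m N -> In (f N k) (ball k)).
  { intros N k; destruct (hfg N) as [[h1 [_ [h2 _]]] _]; apply (hwb (f N) (m N) h1).
    rewrite h2; now left. }
  assert (hgb : forall N k, k <= n N -> In (g N k) (ball k)).
  { intros N k; destruct (hfg N) as [[_ [h1 [_ [h2 _]]]] _]; apply (hwb (g N) (n N) h1).
    rewrite h2; right; now left. }
  assert (hm : forall N, N < m N).
  { intros N; destruct (le_lt_dec (m N) N) as [h|]; [exfalso|assumption].
    destruct (hfg N) as [[_ [_ [_ [_ [h1 _]]]]] _]; apply h1.
    apply (hball (m N)); [assumption|]; apply hfb; lia. }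
  assert (hn : forall N, N < n N).
  { intros N; destruct (le_lt_dec (n N) N) as [h|]; [exfalso|assumption].
    destruct (hfg N) as [[_ [_ [_ [_ [_ [h1 _]]]]]] _]; apply h1.
    apply (hball (n N)); [assumption|]; apply hgb; lia. }
  (* Both paths are followed at once, as pairs, so that the same [N] approximates both limit
     rays. *)
  destruct (compactness (fun N k => (f N k, g N k)) (fun k => list_prod (ball k) (ball k)))
    as [c hc].
  { intros N k hk; specialize (hm N); specialize (hn N).
    apply in_prod; [apply hfb|apply hgb]; lia. }
  assert (hc' : forall K, exists N, K < m N /\ K < n N /\
    forall k, k <= K -> fst (c k) = f N k /\ snd (c k) = g N k).
  { intros K; destruct (hc (S K) K) as [N [h1 h2]]; exists N.
    specialize (hm N); specialize (hn N); split; [lia|]; split; [lia|].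
    intros k hk; rewrite <- h2 by lia; auto. }
  exists (fun k => fst (c k)), (fun k => snd (c k)); split; [|split; [|split; [|split]]].
  - apply (limit_induced_ray _ f m).
    + intros K; destruct (hc' K) as [N [h1 [_ h2]]]; exists N; split; [assumption|apply h2].
    + intros N; apply (hfg N).
    + intros N; apply (shortest_linkage_induced (hfg N)).
  - apply (limit_induced_ray _ g n).
    + intros K; destruct (hc' K) as [N [_ [h1 h2]]]; exists N; split; [assumption|apply h2].
    + intros N; apply (hfg N).
    + intros N.
      apply (shortest_linkage_induced (shortest_linkage_swap (hfg N))).
  - intros i j; destruct (hc' (i + j)) as [N [h1 [h2 h3]]].
    rewrite (proj1 (h3 i ltac:(lia))), (proj2 (h3 j ltac:(lia))).
    destruct (hfg N) as [[_ [_ [_ [_ [_ [_ h4]]]]]] _]; apply h4; lia.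
  - intros i; destruct (hc' i) as [N [h1 [h2 h3]]].
    destruct (h3 i (le_n _)) as [-> ->]; destruct (hfg N) as [[h4 [h5 _]] _].
    split; [apply h4|apply h5]; lia.
  - intros i j i' j' ha ha' hi hj; destruct (hc' (i' + j)) as [N [h1 [h2 h3]]].
    rewrite (proj1 (h3 i ltac:(lia))), (proj2 (h3 j ltac:(lia))) in ha.
    rewrite (proj1 (h3 i' ltac:(lia))), (proj2 (h3 j' ltac:(lia))) in ha'.
    apply (shortest_linkage_cross (hfg N)); trivial; lia.
Qed.

(** The set [A] has one end, and [a], [b] can be linked to it by disjoint paths. *)
Lemma one_ended_unavoidable (G : graph) (A : G -> Prop) (a b : G) :
  locally_finite G ->
  (forall F : list G, exists F' : list G, forall x y,
    A x -> A y -> ~ In x F' -> ~ In y F' -> conn (fun z => ~ In z F) x y) ->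
  (forall F : list G, exists S1 S2 : G -> Prop,
    (forall x, S1 x -> A x) /\ (forall x, S2 x -> A x) /\ (forall x, S1 x -> ~ S2 x) /\
    (exists y, ~ In y F /\ conn S1 a y) /\ (exists y, ~ In y F /\ conn S2 b y)) ->
  unavoidable G.
Proof.
  intros hl hend hlink.
  destruct (clean_rays_exist G A a b hl) as [P [Q [hP [hQ [hd [hA hcr]]]]]].
  - intros F; destruct (hlink F) as [S1 [S2 [h1 [h2 [h3 [[y [h4 h5]] [y' [h6 h7]]]]]]]].
    apply conn_walk in h5 as [f [m [[f1 f2] [f3 f4]]]], h7 as [g [n [[g1 g2] [g3 g4]]]].
    exists f, m, g, n; split; [split; auto|]; split; [split; auto|].
    split; [assumption|]; split; [assumption|].
    rewrite f4, g4; split; [assumption|]; split; [assumption|].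
    intros i j hi hj e; apply (h3 (f i)); [auto|]; rewrite e; auto.
  - apply (clean_rays_unavoidable G P Q); trivial; intros F.
    destruct (hend F) as [F' hF'].
    destruct (injective_bound P F' (proj1 (proj1 hP))) as [i hi].
    destruct (injective_bound Q F' (proj1 (proj1 hQ))) as [j hj].
    exists i, j; apply hF'; try apply hA; intros h; [apply hi in h|apply hj in h]; lia.
Qed.

(** * Locally finite graphs *)

(** The centre of a star would have infinitely many neighbours. *)
Lemma locally_finite_comb (G : graph) (A U : G -> Prop) r lev anc :
  locally_finite G -> geodesic_tree A r lev anc -> (forall u, U u -> A u) -> infset U ->
  exists R, R 0 = r /\ (forall n, A (R n) /\ lev (R n) = n /\ adj (R n) (R (S n))) /\
    (forall n, infset (fun u => U u /\ n <= lev u /\ anc u n = R n)).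
Proof.
  intros hl ht hUA hU.
  destruct (star_or_comb A U r lev anc ht hUA hU) as [[x [u [hx [hu hne]]]]|h]; [|exact h].
  exfalso; destruct ht as [_ [_ [_ [_ [_ [hstep _]]]]]].
  assert (hinf : infset (adj x)).
  { apply (infset_image (fun n => anc (u n) (S (lev x))) (fun _ => True)).
    - intros n m e; apply NNPP; intros h; now apply (hne n m h).
    - intros N; exists N; split; [lia|easy].
    - intros n _; destruct (hu n) as [h1 [h2 h3]]; rewrite <- h3 at 1; apply hstep; auto. }
  destruct (hl x) as [l h]; destruct (hinf l) as [y [h1 h2]]; auto.
Qed.

Lemma ray_conn {G : graph} (A : G -> Prop) (R : nat -> G) i j :
  ray G R -> (forall n, i <= n -> A (R n)) -> i <= j -> conn A (R i) (R j).
Proof.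
  intros [_ hR] hA hij; induction hij as [|j hij IH]; [apply conn_refl; auto|].
  eapply conn_step; [exact IH|apply hR|apply hA; lia].
Qed.

(** Only finitely many of the paths meet [F]; every later one leads to a far vertex of [R] outside
    [F]. So [F'] consists of an initial piece of [R] and the early paths, and [R N] is a common
    meeting point. *)
Lemma one_ended_union (G : graph) (R : nat -> G) (z : nat -> nat -> G) (k : nat -> nat) :
  ray G R ->
  (forall n i, i < k n -> adj (z n i) (z n (S i))) ->
  (forall n, exists j, n <= j /\ adj (z n (k n)) (R j)) ->
  (forall y, exists M, forall n, on_path (z n) (k n) y -> n < M) ->
  forall F : list G, exists F' : list G, forall x y,
    (on_ray R x \/ exists n, on_path (z n) (k n) x) ->
    (on_ray R y \/ exists n, on_path (z n) (k n) y) ->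
    ~ In x F' -> ~ In y F' -> conn (fun v => ~ In v F) x y.
Proof.
  intros hR hz hzR hfin F.
  destruct (injective_bound R F (proj1 hR)) as [B hB].
  destruct (bound_list (fun y n => on_path (z n) (k n) y) F) as [B' hB'].
  { intros y _; apply hfin. }
  set (N := B + B').
  assert (key : forall x, (on_ray R x \/ exists n, on_path (z n) (k n) x) ->
    ~ In x (map R (seq 0 N) ++ flat_map (fun n => map (z n) (seq 0 (S (k n)))) (seq 0 N)) ->
    conn (fun v => ~ In v F) x (R N)).
  { assert (hRN : forall j, N <= j -> conn (fun v => ~ In v F) (R j) (R N)).
    { intros j hj; apply conn_sym, ray_conn; trivial.
      intros n hn h; apply hB in h; lia. }
    intros x [[i ->]|[n [i [hi ->]]]] hx; rewrite in_app_iff in hx.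
    - apply hRN; destruct (le_lt_dec N i); [assumption|].
      exfalso; apply hx; left; apply in_map_seq; exists i; split; [lia|easy].
    - assert (hn : N <= n).
      { destruct (le_lt_dec N n); [assumption|]; exfalso; apply hx; right.
        apply in_flat_map; exists n; split; [apply in_seq; lia|].
        apply in_map_seq; exists i; split; [lia|easy]. }
      destruct (hzR n) as [j [hj ha]].
      assert (hzF : forall i, i <= k n -> ~ In (z n i) F).
      { intros i' hi' h; enough (n < B') by lia; apply (hB' _ n h); now exists i'. }
      apply conn_trans with (R j); [|apply hRN; lia].
      eapply conn_step; [|exact ha|].
      + apply (walk_conn _ (z n) (k n)); trivial; split; auto.
      + intros h; apply hB in h; lia. }
  eexists; intros x y hx hy hx' hy'.
  apply conn_trans with (R N); [|apply conn_sym]; apply key; eassumption.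
Qed.

(** The second ray is a geodesic ray in the component of [c] outside [R], chosen
    so that its vertices lead to infinitely many neighbours of [R]. *)
Lemma unbounded_component (G : graph) (R : nat -> G) (c : G) :
  locally_finite G -> ray G R -> ~ on_ray R c ->
  unbounded (fun j => exists y, conn (fun x => ~ on_ray R x) c y /\ adj y (R j)) ->
  unavoidable G.
Proof.
  intros hl hR hc hunb; set (A := conn (fun x => ~ on_ray R x) c).
  assert (hAR : forall x, A x -> ~ on_ray R x) by (intros x hx; apply (conn_in _ _ _ hx)).
  destruct (geodesic_tree_exists A c) as [lev [anc ht]].
  { now apply conn_refl. }
  { intros x hx; now apply conn_reach. }
  destruct (locally_finite_comb G A (fun y => A y /\ exists j, adj y (R j)) c lev anc hl ht)
    as [X [hX0 [hX hinf]]].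
  { intros u hu; apply hu. }
  { intros l; destruct (neighbours_list G hl l) as [l' hl'].
    destruct (injective_bound R l' (proj1 hR)) as [B hB].
    destruct (hunb B) as [j [hj [y [hy ha]]]]; exists y; split; [eauto|].
    intros hin; specialize (hB j (hl' y _ hin ha)); lia. }
  pose proof ht as [_ [_ [hlip [hanc [hself [hstep _]]]]]].
  assert (hXray : induced_ray G X) by now apply (geodesic_ray A lev).
  destruct (choice_fun (fun n u => A u /\ n <= lev u /\ anc u n = X n /\
    exists j, n <= j /\ adj u (R j))) as [u hu].
  { intros n; destruct (neighbours_list G hl (map R (seq 0 n))) as [l hl'].
    destruct (hinf n l) as [u [[[hu1 [j hj]] [hu2 hu3]] hu4]].
    exists u; repeat split; trivial; exists j; split; [|assumption].
    destruct (le_lt_dec n j); [assumption|]; exfalso; apply hu4, (hl' (R j)).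
    - apply in_map_seq; exists j; split; [lia|easy].
    - now apply adj_sym. }
  set (z := fun n i => anc (u n) (n + i)); set (k := fun n => lev (u n) - n).
  set (L := fun x => on_ray R x \/ exists n, on_path (z n) (k n) x).
  apply (one_ended_unavoidable G L (R 0) (X 0) hl).
  - apply one_ended_union; trivial.
    + intros n i hi; unfold z, k in *; replace (n + S i) with (S (n + i)) by lia.
      apply hstep; [apply hu|lia].
    + intros n; destruct (hu n) as [h1 [h2 [h3 [j [h4 h5]]]]]; exists j; split; [assumption|].
      unfold z, k; replace (n + (lev (u n) - n)) with (lev (u n)) by lia.
      now rewrite hself.
    (* All vertices of [z n] have level at least [n], so each vertex lies on finitely many of these
       paths. *)
    + intros y; exists (S (lev y)); intros n [i [hi ->]]; unfold z, k in *.
      destruct (hu n) as [h1 [h2 _]]; rewrite (proj2 (hanc (u n) (n + i) h1 ltac:(lia))); lia.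
  (* The two disjoint ways to infinity are [R] and [X]; the latter lies in [L] because [X n] is the
     first vertex of [z n]. *)
  - intros F; exists (on_ray R), (on_ray X); split; [|split; [|split; [|split]]].
    + now left.
    + intros x [n ->]; right; exists n, 0; split; [lia|]; unfold z; rewrite Nat.add_0_r.
      symmetry; apply hu.
    + intros x hx [n ->]; now apply (hAR (X n)); [apply hX|].
    + destruct (injective_bound R F (proj1 hR)) as [B hB]; exists (R B); split.
      * intros h; apply hB in h; lia.
      * apply ray_conn; trivial; [|lia]; intros n _; now exists n.
    + destruct (injective_bound X F (proj1 (proj1 hXray))) as [B hB]; exists (X B); split.
      * intros h; apply hB in h; lia.
      * apply ray_conn; [apply hXray| |lia]; intros n _; now exists n.
Qed.

(** [t] can be reached from [a] and from [b] by paths disjoint except for [t]. *)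
Definition fan_to {G : graph} (L : G -> Prop) (a b t : G) :=
  exists S1 S2 : G -> Prop,
    (forall x, S1 x -> L x) /\ (forall x, S2 x -> L x) /\ (forall x, S1 x -> ~ S2 x) /\
    ~ S1 t /\ ~ S2 t /\ (exists y, conn S1 a y /\ adj y t) /\ exists y, conn S2 b y /\ adj y t.

Lemma fan_to_sym {G : graph} (L : G -> Prop) (a b t : G) : fan_to L a b t -> fan_to L b a t.
Proof.
  intros [S1 [S2 [h1 [h2 [h3 [h4 [h5 [h6 h7]]]]]]]]; exists S2, S1.
  repeat split; trivial; intros x hx hx'; now apply (h3 x).
Qed.

(** The path from [b] is prolonged through [t] to [t'], while [a] reaches [t'] by the given
    connection avoiding [t] and [S2]. *)
Lemma fan_to_extend {G : graph} (L S2 : G -> Prop) (a b t t' : G) :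
  (forall x, S2 x -> L x) -> ~ S2 t -> (exists y, conn S2 b y /\ adj y t) ->
  L t -> adj t t' -> a <> t' ->
  conn (fun x => L x /\ x <> t /\ ~ S2 x) t' a -> fan_to L a b t'.
Proof.
  intros h1 h2 [y [h3 h4]] h5 h6 h7 h8; pose proof (conn_in _ _ _ h8) as [h9 _].
  destruct (conn_before _ a t' (conn_sym _ _ _ h8) h7) as [z [h10 h11]].
  exists (fun x => (L x /\ x <> t /\ ~ S2 x) /\ x <> t'), (fun x => S2 x \/ x = t).
  split; [|split; [|split; [|split; [|split; [|split]]]]].
  - intros x hx; apply hx.
  - intros x [hx| ->]; auto.
  - intros x [[_ [hx1 hx2]] _] [hx| ->]; auto.
  - intros [_ h]; now apply h.
  - intros [h| ->]; [now apply h9|now apply adj_irrefl in h6].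
  - now exists z.
  - exists t; split; [|assumption]; apply conn_step with y; trivial; [|now right].
    revert h3; apply conn_mono; auto.
Qed.

Lemma first_hit {G : graph} (A C : G -> Prop) x y : conn A x y -> C y ->
  exists w, C w /\ conn (fun v => A v /\ (C v -> v = w)) x w.
Proof.
  intros h hy.
  destruct (shortest A (fun v => v = x) C) as [f [n [h1 [<- [h3 [_ [h5 _]]]]]]]; [eauto|].
  exists (f n); split; [assumption|].
  apply (walk_conn _ f n); try lia; split; [|apply h1].
  intros i hi; split; [now apply h1|]; intros hC; now rewrite (h5 i hi hC).
Qed.

(** A path from [t'] towards [a] avoiding [t] is followed to its first vertex [w] on the old fan.
    The old route containing [w] then turns off to [t'] there, and the other one is prolonged
    through [t]. *)
Lemma fan_to_step {G : graph} (L : G -> Prop) (a b t t' : G) :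
  fan_to L a b t -> L t -> adj t t' -> a <> t' -> b <> t' ->
  conn (fun x => L x /\ x <> t) t' a -> fan_to L a b t'.
Proof.
  intros [S1 [S2 [h1 [h2 [h3 [h4 [h5 [[y1 [h6 h6']] [y2 [h7 h7']]]]]]]]]] ht htt ha hb hc.
  destruct (first_hit _ (fun x => conn S1 a x \/ conn S2 b x) _ _ hc) as [w [hw hcw]].
  { left; apply conn_refl, (conn_in _ _ _ h6). }
  assert (in1 : forall x, conn S1 a x -> S1 x) by (intros x hx; apply (conn_in _ _ _ hx)).
  assert (in2 : forall x, conn S2 b x -> S2 x) by (intros x hx; apply (conn_in _ _ _ hx)).
  destruct hw as [hw|hw].
  - apply (fan_to_extend L (conn S2 b) a b t t'); auto.
    + exists y2; split; [now apply conn_reach|assumption].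
    + apply conn_trans with w.
      * revert hcw; apply conn_mono; intros x [[e1 e2] e3]; repeat split; trivial.
        intros hx; rewrite (e3 (or_intror hx)) in hx; apply (h3 w); auto.
      * apply conn_sym in hw; revert hw; apply conn_mono; intros x hx.
        repeat split; [auto|intros ->; auto|]; intros hx'; apply (h3 x); auto.
  - apply fan_to_sym, (fan_to_extend L (conn S1 a) b a t t'); auto.
    + exists y1; split; [now apply conn_reach|assumption].
    + apply conn_trans with w.
      * revert hcw; apply conn_mono; intros x [[e1 e2] e3]; repeat split; trivial.
        intros hx; rewrite (e3 (or_introl hx)) in hx; apply (h3 w); auto.
      * apply conn_sym in hw; revert hw; apply conn_mono; intros x hx.
        repeat split; [auto|intros ->; auto|]; intros hx'; apply (h3 x); auto.
Qed.

(** Here [R] together with one jump over each of its vertices has one end. *)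
Lemma bounded_components (G : graph) (R : nat -> G) :
  two_connected G -> locally_finite G -> induced_ray G R ->
  (forall c, ~ on_ray R c -> exists M, forall y j,
    conn (fun x => ~ on_ray R x) c y -> adj y (R j) -> j < M) ->
  unavoidable G.
Proof.
  intros h2 hl hR hbd.
  (* [z n] is the interior of a jump over [R (S n)]: it exists by 2-connectedness and is nonempty
     because [R] is induced. *)
  destruct (choice_fun (fun n (zk : (nat -> G) * nat) => let (z, k) := zk in
    walk (fun x => ~ on_ray R x) z k /\ (exists a, a <= n /\ adj (R a) (z 0)) /\
    exists b, S (S n) <= b /\ adj (z k) (R b))) as [zk hzk].
  { intros n.
    destruct (shortest (fun x => x <> R (S n)) (fun x => exists a, a <= n /\ x = R a)
      (fun x => exists b, S (S n) <= b /\ x = R b))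
      as [f [m [hw [[a [ha1 ha2]] [[b [hb1 hb2]] [hx [hy _]]]]]]].
    { exists (R n), (R (S (S n))); split; [eauto|]; split; [eauto|].
      apply two_connected_conn; trivial; intros e; apply ray_inj in e; trivial; lia. }
    destruct m as [|[|m]].
    { rewrite ha2 in hb2; apply ray_inj in hb2; [lia|assumption]. }
    { assert (h : adj (f 0) (f 1)) by (apply hw; lia).
      rewrite ha2, hb2 in h; apply ray_step in h; [lia|assumption]. }
    exists ((fun i => f (S i)), m); split; [split|split].
    - intros i hi [j e]; assert (j <= n \/ j = S n \/ S (S n) <= j) as [hj|[->|hj]] by lia.
      + assert (S i = 0) by (apply hx; [lia|eauto]); lia.
      + revert e; apply hw; lia.
      + assert (S i = S (S m)) by (apply hy; [lia|eauto]); lia.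
    - intros i hi; apply hw; lia.
    - exists a; split; [assumption|]; rewrite <- ha2; apply hw; lia.
    - exists b; split; [assumption|]; rewrite <- hb2; apply hw; lia. }
  set (z := fun n => fst (zk n)); set (k := fun n => snd (zk n)).
  assert (hz : forall n, walk (fun x => ~ on_ray R x) (z n) (k n) /\
    (exists a, a <= n /\ adj (R a) (z n 0)) /\
    exists b, S (S n) <= b /\ adj (z n (k n)) (R b)).
  { intros n; specialize (hzk n); unfold z, k; destruct (zk n); exact hzk. }
  clearbody z k; clear zk hzk.
  set (L := fun x => on_ray R x \/ exists n, on_path (z n) (k n) x).
  assert (LR : forall i, L (R i)) by (intros i; left; now exists i).
  (* The jump over [R (S n)] leads from the part of [R] beyond it back to the part before it, inside
     [L]. *)
  assert (back : forall n, conn (fun x => L x /\ x <> R (S n)) (R (S (S n))) (R 0)).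
  { intros n; destruct (hz n) as [hw [[a [ha1 ha2]] [b [hb1 hb2]]]].
    assert (hRR : forall i j, (j <= n \/ S (S n) <= i) -> i <= j ->
      conn (fun x => L x /\ x <> R (S n)) (R i) (R j)).
    { intros i j hd hij; replace j with (i + (j - i)) by lia.
      rewrite <- (Nat.add_0_r i) at 1.
      apply (walk_conn _ (fun p => R (i + p)) (j - i)); try lia; split.
      - intros p hp; split; [apply LR|]; intros e; apply ray_inj in e; trivial; lia.
      - intros p hp; replace (i + S p) with (S (i + p)) by lia; now apply ray_adj. }
    assert (hzL : forall i, i <= k n -> L (z n i) /\ z n i <> R (S n)).
    { intros i hi; split; [right; exists n; now exists i|].
      intros e; apply (proj1 hw i hi); now exists (S n). }
    apply conn_trans with (R b); [apply hRR; lia|].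
    apply conn_trans with (z n (k n)).
    { apply conn_edge; [|apply hzL; lia|now apply adj_sym].
      split; [apply LR|]; intros e; apply ray_inj in e; trivial; lia. }
    apply conn_trans with (z n 0).
    { apply (walk_conn _ (z n) (k n)); try lia; split; [exact hzL|apply hw]. }
    apply conn_trans with (R a); [|apply conn_sym, hRR; lia].
    apply conn_edge; [apply hzL; lia| |now apply adj_sym].
    split; [apply LR|]; intros e; apply ray_inj in e; trivial; lia. }
  assert (hfan : forall n, fan_to L (R 0) (R 1) (R (S (S n)))).
  { induction n as [|n IH].
    - destruct (conn_before _ (R 0) (R 2) (conn_sym _ _ _ (back 0))) as [y [h3 h4]].
      { intros e; apply ray_inj in e; trivial; discriminate. }
      exists (fun x => (L x /\ x <> R 1) /\ x <> R 2), (fun x => x = R 1).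
      split; [intros x hx; apply hx|]; split; [intros x ->; apply LR|].
      split; [intros x [[_ hx] _]; exact hx|]; split; [intros [_ h]; now apply h|].
      split; [intros e; apply ray_inj in e; trivial; discriminate|].
      split; [now exists y|]; exists (R 1); split; [now apply conn_refl|now apply ray_adj].
    - apply (fan_to_step L (R 0) (R 1) (R (S (S n)))); trivial.
      + now apply ray_adj.
      + intros e; apply ray_inj in e; trivial; lia.
      + intros e; apply ray_inj in e; trivial; lia. }
  apply (one_ended_unavoidable G L (R 0) (R 1) hl).
  - apply one_ended_union; [apply hR|intros n; apply hz| |].
    + intros n; destruct (hz n) as [_ [_ [b [hb1 hb2]]]]; exists b; split; [lia|assumption].
    + intros y; destruct (classic (on_ray R y)) as [hy|hy].
      * exists 0; intros n [i [hi ->]]; exfalso; now apply (proj1 (proj1 (hz n)) i hi).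
      (* The jump [n] attaches to [R] at some index [b >= n + 2]; if it contains [y], then [b] is
         bounded by the reach of the component of [y]. *)
      * destruct (hbd y hy) as [M hM]; exists M; intros n [i [hi ->]].
        destruct (hz n) as [hw [_ [b [hb1 hb2]]]].
        assert (b < M); [|lia]; apply (hM (z n (k n))); [|assumption].
        apply (walk_conn _ (z n) (k n)); trivial.
  - intros F; destruct (neighbours_list G hl F) as [l hl'].
    destruct (injective_bound R l (proj1 (proj1 hR))) as [B hB].
    (* The last vertices before [R (S (S B))] on the two paths of the fan are outside [F], since
       neighbours of [F] on [R] have index below [B]. *)
    destruct (hfan B) as [S1 [S2 [h3 [h4 [h5 [_ [_ [[y1 [h6 h7]] [y2 [h8 h9]]]]]]]]]].
    exists S1, S2; split; [assumption|]; split; [assumption|]; split; [assumption|].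
    assert (hF : forall y, adj y (R (S (S B))) -> ~ In y F).
    { intros y ha hin; specialize (hB _ (hl' _ _ hin ha)); lia. }
    split; [exists y1|exists y2]; auto.
Qed.

Theorem theorem1p7 (G : graph) (G_infinite : infinite G)
    (G_two_connected : two_connected G) :
  induced_subgraph K_infty G \/
  exists H : graph, induced_subgraph H G /\
    (clean_ladder H \/
     Theta_infty H \/
     F_infty H \/
     F_Delta_infty H \/
     L_infty H \/
     L_Delta_infty H \/
     L_nabla_Delta_infty H).
Proof.
  change (unavoidable G).
  destruct (classic (exists v : G, infset (adj v))) as [[v hv]|hfin].
  { now apply (infinite_degree G v). }
  assert (hl : locally_finite G).
  { intros v; apply NNPP; intros hn; apply hfin; exists v; intros l.
    apply NNPP; intros hn'; apply hn; exists l; intros y hy.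
    apply NNPP; intros hy'; apply hn'; now exists y. }
  assert (hinf : infset (fun _ : G => True)).
  { intros l; apply NNPP; intros hn; apply G_infinite; exists l; intros x.
    apply NNPP; intros hx; apply hn; now exists x. }
  destruct (hinf []) as [r _].
  assert (hconn : forall x, conn (fun _ : G => True) r x).
  (* Connectedness of [G] itself: [r] and [x] are joined even after deleting a third vertex, which
     exists because [G] is infinite. *)
  { intros x; destruct (hinf [r; x]) as [v [_ hv]].
    assert (h : conn (fun y => y <> v) r x).
    { apply two_connected_conn; trivial; intros ->; apply hv; simpl; auto. }
    revert h; now apply conn_mono. }
  destruct (geodesic_tree_exists (fun _ : G => True) r) as [lev [anc ht]]; [easy|auto|].
  destruct (locally_finite_comb G _ (fun _ => True) r lev anc hl ht) as [R [_ [hR _]]];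
    [easy|assumption|].
  assert (hRay : induced_ray G R).
  { apply (geodesic_ray (fun _ => True) lev); [apply ht|exact hR]. }
  destruct (classic (exists c, ~ on_ray R c /\ unbounded (fun j =>
    exists y, conn (fun x => ~ on_ray R x) c y /\ adj y (R j)))) as [[c [hc1 hc2]]|hb].
  - now apply (unbounded_component G R c); [|apply hRay| |].
  - apply (bounded_components G R); trivial.
    intros c hc; destruct (not_unbounded (fun j =>
      exists y, conn (fun x => ~ on_ray R x) c y /\ adj y (R j))) as [M hM].
    + intros h; apply hb; now exists c.
    + exists M; intros y j h1 h2; apply hM; now exists y.
Qed.
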